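(* The sharp (smallest possible) constant $K$ in the inequality $$\|u\|_\infty^2\le K\|u\|_{L_2(0,1)}^{3/2}\|u''\|_{L_2(0,1)}^{1/2},\qquad u\in H^2(0,1)\cap H^1_0(0,1),$$ is $$K=\frac{\sqrt2}{\sqrt[4]{27}}\cdot\coth\frac\pi2=\frac{\sqrt2}{\sqrt[4]{27}}\cdot1.09033\ldots .$$ The unique (up to a constant factor) extremal function is $$u(x)=2\sum_{n=1}^\infty\frac{\sin(\pi nx)\,\sin(\pi n\xi)}{\pi^4n^4+\lambda}\qquad\text{with}\quad\lambda=4\pi^4,\ \ \xi=\tfrac12 .$$
   Context: $\|\cdot\|_\infty$ is the $L_\infty(0,1)$-norm. An extremal function is a non-zero $u\in H^2(0,1)\cap H^1_0(0,1)$ for which the inequality with the sharp constant is an equality. *)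

(* Defs.v *)
From HB Require Import structures.
From mathcomp Require Import all_boot all_order all_algebra.
From mathcomp Require Import all_classical all_reals all_analysis.

Set Implicit Arguments.
Unset Strict Implicit.
Unset Printing Implicit Defensive.
Import Order.TTheory GRing.Theory Num.Theory.
Import numFieldNormedType.Exports.
Local Open Scope classical_set_scope.
Local Open Scope ring_scope.

(* A function on (0,1) is represented by a function R -> R whose values outside
   (0,1) play no role: Lebesgue measure is restricted to (0,1), and equality
   of elements of L_2(0,1) is equality almost everywhere for that measure.
   Membership in Lfun asks for measurability on R, which costs nothing since
   the values outside (0,1) may be taken to be 0. *)
Definition mu01 (R : realType) : {measure set (measurableTypeR R) -> \bar R} :=
  mrestr (@lebesgue_measure R) (measurable_itv `]0%R, 1%R[).

Definition L2_01 (R : realType) : set (R -> R) :=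
  [set u | u \in Lfun (@mu01 R) 2%:E].

Definition normL2 (R : realType) (u : R -> R) : \bar R :=
  'N[@mu01 R]_(2%:E)[EFin \o u].

Definition normLoo (R : realType) (u : R -> R) : \bar R :=
  'N[@mu01 R]_(+oo%E)[EFin \o u].

(* C_c^oo(0,1); a closed subset of R contained in (0,1) is compact. *)
Definition test_function (R : realType) (phi : R -> R) : Prop :=
  (forall (k : nat) (x : R), derivable phi^`(k)%classic x 1) /\
  closure [set x | phi x != 0] `<=` `]0, 1[.

(* v is a k-th weak derivative of u on (0,1), among functions in L_2(0,1). *)
Definition is_weak_derivative (R : realType) (k : nat) (u v : R -> R) : Prop :=
  L2_01 v /\
  forall phi : R -> R, test_function phi ->
    \int[@mu01 R]_x (u x * phi^`(k)%classic x) =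
    (-1) ^+ k * \int[@mu01 R]_x (v x * phi x).

Definition weak_derivative (R : realType) (k : nat) (u : R -> R) : R -> R :=
  xget (cst 0) [set v | is_weak_derivative k u v].

Definition sobolevH (R : realType) (m : nat) : set (R -> R) :=
  [set u | L2_01 u /\
    forall k, (k <= m)%N -> exists v, is_weak_derivative k u v].

(* H^1_0(0,1): closure of C_c^oo(0,1) in the (equivalent) H^1(0,1) norm
   |w|_2 + |w'|_2. *)
Definition sobolevH10 (R : realType) : set (R -> R) :=
  [set u | sobolevH 1 u /\
    forall eps : R, 0 < eps -> exists2 phi : R -> R, test_function phi &
      (normL2 (u \- phi)%R +
       normL2 (weak_derivative 1 u \- phi^`()%classic)%R < eps%:E)%E].

Definition H2_H10 (R : realType) : set (R -> R) :=
  @sobolevH R 2 `&` @sobolevH10 R.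

Definition inequality_lhs (R : realType) (u : R -> R) : \bar R :=
  (normLoo u ^+ 2)%E.

Definition inequality_rhs (R : realType) (C : R) (u : R -> R) : \bar R :=
  (C%:E * (normL2 u `^ (3 / 2)%R) *
     (normL2 (weak_derivative 2 u) `^ (1 / 2)%R))%E.

Definition is_sharp_constant (R : realType) (K : R) : Prop :=
  (forall u : R -> R, H2_H10 u ->
     (inequality_lhs u <= inequality_rhs K u)%E) /\
  (forall C : R,
     (forall u : R -> R, H2_H10 u ->
        (inequality_lhs u <= inequality_rhs C u)%E) ->
     K <= C).

Definition ae_eq01 (R : realType) (u v : R -> R) : Prop :=
  {ae @mu01 R, forall x, u x = v x}.

Definition is_extremal (R : realType) (K : R) (u : R -> R) : Prop :=
  [/\ H2_H10 u,
      ~ ae_eq01 u (cst 0) &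
      inequality_lhs u = inequality_rhs K u].

Definition coth (R : realType) (x : R) : R :=
  (expR x + expR (- x)) / (expR x - expR (- x)).

Definition green_series (R : realType) (lambda xi : R) (x : R) : R :=
  2 * limn (fun N : nat => \sum_(1 <= n < N)
         (sin (pi * n%:R * x) * sin (pi * n%:R * xi)
            / (pi ^+ 4 * n%:R ^+ 4 + lambda)) : R).

(* Main.v *)
Require Import Defs.
From mathcomp Require Import all_boot all_order all_algebra.
From mathcomp Require Import all_classical all_reals all_analysis measurable_realfun ess_sup_inf.
From mathcomp Require Import ring lra.
Set Implicit Arguments.
Unset Strict Implicit.
Unset Printing Implicit Defensive.
Import Order.TTheory GRing.Theory Num.Theory.
Import numFieldNormedType.Exports.
Local Open Scope classical_set_scope.
Local Open Scope ring_scope.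

(** Write s = coth (pi / 2).  The inequality is equivalent, by optimising over
    b > 0, to the family

      8 b^3 |u|_oo^2 <= s (|u''|_2^2 + 4 b^4 |u|_2^2),

    since the right-hand side divided by b^3 is smallest when
    4 b^4 |u|_2^2 = 3 |u''|_2^2, where it gives exactly the constant K
    (balanced_bound).

    A function u of H^2 and H^1_0 has a classical representative: u is C^1 with
    an absolutely continuous derivative and vanishes at 0 and 1
    (H2_H10_rep).  If |u| is maximal at xi, then u'(xi) = 0, so u can be studied
    separately on [0, xi] and [xi, 1].  On an interval of length L, let g be the
    solution of g'''' = - 4 b^4 g with g = g'' = 0 at the outer end and g' = 0
    at xi.  Completing the square of the energy int (u'')^2 + 4 b^4 u^2 around the
    multiple of g that agrees with u at xi, all cross terms are boundary terms,
    and the energy is at least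

      4 b^3 u(xi)^2 (cosh t + cos t) / (sinh t - sin t),   t = 2 b L

    (half_estimate).  The quotient (sinh t - sin t) / (cosh t + cos t) has its
    maximum s over t > 0 at t = pi and only there (profile_ratio_lt), which gives
    the inequality by adding the two halves (split_estimate), whatever xi is.
    Equality forces 2 b xi = 2 b (1 - xi) = pi, hence xi = 1/2 and b = pi, and
    makes u a multiple of g on each half.

    It remains to see that the sine series of the statement is such a function.
    The two profiles glue to a C^2 function green0 whose third derivative jumps
    at 1/2, so that pairing with it in the energy evaluates at 1/2
    (green_reproducing).  The energy of the difference between a partial sum and
    the normalised green0 is then the value of the difference at 1/2
    (sine_residual).  That value tends to 0 because the sum of 1 / (n^4 + 4) over
    odd n is (pi / 16) s (sine_sum_mid, coth_partial_sum).  A small energy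
    controls the C^1 norm, so the series converges to the normalised green0
    together with its first derivative.  Cutting off the partial sums near 0 and
    1 approximates green0 by test functions, so that the limit is in H^1_0
    (green_lim_H10), and its two norms are related by green_equipartition. *)

(** * Integrals over compact intervals and primitives *)

Section interval_integral.
Context {R : realType}.
Implicit Types (a b c d x : R) (f g F G w P : R -> R).
Local Notation mu := (@lebesgue_measure R).

(** Not an oriented integral: intab a b f vanishes when b < a. *)
Definition intab a b f : R := \int[mu]_(x in `[a, b]) f x.
Definition itg a b f : Prop := mu.-integrable `[a, b] (EFin \o f).

Lemma itg_within a b f : {within `[a, b], continuous f} -> itg a b f.
Proof.
by move=> cf; apply: continuous_compact_integrable => //; exact: segment_compact.
Qed.

Lemma itg_continuous a b f : continuous f -> itg a b f.
Proof. by move=> cf; apply: itg_within; exact: continuous_subspaceT. Qed.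

Lemma itg_sub a b c d f : a <= c -> d <= b -> itg a b f -> itg c d f.
Proof.
move=> ac db; apply: integrableS => //.
by apply: subset_itvScc; rewrite bnd_simp.
Qed.

Lemma itg_eq a b f g : (forall x, a <= x <= b -> f x = g x) ->
  itg a b f -> itg a b g.
Proof.
move=> fg; rewrite /itg; apply: eq_integrable => //= x.
by rewrite inE /= in_itv /= => /fg ->.
Qed.

Lemma itgD a b f g : itg a b f -> itg a b g -> itg a b (fun x => f x + g x).
Proof.
by move=> hf hg; have := @integrableD _ _ _ mu _ _ _ _ hf hg; apply.
Qed.

Lemma itgZ a b f c : itg a b f -> itg a b (fun x => c * f x).
Proof.
by move=> hf; have := @integrableZl _ _ _ mu _ _ c _ hf; apply.
Qed.

Lemma itgB a b f g : itg a b f -> itg a b g -> itg a b (fun x => f x - g x).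
Proof.
move=> hf hg; have := itgD (itgZ (-1) hg) hf.
by apply: itg_eq => x _; rewrite mulN1r addrC.
Qed.

Lemma itg_mfun a b f : itg a b f -> measurable_fun `[a, b] f.
Proof. by move=> hf; apply/measurable_EFinP; exact: measurable_int hf. Qed.

Lemma itgM_bounded a b f g : itg a b f -> measurable_fun `[a, b] g ->
  (exists M : R, forall x, a <= x <= b -> `|g x| <= M) ->
  itg a b (fun x => f x * g x).
Proof.
move=> hf mg [M gM]; apply: (@le_integrable _ _ _ mu _ _ _ (EFin \o (fun x => M * f x))) => //.
- apply/measurable_EFinP; apply: measurable_funM => //; exact: itg_mfun.
- move=> x /=; rewrite in_itv /= => xab; rewrite lee_fin !normrM mulrC.
  by apply: ler_wpM2r => //; rewrite (le_trans (gM _ xab))// ler_norm.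
- exact: itgZ.
Qed.

Lemma bounded_within a b f : {within `[a, b], continuous f} ->
  exists M : R, forall x, a <= x <= b -> `|f x| <= M.
Proof.
move=> cf; have [ab|ba] := leP a b; last first.
  by exists 0 => x /andP[ax xb]; move: (le_trans ax xb); rewrite leNgt ba.
have cn : {within `[a, b], continuous (fun x => `|f x|)}.
  apply: (@within_continuous_comp _ _ _ _ f (fun y => `|y|)) => // x _.
  exact: norm_continuous.
have [c _ hc] := EVT_max ab cn.
by exists `|f c| => x xab; apply: hc; rewrite in_itv.
Qed.

Lemma itgMc a b f g : itg a b f -> {within `[a, b], continuous g} ->
  itg a b (fun x => f x * g x).
Proof.
move=> hf cg; apply: itgM_bounded => //; last exact: bounded_within.
by apply: itg_mfun; apply: itg_within.
Qed.

Lemma eq_intab a b f g : (forall x, a <= x <= b -> f x = g x) ->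
  intab a b f = intab a b g.
Proof.
by move=> fg; apply: eq_Rintegral => x; rewrite inE /= in_itv /= => /fg.
Qed.

Lemma intabD a b f g : itg a b f -> itg a b g ->
  intab a b (fun x => f x + g x) = intab a b f + intab a b g.
Proof. by move=> hf hg; rewrite /intab RintegralD. Qed.

Lemma intabB a b f g : itg a b f -> itg a b g ->
  intab a b (fun x => f x - g x) = intab a b f - intab a b g.
Proof. by move=> hf hg; rewrite /intab RintegralB. Qed.

Lemma intabZ a b f c : itg a b f ->
  intab a b (fun x => c * f x) = c * intab a b f.
Proof. by move=> hf; rewrite /intab RintegralZl. Qed.

Lemma intab_cst a b c : a <= b -> intab a b (fun=> c) = c * (b - a).
Proof.
move=> ab; rewrite /intab Rintegral_cst//.
have := @lebesgue_measure_itv R `[a, b]; rewrite /= lte_fin => ->.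
move: ab; rewrite le_eqVlt => /predU1P[->|->]; first by rewrite ltxx subrr.
by [].
Qed.

Lemma le_intab a b f g : itg a b f -> itg a b g ->
  (forall x, a <= x <= b -> f x <= g x) -> intab a b f <= intab a b g.
Proof.
by move=> hf hg fg; apply: le_Rintegral => // x; rewrite /= in_itv; exact: fg.
Qed.

Lemma intab_ge0 a b f : (forall x, a <= x <= b -> 0 <= f x) -> 0 <= intab a b f.
Proof. by move=> f0; apply: Rintegral_ge0 => x; rewrite /= in_itv; exact: f0. Qed.

Lemma intab_xx a f : intab a a f = 0.
Proof. by rewrite /intab set_itv1 Rintegral_set1. Qed.

Lemma intab_split a b c f : itg a b f -> a <= c -> c <= b ->
  intab a b f = intab a c f + intab c b f.
Proof.
move=> hf ac cb; apply/eqP; rewrite addrC -subr_eq; apply/eqP.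
rewrite /intab Rintegral_itvB ?bnd_simp//.
rewrite Rintegral_itv_obnd_cbnd//.
by apply: integrableS hf => //; apply: subset_itv; rewrite bnd_simp.
Qed.

Lemma le_norm_intab a b f : itg a b f ->
  `|intab a b f| <= intab a b (fun x => `|f x|).
Proof. by move=> hf; apply: le_normr_Rintegral. Qed.

Lemma itg_norm a b f : itg a b f -> itg a b (fun x => `|f x|).
Proof. by move=> hf; have := @integrable_norm _ _ _ mu _ _ hf; apply. Qed.

Lemma derive_continuous F f : (forall x, is_derive x 1 F (f x)) -> continuous F.
Proof.
by move=> h x; apply: differentiable_continuous; apply/derivable1_diffP; have [] := h x.
Qed.

Lemma intab_FTC a b F f : a <= b -> (forall x, is_derive x 1 F (f x)) ->
  continuous f -> intab a b f = F b - F a.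
Proof.
rewrite le_eqVlt => /predU1P[<- _ _|ab dF cf]; first by rewrite intab_xx subrr.
have cF := derive_continuous dF.
rewrite /intab /Rintegral (continuous_FTC2 ab _ (F := F)) //.
- exact: continuous_subspaceT.
- split=> [x _||]; first by have [] := dF x.
  + exact/cvg_at_right_filter/cF.
  + exact/cvg_at_left_filter/cF.
- by move=> x _; rewrite derive1E; have [_ ->] := dF x.
Qed.

Lemma intab_primitive_within a b w : a <= b -> itg a b w ->
  {within `[a, b], continuous (fun x => intab a x w)}.
Proof. exact: parameterized_integral_continuous. Qed.

(** Absolute continuity: w is only integrable, so P need not be differentiable
    at any given point. *)
Definition prim a b P w := itg a b w /\
  forall x, a <= x <= b -> P x = P a + intab a x w.

Lemma prim_within a b P w : a <= b -> prim a b P w ->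
  {within `[a, b], continuous P}.
Proof.
move=> ab [hw hP].
have h : {within `[a, b], continuous (fun x => P a + intab a x w)}.
  apply: (@within_continuousD _ _ _ _ (fun=> P a) (fun x => intab a x w)).
    by apply: continuous_subspaceT => x; exact: cst_continuous.
  exact: intab_primitive_within.
apply: (subspace_eq_continuous _ h) => x.
by rewrite inE/= in_itv/= => xab; rewrite /from_subspace /= (hP x xab).
Qed.

Lemma prim_sub a b c d P w : a <= c -> d <= b -> prim a b P w -> prim c d P w.
Proof.
move=> ac db [hw hP]; split; first exact: itg_sub hw.
move=> x /andP[cx xd].
rewrite (hP x) ?(le_trans ac cx) ?(le_trans xd db)//.
rewrite (hP c) ?ac ?(le_trans cx) ?(le_trans xd)//.
by rewrite (@intab_split a x c) ?addrA//; apply: itg_sub hw => //; exact: le_trans db.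
Qed.

Lemma prim_C1 a b F f : (forall x, is_derive x 1 F (f x)) -> continuous f ->
  prim a b F f.
Proof.
move=> dF cf; split; first exact: itg_continuous.
by move=> x /andP[ax _]; rewrite (intab_FTC ax dF cf) addrC subrK.
Qed.

End interval_integral.

(** * Integration by parts for absolutely continuous functions *)

Section fubini_triangle.
Context {R : realType}.
Local Notation mu := (@lebesgue_measure R).
Local Notation T := (measurableTypeR R).
Implicit Types h k : T -> R.

Let tri h k (z : T * T) : R := h z.1 * (k z.2 * (z.2 <= z.1)%R%:R).

Let meas_tri h k : mu.-integrable setT (EFin \o h) ->
  mu.-integrable setT (EFin \o k) -> measurable_fun setT (EFin \o tri h k).
Proof.
move=> /measurable_int/measurable_EFinP mh /measurable_int/measurable_EFinP mk.
apply/measurable_EFinP; apply: measurable_funM.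
  exact: (measurableT_comp mh).
apply: measurable_funM; first exact: (measurableT_comp mk).
apply: (@measurableT_comp _ _ _ _ _ _ (fun b : bool => b%:R : R)) => //.
by apply: measurable_fun_ler.
Qed.

Let integrable_tri h k : mu.-integrable setT (EFin \o h) ->
  mu.-integrable setT (EFin \o k) -> (mu \x mu)%E.-integrable setT (EFin \o tri h k).
Proof.
move=> ih ik; apply/integrable12ltyP; first exact: meas_tri.
have mh : measurable_fun setT h by apply/measurable_EFinP; exact: measurable_int ih.
have mk : measurable_fun setT k by apply/measurable_EFinP; exact: measurable_int ik.
pose M := (\int[mu]_y `|(k y)%:E|)%E.
have Mfin : M \is a fin_num.
  have /integrableP[_ My] := ik.
  by rewrite ge0_fin_numE//; apply: integral_ge0.
apply: (@le_lt_trans _ _ (\int[mu]_x (`|(h x)%:E| * M))%E).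
  apply: ge0_le_integral => //=.
  - by move=> x _; apply: integral_ge0.
  - apply: (measurable_fun_fubini_tonelli_F (abse \o (EFin \o tri h k))) => //=.
    apply: measurableT_comp => //; exact: meas_tri.
  - apply: emeasurable_funM => //.
    by apply/measurable_EFinP; apply: measurableT_comp => //; exact: mh.
  - move=> x _; rewrite -ge0_integralZl//; last first.
      by apply/measurable_EFinP; apply: measurableT_comp => //; exact: mk.
    apply: ge0_le_integral => //=.
    + apply/measurable_EFinP.
      apply: (@measurableT_comp _ _ _ _ _ _ (fun r : R => `|r|)) => //.
      rewrite /tri /=; apply: measurable_funM => //.
      apply: measurable_funM; first exact: mk.
      apply: (@measurableT_comp _ _ _ _ _ _ (fun b : bool => b%:R : R)) => //.
      exact: measurable_fun_ler.
    + apply: emeasurable_funM => //.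
      by apply/measurable_EFinP; apply: measurableT_comp => //; exact: mk.
    + move=> y _; rewrite -EFinM lee_fin /tri /= !normrM; apply: ler_wpM2l => //.
      by case: (y <= x); rewrite ?normr1 ?mulr1// normr0 mulr0.
rewrite ge0_integralZr//; last 2 first.
  by apply/measurable_EFinP; apply: measurableT_comp => //; exact: mh.
  exact: integral_ge0.
have /integrableP[_ hy] := ih.
rewrite -(fineK Mfin); apply: lte_mul_pinfty; first exact: integral_ge0.
  by rewrite ge0_fin_numE//; exact: integral_ge0.
exact: ltry.
Qed.

Let integral_slice k (c : R) (S : interval R) : mu.-integrable setT (EFin \o k) ->
  (\int[mu]_y (c * (k y * (y \in S)%:R))%:E)%E = (c * \int[mu]_(y in [set` S]) k y)%:E.
Proof.
move=> ik; have ikS : mu.-integrable [set` S] (EFin \o k) by apply: integrableS ik.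
have mS : measurable ([set` S] : set T) by [].
have fS : (\int[mu]_(y in [set` S]) (EFin \o k) y)%E \is a fin_num.
  exact: integrable_fin_num.
transitivity (\int[mu]_y (c%:E * ((EFin \o k) \_ [set` S]) y))%E.
  apply: eq_integral => y _ /=; rewrite patchE mem_setE unfold_in.
  set yS := (_ <= S)%O; case: yS; first by rewrite mulr1 EFinM.
  by rewrite !mulr0 mule0.
rewrite (integralZl measurableT); last by apply/(integrable_mkcond _ mS).1.
by rewrite -integral_mkcond EFinM /Rintegral (fineK fS).
Qed.

(** Fubini for h(s) k(t) restricted to the triangle {t <= s}. *)
Lemma fubini_triangle (h k : R -> R) : mu.-integrable setT (EFin \o h) ->
  mu.-integrable setT (EFin \o k) ->
  \int[mu]_s (h s * \int[mu]_(t in `]-oo, s]) k t) =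
  \int[mu]_t (k t * \int[mu]_(s in `[t, +oo[) h s).
Proof.
move=> ih ik.
have E := Fubini (integrable_tri ih ik).
congr fine; transitivity (\int[mu]_x (\int[mu]_y (EFin \o tri h k) (x, y)))%E.
  apply: eq_integral => s _.
  rewrite -(integral_slice (h s) `]-oo, s] ik); apply: eq_integral => t _ /=.
  by rewrite /tri/= in_itv.
rewrite E; apply: eq_integral => t _.
rewrite -(integral_slice (k t) `[t, +oo[ ih); apply: eq_integral => s _ /=.
by rewrite /tri/= in_itv/= andbT mulrCA.
Qed.

End fubini_triangle.

Section primitives.
Context {R : realType}.
Implicit Types (a b c d x : R) (f g F G w P : R -> R).
Local Notation mu := (@lebesgue_measure R).

(** The product P G need not be differentiable.  Writing P and G as integrals of w
    and g instead, the two sides are the two orders of integration of w(t) g(s)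
    over a triangle. *)
Lemma prim_ibp a b P w G g : a <= b -> prim a b P w ->
  (forall x, is_derive x 1 G (g x)) -> continuous g ->
  intab a b (fun x => w x * G x) =
  P b * G b - P a * G a - intab a b (fun x => P x * g x).
Proof.
move=> ab Pw dG cg; have [iw Pw'] := Pw.
have ig : itg a b g by exact: itg_continuous.
have cG := derive_continuous dG.
have cP := prim_within ab Pw.
have restr (l : R -> R) : itg a b l -> mu.-integrable setT (EFin \o (l \_ `[a, b])).
  by move=> il; rewrite -restrict_EFin; apply/(integrable_mkcond _ _).1.
have := fubini_triangle (restr _ ig) (restr _ iw).
have -> : \int[mu]_s ((g \_ `[a, b]) s * \int[mu]_(t in `]-oo, s]) (w \_ `[a, b]) t)
        = intab a b (fun s => g s * intab a s w).
  rewrite /intab [RHS]Rintegral_mkcond; apply: eq_Rintegral => s _.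
  rewrite !patchE; case: ifPn => [|_]; last by rewrite mul0r.
  rewrite inE /= in_itv /= => /andP[sa sb]; congr (_ * _).
  rewrite -Rintegral_mkcondr; congr Rintegral; apply/seteqP; split => t /=; rewrite !in_itv/=.
    by move=> [-> /andP[->]].
  by move=> /andP[-> ts]; rewrite ts (le_trans ts sb).
have -> : \int[mu]_t ((w \_ `[a, b]) t * \int[mu]_(s in `[t, +oo[) (g \_ `[a, b]) s)
        = intab a b (fun t => w t * intab t b g).
  rewrite /intab [RHS]Rintegral_mkcond; apply: eq_Rintegral => s _.
  rewrite !patchE; case: ifPn => [|_]; last by rewrite mul0r.
  rewrite inE /= in_itv /= => /andP[sa sb]; congr (_ * _).
  rewrite -Rintegral_mkcondr; congr Rintegral; apply/seteqP; split => t /=; rewrite !in_itv/=.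
    by move=> [/andP[-> _] /andP[_ ->]].
  by move=> /andP[st ->]; rewrite st (le_trans sa st).
rewrite (@eq_intab _ a b (fun s => g s * intab a s w) (fun s => P s * g s - P a * g s)); last first.
  by move=> s sab; rewrite (Pw' s sab); ring.
rewrite (@eq_intab _ a b (fun t => w t * intab t b g) (fun s => G b * w s - w s * G s)); last first.
  move=> s /andP[_ sb]; rewrite (intab_FTC sb dG cg); ring.
have iPg : itg a b (fun s => P s * g s).
  have : itg a b (fun s => g s * P s) by apply: itgMc.
  by apply: itg_eq => x _; rewrite mulrC.
have iwG : itg a b (fun s => w s * G s).
  by apply: itgMc => //; exact: continuous_subspaceT.
rewrite !intabB//; [|exact: itgZ|exact: itgZ].
rewrite !intabZ// (intab_FTC ab dG cg).
rewrite (Pw' b) ?lexx ?ab//.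
move=> h; lra.
Qed.

Lemma prim_derivable a b P w x : prim a b P w -> {within `[a, b], continuous w} ->
  a < x < b -> is_derive x 1 P (w x).
Proof.
move=> [iw Pw] cw /andP[ax xb].
have ab := lt_trans ax xb.
have [_ xab]: `[a, b]%classic x /\ x \in `]a, b[ by rewrite /= !in_itv/= ax xb !ltW.
have cx : {for x, continuous w}.
  have /(within_continuous_continuous ab) := cw.
  by apply; rewrite in_itv/= ax xb.
have [dF FE] := @continuous_FTC1_closed R w a x b xb iw ax cx.
have e : \forall y \near x, P a + intab a y w = P y.
  near=> y; rewrite -Pw//.
  have : y \in `]a, b[ by near: y; exact: near_in_itvoo.
  by rewrite in_itv/= => /andP[/ltW -> /ltW ->].
have h : is_derive x 1 (fun y => intab a y w) (w x).
  by apply: DeriveDef; [exact: dF|rewrite -derive1E; exact: FE].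
apply: (near_eq_is_derive e).
have := is_deriveD (is_derive_cst (P a) x 1) h; rewrite add0r; exact.
Unshelve. all: by end_near. Qed.

(** The primitive of f is constant, and f is its derivative. *)
Lemma intab_eq0 a b f : a <= b -> {within `[a, b], continuous f} ->
  (forall x, a <= x <= b -> 0 <= f x) -> intab a b f = 0 ->
  forall x, a < x < b -> f x = 0.
Proof.
move=> ab cf f0 If0 x xab.
have hf := itg_within cf.
have pf : prim a b (fun x => intab a x f) f.
  by split=> // y _; rewrite intab_xx add0r.
have Z y : a <= y <= b -> intab a y f = 0.
  move=> /andP[ay yb]; have := intab_split hf ay yb; rewrite If0.
  have := @intab_ge0 _ a y f; have := @intab_ge0 _ y b f => h1 h2.
  have {}h1 : 0 <= intab y b f.
    by apply: h1 => z /andP[yz zb]; apply: f0; rewrite zb (le_trans ay yz).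
  have {}h2 : 0 <= intab a y f.
    by apply: h2 => z /andP[az zy]; apply: f0; rewrite az (le_trans zy yb).
  lra.
have d1 := prim_derivable pf cf xab.
have d2 : is_derive x 1 (fun y => intab a y f) 0.
  have e : \forall y \near x, cst 0 y = intab a y f.
    near=> y; rewrite Z//.
    have : y \in `]a, b[ by near: y; apply: near_in_itvoo; rewrite in_itv.
    by rewrite in_itv/= => /andP[/ltW -> /ltW ->].
  by apply: (near_eq_is_derive e); exact: is_derive_cst.
by have [_ <-] := d1; have [_ ->] := d2.
Unshelve. all: by end_near. Qed.

End primitives.

(** * Hyperbolic functions and the number coth (pi / 2) *)

Section monotonicity.
Context {R : realType}.
Implicit Types (f df : R -> R) (a b x : R).

Lemma MVT_is_derive f df a b : a < b -> (forall x, is_derive x 1 f (df x)) ->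
  exists2 c, a < c < b & f b - f a = df c * (b - a).
Proof.
move=> ab dF.
have cF : continuous f by move=> x; apply: differentiable_continuous; apply/derivable1_diffP; have [] := dF x.
have [|c + E] := @MVT R f df a b ab (fun x _ => dF x).
  exact: continuous_subspaceT.
by rewrite in_itv/= => cab; exists c.
Qed.

Lemma ge0_from_derive f df : (forall x, is_derive x 1 f (df x)) -> 0 <= f 0 ->
  (forall x, 0 <= x -> 0 <= df x) -> forall x, 0 <= x -> 0 <= f x.
Proof.
move=> dF f0 df0 x; rewrite le_eqVlt => /predU1P[<-//|x0].
have [c /andP[c0 _] E] := MVT_is_derive x0 dF.
have := df0 _ (ltW c0); have : 0 <= df c * (x - 0) by rewrite mulr_ge0 ?df0 ?subr0// ltW.
by move: E; lra.
Qed.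

End monotonicity.

Section hyperbolic.
Context {R : realType}.
Implicit Types x y : R.

Definition sinh x : R := (expR x - expR (- x)) / 2.
Definition cosh x : R := (expR x + expR (- x)) / 2.

Global Instance is_derive_sinh x : is_derive x 1 sinh (cosh x).
Proof.
rewrite /sinh; apply: is_derive_eq.
rewrite /cosh /GRing.scale /=; lra.
Qed.

Global Instance is_derive_cosh x : is_derive x 1 cosh (sinh x).
Proof.
rewrite /cosh; apply: is_derive_eq.
rewrite /sinh /GRing.scale /=; lra.
Qed.

Lemma continuous_sinh : continuous sinh.
Proof. by move=> x; apply: differentiable_continuous; apply/derivable1_diffP. Qed.

Lemma continuous_cosh : continuous cosh.
Proof. by move=> x; apply: differentiable_continuous; apply/derivable1_diffP. Qed.

Lemma expRVN x : expR x * expR (- x) = 1.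
Proof. by rewrite -expRD subrr expR0. Qed.

Lemma cosh2sinh2 x : cosh x ^+ 2 - sinh x ^+ 2 = 1.
Proof. by rewrite -(expRVN x) /cosh /sinh; field. Qed.

Lemma sinhD x y : sinh (x + y) = sinh x * cosh y + cosh x * sinh y.
Proof. by rewrite /sinh /cosh opprD !expRD; field. Qed.

Lemma coshD x y : cosh (x + y) = cosh x * cosh y + sinh x * sinh y.
Proof. by rewrite /sinh /cosh opprD !expRD; field. Qed.

Lemma sinhN x : sinh (- x) = - sinh x.
Proof. by rewrite /sinh opprK; field. Qed.

Lemma coshN x : cosh (- x) = cosh x.
Proof. by rewrite /cosh opprK; field. Qed.

Lemma sinh0 : sinh 0 = 0.
Proof. by rewrite /sinh oppr0 subrr mul0r. Qed.

Lemma cosh_ge1 x : 1 <= cosh x.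
Proof.
have := expRVN x; rewrite /cosh; have := expR_gt0 x; have := expR_gt0 (- x).
move: (expR x) (expR (- x)) => a b a0 b0 ab1; rewrite leNgt; apply/negP => h.
have : 0 < (2 - (a + b)) * (2 + (a + b)) by apply: mulr_gt0; lra.
by have := sqr_ge0 (a - b); nra.
Qed.

Lemma cosh_gt0 x : 0 < cosh x.
Proof. exact: lt_le_trans (cosh_ge1 x). Qed.

Lemma cosh_gt1 x : 0 < x -> 1 < cosh x.
Proof.
move=> x0; have : 1 < expR x by rewrite -expR0 ltr_expR.
have := expRVN x; rewrite /cosh; have := expR_gt0 (- x).
move: (expR x) (expR (- x)) => a b b0 ab1 a1; nra.
Qed.

Lemma sinh_gt x : 0 < x -> x < sinh x.
Proof.
move=> x0; have [c /andP[c0 _]] := MVT_is_derive x0 (@is_derive_sinh).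
rewrite sinh0 !subr0 => ->; have := cosh_gt1 c0; nra.
Qed.

Lemma sinh_gt0 x : 0 < x -> 0 < sinh x.
Proof. by move=> x0; apply: lt_trans (sinh_gt x0). Qed.

Lemma cothE x : coth x = cosh x / sinh x.
Proof.
rewrite /coth /cosh /sinh; have [->|n0] := eqVneq (expR x - expR (- x)) 0.
  by rewrite mul0r !invr0 !mulr0.
by rewrite invf_div mulrA divfK// pnatr_eq0.
Qed.

Lemma sin_le x : 0 <= x -> sin x <= x.
Proof.
move=> x0; suff : 0 <= x - sin x by lra.
have d (y : R) : is_derive y 1 (fun x => x - sin x) (1 - cos y) by apply: is_derive_eq.
apply: (ge0_from_derive d) x0 => [|y _]; first by rewrite sin0 subr0.
by rewrite subr_ge0 cos_le1.
Qed.

Lemma sin_cos_ge1 x : 0 <= x <= pi / 2 -> 1 <= sin x + cos x.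
Proof.
move=> /andP[x0 xp]; have s0 : 0 <= sin x by apply: sin_ge0_pi; rewrite x0/= (le_trans xp)//; have := @pi_gt0 R; lra.
have c0 : 0 <= cos x by apply: cos_ge0_pihalf; rewrite xp andbT; have := @pi_gt0 R; lra.
have := cos2Dsin2 x; have := sin_le1 x; have := cos_le1 x; nra.
Qed.

(** On [0, pi / 2] the right-hand side minus the left-hand side vanishes at 0 and has derivative
    cos x + sin x - exp (- x) > 0 for x > 0; beyond pi / 2 the left-hand side is
    negative. *)
Lemma cosBsin_lt_expN x : 0 < x < pi -> cos x - sin x < expR (- x).
Proof.
move=> /andP[x0 xp]; have [xp2|xp2] := leP x (pi / 2).
  have d (y : R) : is_derive y 1 (fun x => expR (- x) + sin x - cos x) (cos y + sin y - expR (- y)).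
    by apply: is_derive_eq; lra.
  have [c /andP[c0 cx]] := MVT_is_derive x0 d.
  rewrite oppr0 expR0 sin0 cos0 addr0 subrr !subr0.
  have : 1 <= sin c + cos c by apply: sin_cos_ge1; lra.
  have : expR (- c) < 1 by rewrite -expR0 ltr_expR; lra.
  move=> h1 h2 E; have : 0 < (cos c + sin c - expR (- c)) * x by rewrite mulr_gt0//; lra.
  lra.
have s0 : 0 < sin x by apply: sin_gt0_pi; rewrite x0.
have c0 : cos x < 0.
  rewrite -[x](subrK (pi / 2)) addrC cosD cos_pihalf mul0r sin_pihalf mul1r sub0r.
  by rewrite oppr_lt0; apply: sin_gt0_pi; lra.
by have := expR_gt0 (- x); lra.
Qed.

Lemma sinh_pihalf_gt0 : 0 < sinh (pi / 2) :> R.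
Proof. by apply: sinh_gt0; rewrite divr_gt0// pi_gt0. Qed.

Lemma coth_pihalf_sinh : coth (pi / 2) * (cosh pi - 1) = sinh pi :> R.
Proof.
have s0 := sinh_pihalf_gt0.
have -> : pi = pi / 2 + pi / 2 :> R by lra.
rewrite sinhD coshD; have -> : (pi / 2 + pi / 2) / 2 = pi / 2 :> R by lra.
rewrite cothE; have := cosh2sinh2 (pi / 2).
move: (cosh _) (sinh _) s0 => c s s0 E; apply: (mulfI (lt0r_neq0 s0)).
have -> : c * c = 1 + s * s by move: E; rewrite !expr2; lra.
by field; lra.
Qed.

Lemma coth_pihalf_cosh : coth (pi / 2) * sinh pi = cosh pi + 1 :> R.
Proof.
have s0 := sinh_pihalf_gt0.
have -> : pi = pi / 2 + pi / 2 :> R by lra.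
rewrite sinhD coshD; have -> : (pi / 2 + pi / 2) / 2 = pi / 2 :> R by lra.
rewrite cothE; have := cosh2sinh2 (pi / 2).
move: (cosh _) (sinh _) s0 => c s s0 E; apply: (mulfI (lt0r_neq0 s0)).
have E2 : s * s = c * c - 1 by move: E; rewrite !expr2; lra.
by rewrite E2; field; lra.
Qed.

Lemma coth_pihalf_gt1 : 1 < coth (pi / 2) :> R.
Proof.
rewrite cothE; have s0 := sinh_pihalf_gt0.
rewrite ltr_pdivlMr// mul1r /cosh /sinh; have := expR_gt0 (- (pi / 2) : R); lra.
Qed.

(** The quotient (sinh t - sin t) / (cosh t + cos t) has a derivative of the sign
    of sin t, so that pi is its first maximum, with value coth (pi / 2).  To compare
    with that value globally, put t = pi + h: the claim becomes
    coth (pi / 2) (cosh h - cos h) + (sinh h - sin h) > 0.  This is clear for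
    h > 0; for h = - k < 0, replacing coth (pi / 2) by 1 leaves
    exp (- k) > cos k - sin k. *)
Lemma profile_ratio_lt (t : R) : 0 < t -> t != pi ->
  sinh t - sin t < coth (pi / 2) * (cosh t + cos t).
Proof.
move=> t0 tpi; have := coth_pihalf_sinh; have := coth_pihalf_cosh.
have := coth_pihalf_gt1; set s := coth _ => s1 E1 E2.
pose h := t - pi; have -> : t = pi + h by rewrite /h addrC subrK.
rewrite sinhD coshD sinD cosD sinpi cospi !mul0r add0r subr0 !mulN1r opprK.
suff : 0 < s * (cosh h - cos h) + (sinh h - sin h).
  have -> : s * (cosh h - cos h) + (sinh h - sin h) =
    (s * (cosh pi - 1) - sinh pi) * cosh h + (s * sinh pi - (cosh pi + 1)) * sinh h
    + s * (cosh h - cos h) + (sinh h - sin h) by rewrite E1 E2; ring.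
  by lra.
have [h0|h0|h0] := ltgtP h 0; last by move: tpi; rewrite -subr_eq0 -/h h0 eqxx.
  pose k := - h; have -> : h = - k by rewrite opprK.
  rewrite coshN sinhN cosN sinN.
  have : cos k - sin k < expR (- k).
    by apply: cosBsin_lt_expN; rewrite /k /h; move: h0; rewrite /h; lra.
  have -> : expR (- k) = cosh k - sinh k by rewrite /cosh /sinh; lra.
  have := cosh_ge1 k; have := cos_le1 k => ck Ck H.
  have : 0 <= (s - 1) * (cosh k - cos k) by rewrite mulr_ge0//; lra.
  by lra.
have := sinh_gt h0; have := sin_le (ltW h0).
have := cosh_ge1 h; have := cos_le1 h => ck Ck H1 H2.
have : 0 <= s * (cosh h - cos h) by rewrite mulr_ge0//; lra.
by lra.
Qed.

Lemma profile_ratio_pi : sinh pi - sin pi = coth (pi / 2) * (cosh pi + cos pi) :> R.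
Proof. by rewrite sinpi cospi subr0 coth_pihalf_sinh. Qed.

End hyperbolic.

(* The Taylor coefficients are replaced by variables while a derivative is
   inferred: unification would otherwise unfold their numerals in unary. *)
Ltac is_derive_taylor R :=
  let c1 := fresh in let c2 := fresh in let c3 := fresh in let c4 := fresh in
  let E1 := fresh in let E2 := fresh in let E3 := fresh in let E4 := fresh in
  have [c1 E1] : exists c : R, c = 5040^-1 by [exists (5040^-1)];
  have [c2 E2] : exists c : R, c = 720^-1 by [exists (720^-1)];
  have [c3 E3] : exists c : R, c = 120^-1 by [exists (120^-1)];
  have [c4 E4] : exists c : R, c = 24^-1 by [exists (24^-1)];
  rewrite -?E1 -?E2 -?E3 -?E4; apply: is_derive_eq;
  rewrite /GRing.scale /= ?E1 ?E2 ?E3 ?E4; lra.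

Section numerics.
Context {R : realType}.
Implicit Types x : R.

(** Taylor bounds for sin and cos: each one integrates the preceding one. *)
Lemma cos_ge2 x : 0 <= x -> 1 - x ^+ 2 / 2 <= cos x.
Proof.
have d (y : R) : is_derive y 1 (fun y => cos y - (1 - y ^+ 2 / 2)) (y - sin y).
  by is_derive_taylor R.
move=> x0; suff : 0 <= cos x - (1 - x ^+ 2 / 2) by lra.
apply: (ge0_from_derive d) x0 => [|y y0]; first by rewrite cos0; lra.
by have := sin_le y0; lra.
Qed.

Lemma sin_ge3 x : 0 <= x -> x - x ^+ 3 / 6 <= sin x.
Proof.
have d (y : R) : is_derive y 1 (fun y => sin y - (y - y ^+ 3 / 6)) (cos y - (1 - y ^+ 2 / 2)).
  by is_derive_taylor R.
move=> x0; suff : 0 <= sin x - (x - x ^+ 3 / 6) by lra.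
apply: (ge0_from_derive d) x0 => [|y y0]; first by rewrite sin0; lra.
by have := cos_ge2 y0; lra.
Qed.

Lemma cos_le4 x : 0 <= x -> cos x <= 1 - x ^+ 2 / 2 + x ^+ 4 / 24.
Proof.
have d (y : R) : is_derive y 1 (fun y => 1 - y ^+ 2 / 2 + y ^+ 4 / 24 - cos y) (sin y - (y - y ^+ 3 / 6)).
  by is_derive_taylor R.
move=> x0; suff : 0 <= 1 - x ^+ 2 / 2 + x ^+ 4 / 24 - cos x by lra.
apply: (ge0_from_derive d) x0 => [|y y0]; first by rewrite cos0; lra.
by have := sin_ge3 y0; lra.
Qed.

Lemma sin_le5 x : 0 <= x -> sin x <= x - x ^+ 3 / 6 + x ^+ 5 / 120.
Proof.
have d (y : R) : is_derive y 1 (fun y => y - y ^+ 3 / 6 + y ^+ 5 / 120 - sin y)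
    (1 - y ^+ 2 / 2 + y ^+ 4 / 24 - cos y).
  by is_derive_taylor R.
move=> x0; suff : 0 <= x - x ^+ 3 / 6 + x ^+ 5 / 120 - sin x by lra.
apply: (ge0_from_derive d) x0 => [|y y0]; first by rewrite sin0; lra.
by have := cos_le4 y0; lra.
Qed.

Lemma cos_ge6 x : 0 <= x -> 1 - x ^+ 2 / 2 + x ^+ 4 / 24 - x ^+ 6 / 720 <= cos x.
Proof.
have d (y : R) : is_derive y 1 (fun y => cos y - (1 - y ^+ 2 / 2 + y ^+ 4 / 24 - y ^+ 6 / 720))
    (y - y ^+ 3 / 6 + y ^+ 5 / 120 - sin y).
  by is_derive_taylor R.
move=> x0; suff : 0 <= cos x - (1 - x ^+ 2 / 2 + x ^+ 4 / 24 - x ^+ 6 / 720) by lra.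
apply: (ge0_from_derive d) x0 => [|y y0]; first by rewrite cos0; lra.
by have := sin_le5 y0; lra.
Qed.

Lemma sin_ge7 x : 0 <= x -> x - x ^+ 3 / 6 + x ^+ 5 / 120 - x ^+ 7 / 5040 <= sin x.
Proof.
have d (y : R) : is_derive y 1 (fun y => sin y - (y - y ^+ 3 / 6 + y ^+ 5 / 120 - y ^+ 7 / 5040))
    (cos y - (1 - y ^+ 2 / 2 + y ^+ 4 / 24 - y ^+ 6 / 720)).
  by is_derive_taylor R.
move=> x0; suff : 0 <= sin x - (x - x ^+ 3 / 6 + x ^+ 5 / 120 - x ^+ 7 / 5040) by lra.
apply: (ge0_from_derive d) x0 => [|y y0]; first by rewrite sin0; lra.
by have := cos_ge6 y0; lra.
Qed.

(** With x = pi / 6, the equation sin (3 x) = 1 is a cubic equation in sin x whose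
    roots are - 1 and the double root 1 / 2. *)
Lemma sin_pi6 : sin (pi / 6) = 2^-1 :> R.
Proof.
set x : R := pi / 6; have p0 := @pi_gt0 R.
have s0 : 0 < sin x by apply: sin_gt0_pi; rewrite /x; lra.
have : sin (x + (x + x)) = 1.
  by rewrite (_ : x + (x + x) = pi / 2) ?sin_pihalf// /x; lra.
rewrite sinD sinD cosD; have := cos2Dsin2 x.
move: (sin x) (cos x) s0 => s c s0 E E1.
have : (s + 1) * (2 * s - 1) ^+ 2 = 0.
  have C : c ^+ 2 = 1 - s ^+ 2 by lra.
  have -> : (s + 1) * (2 * s - 1) ^+ 2 = 4 * s ^+ 3 - 3 * s + 1 by ring.
  have : s * (c * c - s * s) + c * (s * c + c * s) = s * (3 * c ^+ 2 - s ^+ 2) by ring.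
  by rewrite E1 C => h; nra.
move/eqP; rewrite mulf_eq0 expf_eq0 /= => /orP[/eqP|/eqP]; lra.
Qed.

(** This is 3.14155 < pi < 3.1416, decimals being written in Horner form.  It
    compares sin (pi / 6) = 1 / 2 with Taylor bounds for sin at rational points. *)
Lemma pi_bounds : (3 + (1 + (4 + (1 + (5 + 5 / 10) / 10) / 10) / 10) / 10) < (pi : R) < (3 + (1 + (4 + (1 + 6 / 10) / 10) / 10) / 10).
Proof.
have p0 := @pi_gt0 R; have p2 := @pi_ge2 R; have p4 : (pi : R) < 4 by have := @pihalf_lt2 R; lra.
have mono (x y : R) : 0 <= x <= 1 -> 0 <= y <= 1 -> (sin x < sin y) = (x < y).
  by move=> hx hy; rewrite ltr_sin// in_itv/=; lra.
apply/andP; split.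
  suff : ((3 + (1 + (4 + (1 + (5 + 5 / 10) / 10) / 10) / 10) / 10)) / 6 < pi / 6 :> R by lra.
  rewrite -mono; [|lra|lra]; rewrite sin_pi6.
  set a : R := (3 + (1 + (4 + (1 + (5 + 5 / 10) / 10) / 10) / 10) / 10) / 6; have a0 : 0 <= a by rewrite /a; lra.
  apply: le_lt_trans (sin_le5 a0) _; rewrite /a; lra.
suff : pi / 6 < ((3 + (1 + (4 + (1 + 6 / 10) / 10) / 10) / 10)) / 6 :> R by lra.
rewrite -mono; [|lra|lra]; rewrite sin_pi6.
set a : R := (3 + (1 + (4 + (1 + 6 / 10) / 10) / 10) / 10) / 6; have a0 : 0 <= a by rewrite /a; lra.
apply: lt_le_trans (sin_ge7 a0); rewrite /a; lra.
Qed.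

Lemma expR_ge5 x : 0 <= x -> 1 + x + x ^+ 2 / 2 + x ^+ 3 / 6 + x ^+ 4 / 24 + x ^+ 5 / 120 <= expR x.
Proof.
have step : forall P Q : R -> R, P 0 = 1 -> (forall y : R, is_derive y 1 P (Q y)) ->
  (forall y : R, 0 <= y -> Q y <= expR y) -> forall y : R, 0 <= y -> P y <= expR y.
  move=> P Q P0 dP QE y y0; suff : 0 <= expR y - P y by lra.
  have d (z : R) : is_derive z 1 (fun z => expR z - P z) (expR z - Q z) by apply: is_derive_eq.
  apply: (ge0_from_derive d) y0 => [|z z0]; first by rewrite expR0 P0 subrr.
  by have := QE _ z0; lra.
apply: (step (fun x => 1 + x + x ^+ 2 / 2 + x ^+ 3 / 6 + x ^+ 4 / 24 + x ^+ 5 / 120) (fun x => 1 + x + x ^+ 2 / 2 + x ^+ 3 / 6 + x ^+ 4 / 24)) => [|y|]; [by rewrite !expr0n /=; lra|by is_derive_taylor R|].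
apply: (step (fun x => 1 + x + x ^+ 2 / 2 + x ^+ 3 / 6 + x ^+ 4 / 24) (fun x => 1 + x + x ^+ 2 / 2 + x ^+ 3 / 6)) => [|y|]; [by rewrite ?expr0n /=; lra|by is_derive_taylor R|].
apply: (step (fun x => 1 + x + x ^+ 2 / 2 + x ^+ 3 / 6) (fun x => 1 + x + x ^+ 2 / 2)) => [|y|]; [by rewrite ?expr0n /=; lra|by is_derive_taylor R|].
apply: (step (fun x => 1 + x + x ^+ 2 / 2) (fun x => 1 + x)) => [|y|]; [by rewrite ?expr0n /=; lra|by is_derive_taylor R|].
by move=> y _; exact: expR_ge1Dx.
Qed.

Lemma expRN_ge5 x : 0 <= x -> 1 - x + x ^+ 2 / 2 - x ^+ 3 / 6 + x ^+ 4 / 24 - x ^+ 5 / 120 <= expR (- x).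
Proof.
have lo (P Q : R -> R) : P 0 = 1 -> (forall y : R, is_derive y 1 P (- Q y)) ->
  (forall y : R, 0 <= y -> expR (- y) <= Q y) -> forall y : R, 0 <= y -> P y <= expR (- y).
  move=> P0 dP QE y y0; suff : 0 <= expR (- y) - P y by lra.
  have d (z : R) : is_derive z 1 (fun z => expR (- z) - P z) (Q z - expR (- z)).
    by apply: is_derive_eq; lra.
  apply: (ge0_from_derive d) y0 => [|z z0]; first by rewrite oppr0 expR0 P0 subrr.
  by have := QE _ z0; lra.
have hi (P Q : R -> R) : P 0 = 1 -> (forall y : R, is_derive y 1 P (- Q y)) ->
  (forall y : R, 0 <= y -> Q y <= expR (- y)) -> forall y : R, 0 <= y -> expR (- y) <= P y.
  move=> P0 dP QE y y0; suff : 0 <= P y - expR (- y) by lra.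
  have d (z : R) : is_derive z 1 (fun z => P z - expR (- z)) (expR (- z) - Q z).
    by apply: is_derive_eq; lra.
  apply: (ge0_from_derive d) y0 => [|z z0]; first by rewrite oppr0 expR0 P0 subrr.
  by have := QE _ z0; lra.
apply: (lo (fun x => 1 - x + x ^+ 2 / 2 - x ^+ 3 / 6 + x ^+ 4 / 24 - x ^+ 5 / 120) (fun x => 1 - x + x ^+ 2 / 2 - x ^+ 3 / 6 + x ^+ 4 / 24)) => [|y|]; [by rewrite ?expr0n /=; lra|by is_derive_taylor R|].
apply: (hi (fun x => 1 - x + x ^+ 2 / 2 - x ^+ 3 / 6 + x ^+ 4 / 24) (fun x => 1 - x + x ^+ 2 / 2 - x ^+ 3 / 6)) => [|y|]; [by rewrite ?expr0n /=; lra|by is_derive_taylor R|].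
apply: (lo (fun x => 1 - x + x ^+ 2 / 2 - x ^+ 3 / 6) (fun x => 1 - x + x ^+ 2 / 2)) => [|y|]; [by rewrite ?expr0n /=; lra|by is_derive_taylor R|].
apply: (hi (fun x => 1 - x + x ^+ 2 / 2) (fun x => 1 - x)) => [|y|]; [by rewrite ?expr0n /=; lra|by is_derive_taylor R|].
by move=> y _; have := expR_ge1Dx (- y); lra.
Qed.

Lemma coth_pihalf_exp : coth (pi / 2) = (expR pi + 1) / (expR pi - 1) :> R.
Proof.
have e1 : 1 < expR pi :> R by rewrite -expR0 ltr_expR pi_gt0.
have E : expR pi = expR (pi / 2) * expR (pi / 2) :> R by rewrite -expRD; congr expR; lra.
rewrite /coth; have := expRVN (pi / 2 : R); have := expR_gt0 (pi / 2 : R).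
rewrite E in e1 *; move: (expR _) (expR (- _)) e1 => a b e1 a0 ab.
have -> : b = a^-1 by apply: (mulfI (lt0r_neq0 a0)); rewrite ab divff// lt0r_neq0.
have aa : a * a - 1 != 0 by apply/eqP; lra.
have -> : (a + a^-1) = (a * a + 1) / a by field; rewrite lt0r_neq0.
have -> : (a - a^-1) = (a * a - 1) / a by field; rewrite lt0r_neq0.
by field; rewrite aa lt0r_neq0.
Qed.

Lemma sqr_ge x y : 0 <= x -> x <= y -> x * x <= y * y.
Proof. by move=> x0 xy; apply: ler_pM. Qed.

Lemma expR_double x : expR (x * 2) = expR x * expR x.
Proof. by rewrite -expRD; congr expR; lra. Qed.

(** Four squarings lead from exp (pi / 16), where the Taylor bound is accurate, to
    exp pi; each square is rounded down. *)
Lemma expR_pi_gt : 2 < (0 + (0 + (9 + (0 + (3 + 4 / 10) / 10) / 10) / 10) / 10) * (expR pi - 1) :> R.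
Proof.
have /andP[pl _] := pi_bounds.
have : expR (3 + (1 + (4 + (1 + (5 + 5 / 10) / 10) / 10) / 10) / 10) < expR pi :> R by rewrite ltr_expR.
set a := (X in expR X < _); pose y := a / 16; have -> : a = y * 2 * 2 * 2 * 2 by rewrite /y; lra.
rewrite !expR_double.
have h0 : (1 + (2 + (1 + (6 + (9 + (4 + (8 + (8 + (7 + 9 / 10) / 10) / 10) / 10) / 10) / 10) / 10) / 10) / 10) <= expR y.
  have y0 : 0 <= y by rewrite /y /a; lra.
  by apply: le_trans (expR_ge5 y0); rewrite /y /a; lra.
move: (expR y) h0 => e h0; set e2 := e * e; set e4 := e2 * e2; set e8 := e4 * e4; set e16 := e8 * e8.
have h1 : (1 + (4 + (8 + (0 + (9 + (6 + (4 + (5 + 7 / 10) / 10) / 10) / 10) / 10) / 10) / 10) / 10) <= e2.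
  apply: le_trans (sqr_ge _ h0); lra.
have h2 : (2 + (1 + (9 + (3 + (2 + (5 + (6 + (0 + 5 / 10) / 10) / 10) / 10) / 10) / 10) / 10) / 10) <= e4.
  apply: le_trans (sqr_ge _ h1); lra.
have h3 : (4 + (8 + (1 + (0 + (3 + (7 + (2 + 1 / 10) / 10) / 10) / 10) / 10) / 10) / 10) <= e8.
  apply: le_trans (sqr_ge _ h2); lra.
have h4 : (23 + (1 + (3 + (9 + (6 + (7 + (9 + (7 + 4 / 10) / 10) / 10) / 10) / 10) / 10) / 10) / 10) <= e16.
  apply: le_trans (sqr_ge _ h3); lra.
move: h4; lra.
Qed.

(** An upper bound for exp pi is a lower bound for exp (- pi), obtained in the same
    way by rounding down the squares. *)
Lemma expR_pi_lt : (0 + (0 + (9 + (0 + (3 + 3 / 10) / 10) / 10) / 10) / 10) * (expR pi - 1) < 2 :> R.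
Proof.
have /andP[_ pu] := pi_bounds.
have : expR pi < expR (3 + (1 + (4 + (1 + 6 / 10) / 10) / 10) / 10) :> R by rewrite ltr_expR.
set a := (X in _ < expR X); pose y := a / 16; have -> : a = y * 2 * 2 * 2 * 2 by rewrite /y; lra.
rewrite -[X in expR pi < expR X]opprK expRN.
have -> : - (y * 2 * 2 * 2 * 2) = (- y) * 2 * 2 * 2 * 2 by lra.
rewrite !expR_double.
have h0 : (0 + (8 + (2 + (1 + (7 + (2 + (4 + (5 + (0 + (3 + 3 / 10) / 10) / 10) / 10) / 10) / 10) / 10) / 10) / 10) / 10) <= expR (- y).
  have y0 : 0 <= y by rewrite /y /a; lra.
  by apply: le_trans (expRN_ge5 y0); rewrite /y /a; lra.
move: (expR (- y)) h0 => e h0; set e2 := e * e; set e4 := e2 * e2; set e8 := e4 * e4; set e16 := e8 * e8.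
have h1 : (0 + (6 + (7 + (5 + (2 + (3 + (1 + (1 + (5 + (9 + 3 / 10) / 10) / 10) / 10) / 10) / 10) / 10) / 10) / 10) / 10) <= e2.
  apply: le_trans (sqr_ge _ h0); lra.
have h2 : (0 + (4 + (5 + (5 + (9 + (3 + (7 + (1 + (1 + (8 + 4 / 10) / 10) / 10) / 10) / 10) / 10) / 10) / 10) / 10) / 10) <= e4.
  apply: le_trans (sqr_ge _ h1); lra.
have h3 : (0 + (2 + (0 + (7 + (8 + (7 + (8 + (6 + (5 + (5 + 9 / 10) / 10) / 10) / 10) / 10) / 10) / 10) / 10) / 10) / 10) <= e8.
  apply: le_trans (sqr_ge _ h2); lra.
have h4 : (0 + (0 + (4 + (3 + (2 + (1 + (3 + (5 + (3 + (5 + 5 / 10) / 10) / 10) / 10) / 10) / 10) / 10) / 10) / 10) / 10) <= e16.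
  apply: le_trans (sqr_ge _ h3); lra.
move: e16 h4 {h0 h1 h2 h3} => p h4 h.
have p0 : 0 < p by lra.
have : expR pi * p < 1 by rewrite -ltr_pdivlMr// div1r.
nra.
Qed.

Lemma coth_pihalf_bounds :
  1 + 9 / 10 ^+ 2 + 3 / 10 ^+ 4 + 3 / 10 ^+ 5 <= coth (pi / 2 : R)
        < 1 + 9 / 10 ^+ 2 + 3 / 10 ^+ 4 + 4 / 10 ^+ 5.
Proof.
have lo := expR_pi_gt; have hi := expR_pi_lt.
rewrite coth_pihalf_exp; move: (expR pi) lo hi => E lo hi.
have E1 : 0 < E - 1 by lra.
have -> : (E + 1) / (E - 1) = 1 + 2 / (E - 1) by field; lra.
have l2 : (0 + (0 + (9 + (0 + (3 + 3 / 10) / 10) / 10) / 10) / 10) <= 2 / (E - 1) by rewrite ler_pdivlMr//; lra.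
have h2 : 2 / (E - 1) < (0 + (0 + (9 + (0 + (3 + 4 / 10) / 10) / 10) / 10) / 10) by rewrite ltr_pdivrMr//; lra.
by apply/andP; split; lra.
Qed.

End numerics.

(** * The beam equation and the estimate at a critical point *)

Section green_identity.
Context {R : realType}.
Implicit Types (a c l k : R) (U p w : R -> R).

(** A solution g0 of g'''' + l g = 0 is carried along with its derivatives g1, g2
    and g3. *)
Definition beam_solution l (g0 g1 g2 g3 : R -> R) : Prop :=
  [/\ forall x : R, is_derive x 1 g0 (g1 x), forall x : R, is_derive x 1 g1 (g2 x),
      forall x : R, is_derive x 1 g2 (g3 x) &
      forall x : R, is_derive x 1 g3 (- l * g0 x)].

(** Two integrations by parts move both derivatives of U onto g, where the equation
    cancels what remains under the integral. *)
Lemma green_identity a c l U p w (g0 g1 g2 g3 : R -> R) : a <= c ->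
  prim a c U p -> prim a c p w -> beam_solution l g0 g1 g2 g3 ->
  intab a c (fun x => w x * g2 x) + l * intab a c (fun x => U x * g0 x) =
  (p c * g2 c - U c * g3 c) - (p a * g2 a - U a * g3 a).
Proof.
move=> ac Up pw [d0 d1 d2 d3].
have c0 := derive_continuous d0; have c3 := derive_continuous d3.
have cl : continuous (fun x => - l * g0 x).
  by move=> x; apply: cvgM; [exact: cvg_cst|exact: c0].
rewrite (prim_ibp ac pw d2 c3) (prim_ibp ac Up d3 cl).
have -> : intab a c (fun x => U x * (- l * g0 x)) = - l * intab a c (fun x => U x * g0 x).
  rewrite -intabZ.
    by apply: eq_intab => x _; rewrite mulrCA.
  apply: itgMc; last exact: continuous_subspaceT.
  by apply: itg_within; exact: prim_within Up.
ring.
Qed.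

Lemma beam_prim l a c (g0 g1 g2 g3 : R -> R) : beam_solution l g0 g1 g2 g3 ->
  prim a c g0 g1 /\ prim a c g1 g2.
Proof.
move=> [d0 d1 d2 d3]; split; apply: prim_C1 => //.
  exact: derive_continuous d1.
exact: derive_continuous d2.
Qed.

(** Completing the square in the energy form: by Green's identity the cross
    term and the energy of g reduce to boundary values. *)
Lemma energy_expansion a c l k U p w (g0 g1 g2 g3 : R -> R) : a <= c ->
  prim a c U p -> prim a c p w -> itg a c (fun x => w x ^+ 2) ->
  beam_solution l g0 g1 g2 g3 ->
  intab a c (fun x => (w x - k * g2 x) ^+ 2) +
    l * intab a c (fun x => (U x - k * g0 x) ^+ 2) =
  intab a c (fun x => w x ^+ 2) + l * intab a c (fun x => U x ^+ 2)
  - 2 * k * ((p c * g2 c - U c * g3 c) - (p a * g2 a - U a * g3 a))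
  + k ^+ 2 * ((g1 c * g2 c - g0 c * g3 c) - (g1 a * g2 a - g0 a * g3 a)).
Proof.
move=> ac Up pw iw2 bg; have [gp0 gp1] := beam_prim a c bg.
have [d0 d1 d2 d3] := bg.
have G1 := green_identity ac Up pw bg; have G2 := green_identity ac gp0 gp1 bg.
have cU := prim_within ac Up.
have sq (f : R -> R) : {within `[a, c], continuous f} -> itg a c (fun x => f x * f x).
  by move=> cf; apply: itgMc => //; exact: itg_within.
have expand (f g : R -> R) : itg a c (fun x => f x ^+ 2) -> itg a c f -> continuous g ->
    intab a c (fun x => (f x - k * g x) ^+ 2) = intab a c (fun x => f x ^+ 2)
    - 2 * k * intab a c (fun x => f x * g x) + k ^+ 2 * intab a c (fun x => g x * g x).
  move=> if2 iff cg.
  have ifg : itg a c (fun x => f x * g x) by apply: itgMc => //; exact: continuous_subspaceT.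
  have igg : itg a c (fun x => g x * g x) by apply: sq; exact: continuous_subspaceT.
  rewrite -!intabZ// -intabB//; last exact: itgZ.
  rewrite -intabD//; [|by apply: itgB => //; exact: itgZ|exact: itgZ].
  by apply: eq_intab => x _; ring.
rewrite !expand//.
- move: G1 G2.
  set A1 := intab a c (fun x => w x * g2 x); set A2 := intab a c (fun x => U x * g0 x).
  set A3 := intab a c (fun x => g2 x * g2 x); set A4 := intab a c (fun x => g0 x * g0 x).
  by move=> <- <-; ring.
- by apply: itg_eq (sq _ cU) => x _; rewrite expr2.
- exact: itg_within.
- exact: derive_continuous d0.
- by case: pw.
- exact: derive_continuous d2.
Qed.

(** The integrand of the second term is continuous and nonnegative, so it vanishes
    with its integral. *)
Lemma energy_zero a c l k U w (g0 g2 : R -> R) : a <= c -> 0 < l ->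
  {within `[a, c], continuous U} -> {within `[a, c], continuous g0} ->
  intab a c (fun x => (w x - k * g2 x) ^+ 2) +
    l * intab a c (fun x => (U x - k * g0 x) ^+ 2) = 0 ->
  forall x, a < x < c -> U x = k * g0 x.
Proof.
move=> ac l0 cU cg H x xac.
have h1 : 0 <= intab a c (fun x => (w x - k * g2 x) ^+ 2) by apply: intab_ge0 => y _; exact: sqr_ge0.
have h2 : 0 <= intab a c (fun x => (U x - k * g0 x) ^+ 2) by apply: intab_ge0 => y _; exact: sqr_ge0.
have h3 : intab a c (fun x => (U x - k * g0 x) ^+ 2) = 0 by nra.
have cf : {within `[a, c], continuous (fun x => (U x - k * g0 x) ^+ 2)}.
  have cd : {within `[a, c], continuous (fun x => U x - k * g0 x)}.
    move=> y; apply: (@cvgB _ _ _ _ _ (U : subspace `[a, c] -> R)); first exact: cU.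
    by apply: (@cvgM _ _ _ _ (fun=> k)); [exact: cvg_cst|exact: cg].
  have -> : (fun x => (U x - k * g0 x) ^+ 2) = (fun x => (U x - k * g0 x) * (U x - k * g0 x)).
    by apply/funext => y; rewrite expr2.
  by move=> y; apply: cvgM; exact: cd.
have := @intab_eq0 _ a c _ ac cf (fun y _ => sqr_ge0 _) h3 x xac.
by move/eqP; rewrite sqrf_eq0 subr_eq0 => /eqP.
Qed.

End green_identity.

Section beam_profile.
Context {R : realType}.
Implicit Types (b L x y : R).

(** The solutions of g'''' = - 4 b^4 g with g = g'' = 0 at 0, and their first three
    derivatives. *)
Definition beam0 (P Q b x : R) := P * (sinh (b * x) * cos (b * x)) + Q * (cosh (b * x) * sin (b * x)).
Definition beam1 (P Q b x : R) := b * (P * (cosh (b * x) * cos (b * x) - sinh (b * x) * sin (b * x))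
  + Q * (sinh (b * x) * sin (b * x) + cosh (b * x) * cos (b * x))).
Definition beam2 (P Q b x : R) := 2 * b ^+ 2 * (Q * (sinh (b * x) * cos (b * x)) - P * (cosh (b * x) * sin (b * x))).
Definition beam3 (P Q b x : R) := 2 * b ^+ 3 * (Q * (cosh (b * x) * cos (b * x) - sinh (b * x) * sin (b * x))
  - P * (sinh (b * x) * sin (b * x) + cosh (b * x) * cos (b * x))).

Lemma beamP P Q b : beam_solution (4 * b ^+ 4) (beam0 P Q b) (beam1 P Q b) (beam2 P Q b) (beam3 P Q b).
Proof.
split=> x; rewrite /beam0 /beam1 /beam2 /beam3;
  by apply: is_derive_eq; rewrite /GRing.scale /=; ring.
Qed.

Lemma is_derive_refl (f : R -> R) (df : R) x : is_derive (1 - x) 1 f df ->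
  is_derive x 1 (fun y => f (1 - y)) (- df).
Proof.
move=> d; have d' : is_derive x 1 (fun y : R => 1 - y) (- 1) by apply: is_derive_eq; lra.
by have := @is_derive1_comp R f (fun y => 1 - y) x df (-1) d d'; rewrite mulrN1.
Qed.

Lemma beam_refl l (g0 g1 g2 g3 : R -> R) : beam_solution l g0 g1 g2 g3 ->
  beam_solution l (fun x : R => g0 (1 - x)) (fun x => - g1 (1 - x)) (fun x => g2 (1 - x)) (fun x => - g3 (1 - x)).
Proof.
move=> [d0 d1 d2 d3]; split=> x.
- exact: is_derive_refl (d0 _).
- by have := is_deriveN (is_derive_refl (d1 (1 - x))); rewrite opprK.
- exact: is_derive_refl (d2 _).
- by have := is_deriveN (is_derive_refl (d3 (1 - x))); rewrite opprK.
Qed.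

(** With these coefficients the solution has a critical point at L. *)
Definition profP b L : R := cosh (b * L) * cos (b * L) + sinh (b * L) * sin (b * L).
Definition profQ b L : R := sinh (b * L) * sin (b * L) - cosh (b * L) * cos (b * L).

Lemma prof_at0 P Q b : (beam0 P Q b 0 = 0) * (beam2 P Q b 0 = 0).
Proof. by rewrite /beam0 /beam2 mulr0 sinh0 sin0; split; ring. Qed.

Lemma prof1_end b L : beam1 (profP b L) (profQ b L) b L = 0.
Proof. by rewrite /beam1 /profP /profQ; ring. Qed.

Lemma prof0_end b L : beam0 (profP b L) (profQ b L) b L =
  (sinh (2 * (b * L)) - sin (2 * (b * L))) / 2.
Proof.
rewrite /beam0 /profP /profQ; set t := b * L.
rewrite (_ : 2 * t = t + t) ?sinhD ?sinD; last by ring.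
have := cosh2sinh2 t; have := cos2Dsin2 t.
move: (cosh t) (sinh t) (cos t) (sin t) => C S c s E1 E2.
have -> : S * C + C * S = 2 * (S * C * (c ^+ 2 + s ^+ 2)) by rewrite E1; ring.
have -> : s * c + c * s = 2 * (s * c * (C ^+ 2 - S ^+ 2)) by rewrite E2; ring.
by field.
Qed.

Lemma prof3_end b L : - beam3 (profP b L) (profQ b L) b L =
  2 * b ^+ 3 * (cosh (2 * (b * L)) + cos (2 * (b * L))).
Proof.
rewrite /beam3 /profP /profQ; set t := b * L.
rewrite (_ : 2 * t = t + t) ?coshD ?cosD; last by ring.
have := cosh2sinh2 t; have := cos2Dsin2 t.
move: (cosh t) (sinh t) (cos t) (sin t) => C S c s E1 E2.
have -> : C * C + S * S + (c * c - s * s) =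
  (C ^+ 2 + S ^+ 2) * (c ^+ 2 + s ^+ 2) + (c ^+ 2 - s ^+ 2) * (C ^+ 2 - S ^+ 2).
  by rewrite E1 E2; ring.
by ring.
Qed.

End beam_profile.

Section half_interval.
Context {R : realType}.
Implicit Types (b L x y m : R) (U p w : R -> R).
Local Notation s := (coth (pi / 2) : R).

Lemma prof_pos t : 0 < t -> 0 < sinh t - sin t :> R /\ 0 < cosh t + cos t :> R.
Proof.
move=> t0; split; first by have := sinh_gt t0; have := sin_le (ltW t0); lra.
by have := cosh_gt1 t0; have := cos_geN1 t; lra.
Qed.

(** The energy E of U is that of its multiple U(z) / g(z) of g, namely
    4 b^3 (cosh t + cos t) / (sinh t - sin t) U(z)^2 with t = 2 b L, plus the energy Q
    of the difference.  The first term is at least 4 b^3 U(z)^2 / coth (pi / 2), and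
    equality means that t = pi and Q = 0. *)
Lemma half_estimate a c b L U p w z (g0 g1 g2 g3 : R -> R) :
  a <= c -> 0 < b -> 0 < L ->
  prim a c U p -> prim a c p w -> itg a c (fun x => w x ^+ 2) ->
  beam_solution (4 * b ^+ 4) g0 g1 g2 g3 ->
  (p c * g2 c - U c * g3 c) - (p a * g2 a - U a * g3 a) =
    2 * b ^+ 3 * (cosh (2 * (b * L)) + cos (2 * (b * L))) * U z ->
  (g1 c * g2 c - g0 c * g3 c) - (g1 a * g2 a - g0 a * g3 a) =
    2 * b ^+ 3 * (cosh (2 * (b * L)) + cos (2 * (b * L))) * g0 z ->
  g0 z = (sinh (2 * (b * L)) - sin (2 * (b * L))) / 2 ->
  let E := intab a c (fun x => w x ^+ 2) + 4 * b ^+ 4 * intab a c (fun x => U x ^+ 2) in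
  4 * b ^+ 3 * U z ^+ 2 <= s * E /\
  (4 * b ^+ 3 * U z ^+ 2 = s * E -> U z != 0 ->
     2 * (b * L) = pi /\ forall x, a < x < c -> U x = U z / g0 z * g0 x).
Proof.
move=> ac b0 L0 Up pw iw2 bg B1 B2 gz E.
have bL0 : 0 < 2 * (b * L) by rewrite !mulr_gt0.
have [S0 C0] := prof_pos bL0.
have g0z : 0 < g0 z by rewrite gz divr_gt0.
have l0 : 0 < 4 * b ^+ 4 by rewrite mulr_gt0// exprn_gt0.
have X := energy_expansion (U z / g0 z) ac Up pw iw2 bg.
rewrite B1 B2 -/E in X.
set Q := (X in X = _) in X.
have Q0 : 0 <= Q.
  by apply: addr_ge0; [|apply: mulr_ge0; first exact: ltW]; apply: intab_ge0 => y _; exact: sqr_ge0.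
have s1 := @coth_pihalf_gt1 R.
set C := cosh _ + cos _ in C0 B1 B2 X *.
have EQ : E = Q + 4 * b ^+ 3 * C / (2 * g0 z) * U z ^+ 2.
  by rewrite X; field; rewrite lt0r_neq0.
have b3 : 0 < b ^+ 3 by rewrite exprn_gt0.
have sC : s * E - 4 * b ^+ 3 * U z ^+ 2 =
    s * Q + 4 * b ^+ 3 * U z ^+ 2 * ((s * C - 2 * g0 z) / (2 * g0 z)).
  by rewrite EQ; field; rewrite lt0r_neq0.
have key : 0 <= s * C - 2 * g0 z /\ (s * C - 2 * g0 z = 0 -> 2 * (b * L) = pi).
  rewrite gz (_ : 2 * ((sinh (2 * (b * L)) - sin (2 * (b * L))) / 2)
    = sinh (2 * (b * L)) - sin (2 * (b * L))); last by field.
  have [e|ne] := eqVneq (2 * (b * L)) pi.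
    by have := @profile_ratio_pi R; split=> //; rewrite /C e; lra.
  by have := profile_ratio_lt bL0 ne; rewrite -/C; split; lra.
have [key1 key2] := key.
have T1 : 0 <= 4 * b ^+ 3 * U z ^+ 2 * ((s * C - 2 * g0 z) / (2 * g0 z)).
  apply: mulr_ge0; last by rewrite divr_ge0// mulr_ge0// ltW.
  by apply: mulr_ge0; [apply: mulr_ge0 => //; exact: ltW|exact: sqr_ge0].
have T2 : 0 <= s * Q by rewrite mulr_ge0//; lra.
split; first by lra.
move=> EE Uz.
have Uz2 : 0 < U z ^+ 2 by rewrite exprn_even_gt0.
have Z1 : s * Q = 0 by lra.
have Z2 : 4 * b ^+ 3 * U z ^+ 2 * ((s * C - 2 * g0 z) / (2 * g0 z)) = 0 by lra.
split.
  apply: key2; have F1 : 0 < 4 * b ^+ 3 * U z ^+ 2 by apply: mulr_gt0 => //; exact: mulr_gt0.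
  have F2 : 0 < 2 * g0 z by rewrite mulr_gt0.
  by move/eqP: Z2; rewrite mulf_eq0 (gt_eqF F1) /= mulf_eq0 invr_eq0 (gt_eqF F2) orbF => /eqP.
apply: (@energy_zero _ a c (4 * b ^+ 4) _ U w g0 g2) => //.
- exact: prim_within Up.
- by case: bg => d0 _ _ _; apply: continuous_subspaceT; exact: derive_continuous d0.
- by rewrite -/Q; move/eqP: Z1; rewrite mulf_eq0 => /orP[/eqP|/eqP//]; lra.
Qed.

End half_interval.

Section sup_estimate.
Context {R : realType}.
Implicit Types (b x y m : R) (U p w : R -> R).
Local Notation s := (coth (pi / 2) : R).

(** The form taken on [0, 1] by an element U of H^2 and H^1_0, its derivative p and
    its second derivative w. *)
Definition H2rep U p w : Prop :=
  [/\ prim 0 1 U p, prim 0 1 p w, itg 0 1 (fun x => w x ^+ 2), U 0 = 0 & U 1 = 0].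

(** Up to a factor, the beam solution of profP and profQ for b = pi and L = 1 / 2. *)
Definition extremal_profile x : R :=
  sinh (pi * x) * cos (pi * x) + cosh (pi * x) * sin (pi * x).

Lemma half_scaling b L x : 2 * (b * L) = pi -> L = 1 / 2 ->
  beam0 (profP b L) (profQ b L) b x = sinh (pi / 2) * extremal_profile x.
Proof.
move=> bL L2; rewrite /beam0 /profP /profQ /extremal_profile.
have -> : b * L = pi / 2 by lra.
have -> : b = pi by rewrite L2 in bL; lra.
by rewrite cos_pihalf sin_pihalf; ring.
Qed.

(** At a critical point xi the half intervals [0, xi] and [xi, 1] obey the same
    estimate, whatever their lengths, so the two add up.  Equality forces both
    lengths to be pi / (2 b). *)
Lemma split_estimate U p w xi b : H2rep U p w -> 0 < xi < 1 -> p xi = 0 -> 0 < b ->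
  let E := intab 0 1 (fun x => w x ^+ 2) + 4 * b ^+ 4 * intab 0 1 (fun x => U x ^+ 2) in
  8 * b ^+ 3 * U xi ^+ 2 <= s * E /\
  (8 * b ^+ 3 * U xi ^+ 2 = s * E -> U xi != 0 ->
    b = pi /\ exists2 k : R, k != 0 & forall x, 0 < x < 1 -> x != 1 / 2 ->
      U x = k * (if x < 1 / 2 then extremal_profile x else extremal_profile (1 - x))).
Proof.
move=> [Up pw iw2 U0 U1] /andP[x0 x1] px b0 E.
have iU2 : itg 0 1 (fun x => U x ^+ 2).
  have cU := prim_within ler01 Up.
  have : itg 0 1 (fun x => U x * U x) by apply: itgMc => //; exact: itg_within.
  by apply: itg_eq => x _; rewrite expr2.
have x0' := ltW x0; have x1' := ltW x1.
have L1 : 0 < 1 - xi by rewrite subr_gt0.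
have bg1 := beamP (profP b xi) (profQ b xi) b.
have bg2 := beam_refl (beamP (profP b (1 - xi)) (profQ b (1 - xi)) b).
have [] := @half_estimate R 0 xi b xi U p w xi _ _ _ _ x0' b0 x0 (prim_sub (lexx _) x1' Up)
   (prim_sub (lexx _) x1' pw) (itg_sub (lexx _) x1' iw2) bg1.
- by rewrite px U0 !prof_at0 -prof3_end; ring.
- by rewrite prof1_end !prof_at0 -prof3_end; ring.
- exact: prof0_end.
have [] := @half_estimate R xi 1 b (1 - xi) U p w xi _ _ _ _ x1' b0 L1 (prim_sub x0' (lexx _) Up)
   (prim_sub x0' (lexx _) pw) (itg_sub x0' (lexx _) iw2) bg2.
- by rewrite px U1 subrr !prof_at0 -prof3_end; ring.
- by rewrite subrr prof1_end !prof_at0 -prof3_end; ring.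
- exact: prof0_end.
have EE : E = (intab 0 xi (fun x => w x ^+ 2) + 4 * b ^+ 4 * intab 0 xi (fun x => U x ^+ 2))
  + (intab xi 1 (fun x => w x ^+ 2) + 4 * b ^+ 4 * intab xi 1 (fun x => U x ^+ 2)).
  by rewrite /E (intab_split iw2 x0' x1') (intab_split iU2 x0' x1'); ring.
rewrite EE; set E1 := intab 0 xi _ + _; set E2 := intab xi 1 _ + _.
move=> r1 r2 l1 l2; split; first by lra.
move=> eq Uxi; have [m2 l3] := l2 ltac:(lra) Uxi; have [n2 r3] := r2 ltac:(lra) Uxi.
have xi2 : xi = 1 / 2.
  have : b * (xi - 1 / 2) = 0 by lra.
  by move/eqP; rewrite mulf_eq0 (gt_eqF b0) subr_eq0 => /eqP.
have L2 : 1 - xi = 1 / 2 by rewrite xi2; lra.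
split; first by rewrite xi2 in m2; lra.
have g1 x := half_scaling x m2 xi2.
have g2 x := half_scaling x n2 L2.
have sp := @sinh_pihalf_gt0 R.
have e0 : 0 < extremal_profile (1 / 2).
  rewrite /extremal_profile (_ : pi * (1 / 2) = pi / 2); last by lra.
  by rewrite cos_pihalf sin_pihalf mulr0 add0r mulr1 cosh_gt0.
exists (U xi / extremal_profile (1 / 2)).
  by rewrite mulf_neq0// invr_neq0// lt0r_neq0.
move=> x /andP[hx0 hx1] hx; case: ltP => hx2.
  rewrite (l3 x); last by rewrite hx0 xi2.
  by rewrite !g1 xi2; field; rewrite !lt0r_neq0.
rewrite (r3 x); last by rewrite hx1 andbT xi2 lt_neqAle eq_sym hx.
by rewrite !g2 L2; field; rewrite !lt0r_neq0.
Qed.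

End sup_estimate.

(** * Smooth functions and bumps *)

Section smooth_functions.
Context {R : realType}.
Implicit Types (f g : R -> R) (x y : R).

Definition smooth f : Prop := forall (k : nat) x, derivable f^`(k)%classic x 1.

Lemma smooth_derivable f x : smooth f -> derivable f x 1.
Proof. by move=> sf; exact: (sf 0%N). Qed.

Lemma smooth_is_derive f x : smooth f -> is_derive x 1 f (f^`()%classic x).
Proof. by move=> sf; apply: DeriveDef; [exact: smooth_derivable|rewrite derive1E]. Qed.

Lemma smooth_derive f : smooth f -> smooth f^`()%classic.
Proof. by move=> sf k x; rewrite -derive1Sn; exact: sf. Qed.

Lemma smooth_continuous f : smooth f -> continuous f.
Proof. by move=> sf; apply: derive_continuous => x; exact: smooth_is_derive. Qed.

Lemma smooth_antiderivative f g : (forall x, is_derive x 1 f (g x)) -> smooth g -> smooth f.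
Proof.
move=> fg sg [|k] x; first by have [] := fg x.
rewrite derive1Sn; have -> : f^`()%classic = g.
  by apply/funext => z; rewrite derive1E; have [_ ->] := fg z.
exact: sg.
Qed.

(** Infinite differentiability is coinductive: it holds throughout any class of
    differentiable functions which is stable under differentiation. *)
Lemma smooth_coind (S : (R -> R) -> Prop) :
  (forall f, S f -> exists2 g, S g & forall x, is_derive x 1 f (g x)) ->
  forall f, S f -> smooth f.
Proof.
move=> HS f Sf k; elim: k f Sf => [|k IH] f Sf x.
  by have [g _ /(_ x)[]] := HS _ Sf.
have [g Sg fg] := HS _ Sf; rewrite derive1Sn; have -> : f^`()%classic = g.
  by apply/funext => z; rewrite derive1E; have [_ ->] := fg z.
exact: IH.
Qed.

Lemma smooth_cst (c : R) : smooth (fun=> c).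
Proof.
apply: (@smooth_coind (fun f => exists c, f = fun=> c)) => [_ [d ->]|]; last by exists c.
by exists (fun=> 0); [exists 0|move=> x; exact: is_derive_cst].
Qed.

Lemma smooth_id : smooth (fun x => x).
Proof.
apply: (@smooth_antiderivative _ (fun=> 1)); last exact: smooth_cst.
Qed.

Lemma smooth_sin : smooth sin.
Proof.
apply: (@smooth_coind (fun f => exists a b, f = fun x => a * sin x + b * cos x)) => [_ [a [b ->]]|]; last first.
  by exists 1, 0; apply/funext => x; rewrite mul1r mul0r addr0.
exists (fun x => (- b) * sin x + a * cos x); first by exists (- b), a.
by move=> x; apply: is_derive_eq; rewrite /GRing.scale /=; ring.
Qed.

(** Closing the smooth functions under sums, products and compositions gives a class
    stable under differentiation; this replaces the formulas of Leibniz and of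
    Faa di Bruno. *)
Inductive smooth_closure : (R -> R) -> Prop :=
| SmoothBase f : smooth f -> smooth_closure f
| SmoothAdd f g : smooth_closure f -> smooth_closure g -> smooth_closure (fun x => f x + g x)
| SmoothMul f g : smooth_closure f -> smooth_closure g -> smooth_closure (fun x => f x * g x)
| SmoothComp f g : smooth f -> smooth_closure g -> smooth_closure (fun x => f (g x)).

Lemma smooth_closureP f : smooth_closure f -> smooth f.
Proof.
apply: smooth_coind => {}f; elim => {f} [f sf|f g sf [f' sf' df] sg [g' sg' dg]|
    f g sf [f' sf' df] sg [g' sg' dg]|f g sf sg [g' sg' dg]].
- exists f^`()%classic; first exact/SmoothBase/smooth_derive.
  by move=> x; exact: smooth_is_derive.
- exists (fun x => f' x + g' x); first exact: SmoothAdd.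
  by move=> x; exact: is_deriveD.
- exists (fun x => f x * g' x + g x * f' x).
    by apply: SmoothAdd; apply: SmoothMul.
  by move=> x; exact: is_deriveM.
- exists (fun x => f^`()%classic (g x) * g' x).
    exact: (SmoothMul (SmoothComp (smooth_derive sf) sg) sg').
  move=> x; apply: is_derive1_comp; exact: smooth_is_derive.
Qed.

Lemma smoothD f g : smooth f -> smooth g -> smooth (fun x => f x + g x).
Proof. by move=> sf sg; apply: smooth_closureP; apply: SmoothAdd; exact: SmoothBase. Qed.

Lemma smoothM f g : smooth f -> smooth g -> smooth (fun x => f x * g x).
Proof. by move=> sf sg; apply: smooth_closureP; apply: SmoothMul; exact: SmoothBase. Qed.

Lemma smooth_comp f g : smooth f -> smooth g -> smooth (fun x => f (g x)).
Proof. by move=> sf sg; apply: smooth_closureP; apply: SmoothComp => //; exact: SmoothBase. Qed.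

Lemma smooth_sum (I : Type) (r : seq I) (F : I -> R -> R) :
  (forall i, smooth (F i)) -> smooth (fun x => \sum_(i <- r) F i x).
Proof.
move=> sF; elim: r => [|i r IH].
  by under eq_fun do rewrite big_nil; exact: smooth_cst.
by under eq_fun do rewrite big_cons; exact: (smoothD (sF i) IH).
Qed.

End smooth_functions.

Section flat_function.
Context {R : realType}.
Implicit Types (x y z : R) (P Q : {poly R}).

(** Allowing a polynomial factor makes the class stable under differentiation. *)
Definition flat P x : R := if 0 < x then P.[x^-1] * expR (- x^-1) else 0.

(** The inequality exp z >= z for z = y / (n + 1), raised to the power n + 1. *)
Lemma pow_exp_bounded (n : nat) : exists C : R, forall y, 0 <= y -> y ^+ n * expR (- y) <= C.
Proof.
exists (n.+1%:R ^+ n.+1 + 1) => y y0; have [y1|y1] := leP y 1.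
  apply: (@le_trans _ _ 1); last by rewrite lerDr exprn_ge0.
  by rewrite mulr_ile1 ?expR_ge0 ?exprn_ge0// ?exprn_ile1// -expR0 ler_expR oppr_le0.
apply: (@le_trans _ _ (y ^+ n.+1 * expR (- y))).
  by rewrite ler_pM2r ?expR_gt0// ler_weXn2l// ltW.
have h : y / n.+1%:R <= expR (y / n.+1%:R).
  by apply: le_trans (expR_ge1Dx _); rewrite lerDr.
have : (y / n.+1%:R) ^+ n.+1 <= expR (y / n.+1%:R) ^+ n.+1.
  by rewrite lerXn2r// ?nnegrE ?divr_ge0// expR_ge0.
rewrite -expRM_natl (mulrC n.+1%:R) divfK ?pnatr_eq0// expr_div_n ler_pdivrMr ?exprn_gt0// => hh.
rewrite expRN ler_pdivrMr ?expR_gt0//; apply: (le_trans hh).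
by rewrite mulrC ler_pM2r ?expR_gt0// lerDl.
Qed.

Lemma poly_exp_bounded P : exists C : R, forall y, 0 <= y -> `|P.[y] * expR (- y)| <= C.
Proof.
have [C HC] := choice pow_exp_bounded.
exists (\sum_(i < size P) `|P`_i| * C i) => y y0.
rewrite horner_coef mulr_suml (le_trans (ler_norm_sum _ _ _))//.
apply: ler_sum => i _; rewrite -mulrA normrM; apply: ler_wpM2l => //.
by rewrite ger0_norm ?HC// mulr_ge0 ?expR_ge0 ?exprn_ge0.
Qed.

Lemma flat_le P : exists C : R, forall x, `|flat P x| <= C * `|x|.
Proof.
have [C HC] := poly_exp_bounded (P * 'X); exists C => x; rewrite /flat; case: ifPn => [x0|_].
  have := HC x^-1; rewrite invr_ge0 (ltW x0) => /(_ isT).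
  rewrite hornerM hornerX (mulrC P.[_]) -mulrA normrM gtr0_norm ?invr_gt0//.
  by rewrite (gtr0_norm x0) mulrC ler_pdivrMr.
rewrite normr0; have := HC 0 (lexx _) => h; apply: mulr_ge0 => //.
exact: le_trans (normr_ge0 _) h.
Qed.

(** At 0 the difference quotient of flat P is flat (P * 'X), which tends to 0. *)
Lemma is_derive_flat P x :
  is_derive x 1 (flat P) (flat ('X^2 * (P - P^`())) x).
Proof.
have [x0|x0|<-] := ltgtP 0 x.
- have xn0 : x != 0 by rewrite gt_eqF.
  rewrite {2}/flat x0.
  have e : \forall y \near x, P.[y^-1] * expR (- y^-1) = flat P y.
    by near=> y; rewrite /flat ifT//; near: y; exact: lt_nbhsr.
  apply: (near_eq_is_derive e).
  have dV := @is_deriveV R (fun y => y) x 1 1 xn0 (is_derive_id _ _).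
  have d1 := @is_derive1_comp R (horner P) (fun y => y^-1) x _ _ (is_derive_poly P (x^-1)) dV.
  have d2 := @is_derive1_comp R expR (fun y => - y^-1) x _ _ (is_derive_expR _) (is_deriveN dV).
  have d3 := is_deriveM d1 d2.
  apply: is_derive_eq; rewrite /GRing.scale /= !hornerE /= .
  by rewrite -exprVn; ring.
- rewrite {2}/flat ltNge (ltW x0) /=.
  have e : \forall y \near x, cst 0 y = flat P y.
    near=> y; rewrite /flat ifN// -leNgt; near: y.
    by apply: filterS (lt_nbhsl x0) => z /ltW.
  by apply: (near_eq_is_derive e); exact: is_derive_cst.
- rewrite {2}/flat ltxx; apply/is_derive1_caratheodory.
  exists (flat (P * 'X)); split.
  + move=> z; rewrite subr0 /flat ltxx subr0; case: ifPn => z0; last by rewrite mul0r.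
    by rewrite hornerM hornerX mulrAC divfK ?gt_eqF.
  + have [C HC] := flat_le (P * 'X).
    have F0 : flat (P * 'X) 0 = 0 by rewrite /flat ltxx.
    apply/(@cvgrPdist_le _ R); rewrite F0 => e e0.
    have [C0|C0] := leP C 0.
      near=> z; rewrite sub0r normrN (le_trans (HC z))// (le_trans _ (ltW e0))//.
      exact: mulr_le0_ge0.
    near=> z; rewrite sub0r normrN (le_trans (HC z))// mulrC -ler_pdivlMr//.
    by near: z; apply: (@nbhs0_le _ R); exact: divr_gt0.
  + by rewrite /flat ltxx.
Unshelve. all: by end_near. Qed.

Lemma smooth_flat P : smooth (flat P).
Proof.
apply: (@smooth_coind R (fun f => exists P, f = flat P)) => [_ [Q ->]|]; last by exists P.
by exists (flat ('X^2 * (Q - Q^`()))); [eexists|exact: is_derive_flat].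
Qed.

Definition bump x : R := flat 1 x.

Lemma bumpE x : bump x = if 0 < x then expR (- x^-1) else 0.
Proof. by rewrite /bump /flat hornerC mul1r. Qed.

Lemma is_derive_bump x : is_derive x 1 bump (flat 'X^2 x).
Proof. by have := is_derive_flat 1 x; rewrite derivC subr0 mulr1. Qed.

Lemma bump_ge0 x : 0 <= bump x.
Proof. by rewrite bumpE; case: ifP => // _; exact: expR_ge0. Qed.

Lemma bump_le1 x : bump x <= 1.
Proof.
by rewrite bumpE; case: ifP => // x0; rewrite -expR0 ler_expR oppr_le0 invr_ge0 ltW.
Qed.

End flat_function.

(** * Test functions and L_2 norms on (0, 1) *)

Section test_functions.
Context {R : realType}.
Implicit Types (f g phi u : R -> R) (a b x y : R).

Lemma test_smooth phi : test_function phi -> smooth phi.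
Proof. by case. Qed.

Lemma test_eq0 phi x : test_function phi -> ~ (0 < x < 1) -> phi x = 0.
Proof.
move=> [_ supp] nx; apply/eqP/negPn/negP => phix; apply: nx.
have : `]0, 1[%classic x by apply: supp; exact: subset_closure.
by rewrite /= in_itv.
Qed.

Lemma smooth_test a b phi : 0 < a -> b < 1 -> smooth phi ->
  (forall x, ~ (a < x < b) -> phi x = 0) -> test_function phi.
Proof.
move=> a0 b1 sphi phi0; split=> // x.
have sub : [set x | phi x != 0] `<=` `[a, b].
  move=> y /= /eqP ynz; rewrite in_itv/=; apply/negP => yab; apply: ynz; apply: phi0.
  by move=> /andP[ay yb]; apply: yab; rewrite !ltW.
move=> /(closureS sub); rewrite -(closure_id _).1; last exact: itv_closed.
by rewrite /= !in_itv/= => /andP[ax xb]; rewrite (lt_le_trans a0)// (le_lt_trans xb).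
Qed.

Lemma test_derive phi : test_function phi -> test_function phi^`()%classic.
Proof.
move=> [sphi supp]; split; first exact: smooth_derive.
apply: subset_trans supp; rewrite [X in _ `<=` X](closure_id _).1; last exact: closed_closure.
apply: closureS => y /= ynz; apply/not_notP => ny; move/eqP: ynz; apply.
have e : \forall z \near y, cst 0 z = phi z.
  have : nbhs y (~` closure [set x | phi x != 0]).
    by apply: open_nbhs_nbhs; split=> //; exact/closed_openC/closed_closure.
  apply: filterS => z nBz /=; apply/esym/eqP/negPn/negP => pz; apply: nBz.
  exact: subset_closure.
by rewrite derive1E; have [_ ->] := near_eq_is_derive e (is_derive_cst 0 y 1).
Qed.

(** For n tending to infinity these converge to the indicator function of (a, b). *)
Definition itv_bump a b (n : nat) x : R := bump (n.+1%:R * ((x - a) * (b - x))).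

Lemma smooth_affine (c d : R) : smooth (fun x => c + d * x).
Proof. by apply: smoothD; [exact: smooth_cst|apply: smoothM; [exact: smooth_cst|exact: smooth_id]]. Qed.

Lemma itv_bump_smooth a b n : smooth (itv_bump a b n).
Proof.
apply: smooth_comp; first exact: smooth_flat.
apply: smoothM; first exact: smooth_cst.
apply: smoothM.
  have := @smooth_affine (- a) 1; congr smooth; apply/funext => x; ring.
have := @smooth_affine b (- 1); congr smooth; apply/funext => x; ring.
Qed.

Lemma itv_bump_out a b n x : ~ (a < x < b) -> a <= b -> itv_bump a b n x = 0.
Proof.
move=> nx ab; rewrite /itv_bump bumpE ifN// -leNgt pmulr_rle0//.
have [xa|ax] := leP x a; first by rewrite mulr_le0_ge0//; lra.
have [bx|xb] := leP b x; first by rewrite mulr_ge0_le0//; lra.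
by exfalso; apply: nx; rewrite ax xb.
Qed.

Lemma itv_bump_test a b n : 0 < a -> a <= b -> b < 1 -> test_function (itv_bump a b n).
Proof.
move=> a0 ab b1; apply: (smooth_test a0 b1); first exact: itv_bump_smooth.
by move=> x nx; exact: itv_bump_out.
Qed.

Lemma itv_bump_cvg a b x : a < x < b -> itv_bump a b ^~ x @ \oo --> (1 : R).
Proof.
move=> /andP[ax xb]; set q := (x - a) * (b - x).
have q0 : 0 < q by rewrite mulr_gt0// subr_gt0.
have -> : itv_bump a b ^~ x = fun n => expR (- (q^-1 * n.+1%:R^-1)).
  apply/funext => n; rewrite /itv_bump bumpE -/q ifT; last by rewrite mulr_gt0.
  by rewrite invfM mulrC.
rewrite -[X in _ --> X](@expR0 R) -oppr0 -(mulr0 q^-1).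
apply: continuous_cvg; first exact: continuous_expR.
apply: cvgN; apply: cvgM; first exact: cvg_cst.
exact: cvg_harmonic.
Qed.

Lemma itv_bump_pos a b n : a < b -> 0 < itv_bump a b n ((a + b) / 2).
Proof.
move=> ab; rewrite /itv_bump bumpE ifT ?expR_gt0//.
by rewrite !mulr_gt0//; lra.
Qed.

End test_functions.

Section lebesgue01.
Context {R : realType}.
Local Notation mu := (@lebesgue_measure R).
Local Notation mu01 := (@mu01 R).
Local Notation mfunT := (measurable_fun (setT : set (measurableTypeR R))).
Implicit Types (f g u v : R -> R).

Lemma mu01E (A : set R) : mu01 A = mu (A `&` `]0, 1[).
Proof. by []. Qed.

Lemma mu01T : mu01 setT = 1%E.
Proof.
rewrite mu01E setTI; have := @lebesgue_measure_itv R `]0, 1[; rewrite /= lte_fin ltr01 => ->.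
by rewrite oppr0 adde0.
Qed.

Let m01 : measurable (`]0, 1[ : set (measurableTypeR R)). Proof. exact: measurable_itv. Qed.

Lemma ae_mu01P (P : R -> Prop) : {ae mu01, forall x, P x} <-> {ae mu, forall x, 0 < x < 1 -> P x}.
Proof.
split=> -[A [mA A0 sA]].
  exists (A `&` `]0, 1[); split=> //; first exact: measurableI.
  move=> x /= nPx; have [x01 nP] : 0 < x < 1 /\ ~ P x by apply/not_implyP.
  by split; [exact: sA|rewrite /= in_itv].
exists (A `|` ~` `]0, 1[); split.
- by apply: measurableU => //; exact: measurableC.
- apply/eqP; rewrite eq_le measure_ge0 andbT mu01E setIUl setICl setU0 -A0.
  by apply: le_measure; rewrite ?inE//; exact: measurableI.
- move=> x /= nPx; have [x01|nx] := pselect (`]0, 1[%classic x); last by right.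
  by left; apply: sA => /= h; apply: nPx; apply: h; move: x01; rewrite /= in_itv.
Qed.

Lemma integral_mu01 (f : R -> \bar R) : mfunT f ->
  (\int[mu01]_x f x = \int[mu]_(x in `[0%R, 1%R]) f x)%E.
Proof.
move=> mf; have mfS (D : set (measurableTypeR R)) : measurable_fun D f.
  exact: measurable_funS mf.
rewrite (@integral_itv_bndoo _ _ _ _ true false (mfS _)).
rewrite -(setUv (`]0, 1[ : set (measurableTypeR R))).
rewrite (integral_setU _ m01 (measurableC m01) (mfS _)); last by apply/disj_setPCl.
rewrite (@null_set_integral _ _ _ mu01 (~` `]0, 1[)); last first.
- by rewrite mu01E setICl measure0.
- exact: mfS.
- exact: measurableC.
rewrite adde0; apply: eq_measure_integral => A mA sA.
by rewrite mu01E setIidl.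
Qed.

Lemma Rint_mu01 f : mfunT f ->
  \int[mu01]_x f x = intab 0 1 f.
Proof. by move=> mf; rewrite /intab /Rintegral integral_mu01//; exact/measurable_EFinP. Qed.

Lemma normL2_poweR u : mfunT u ->
  (normL2 u = (\int[mu]_(x in `[0%R, 1%R]) (u x ^+ 2)%:E) `^ 2^-1)%E.
Proof.
move=> mu_; rewrite /normL2 unlock /Lnorm; congr (_ `^ _)%E.
rewrite -integral_mu01; last by apply/measurable_EFinP; exact: measurable_funX.
apply: eq_integral => x _ /=.
by rewrite powR_mulrn// -normrX ger0_norm ?sqr_ge0.
Qed.

Lemma L2_01P u : L2_01 u <->
  mfunT u /\ itg 0 1 (fun x => u x ^+ 2).
Proof.
have fin : mfunT u ->
    (normL2 u < +oo)%E <-> itg 0 1 (fun x => u x ^+ 2).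
  move=> mu_; have mu2 : measurable_fun (`[0, 1] : set (measurableTypeR R)) (EFin \o (fun x => u x ^+ 2)).
    by apply/measurable_EFinP; apply: measurable_funTS; exact: measurable_funX.
  have E : (\int[mu]_(x in `[0%R, 1%R]) `|(u x ^+ 2)%:E| = \int[mu]_(x in `[0%R, 1%R]) (u x ^+ 2)%:E)%E.
    by apply: eq_integral => x _; rewrite gee0_abs// lee_fin sqr_ge0.
  rewrite (normL2_poweR mu_); split.
    move=> h; apply/integrableP; split=> //=; rewrite E.
    by apply: (@lty_poweRy _ _ 2^-1).
  by move=> /integrableP[_ /=]; rewrite E => h; rewrite poweR_lty.
split.
  rewrite /L2_01 /= inE => /andP[]; rewrite !inE /= => mu_ fu; split=> //.
  exact/fin.
move=> [mu_ iu2]; rewrite /L2_01 /= inE; apply/andP; split; rewrite !inE//=.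
exact/fin.
Qed.

Lemma normL2E u : L2_01 u -> normL2 u = (Num.sqrt (intab 0 1 (fun x => u x ^+ 2)))%:E.
Proof.
move=> /L2_01P[mu_ iu2]; rewrite (normL2_poweR mu_) -powR12_sqrt; last first.
  by apply: intab_ge0 => x _; exact: sqr_ge0.
rewrite -poweR_EFin /intab /Rintegral fineK//.
by apply: integrable_fin_num => //.
Qed.

Lemma L2_continuous u : continuous u -> L2_01 u.
Proof.
move=> cu; apply/L2_01P; split; first exact: continuous_measurable_fun.
apply: itg_continuous => x; under eq_fun do rewrite expr2.
by apply: cvgM; exact: cu.
Qed.

Lemma L2_mfun u : L2_01 u -> mfunT u.
Proof. by move=> /L2_01P[]. Qed.

Lemma L2_itg2 u : L2_01 u -> itg 0 1 (fun x => u x ^+ 2).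
Proof. by move=> /L2_01P[]. Qed.

Lemma itg_le a b f g : measurable_fun (`[a, b] : set (measurableTypeR R)) f -> itg a b g ->
  (forall x, a <= x <= b -> `|f x| <= g x) -> itg a b f.
Proof.
move=> mf ig fg; apply: (@le_integrable _ _ _ mu _ _ _ (EFin \o g)) => //.
- exact/measurable_EFinP.
- move=> x /=; rewrite in_itv/= => xab; rewrite lee_fin (le_trans (fg _ xab))//.
  exact: ler_norm.
Qed.

Lemma L2_itgM u v : L2_01 u -> L2_01 v -> itg 0 1 (fun x => u x * v x).
Proof.
move=> /L2_01P[mu_ iu] /L2_01P[mv iv]; apply: itg_le (itgD iu iv) _.
  by apply: measurable_funTS; exact: measurable_funM.
move=> x _; rewrite normrM -(real_normK (num_real (u x))) -(real_normK (num_real (v x))).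
have := sqr_ge0 (`|u x| - `|v x|); have := normr_ge0 (u x); have := normr_ge0 (v x); nra.
Qed.

Lemma L2_itg u : L2_01 u -> itg 0 1 u.
Proof.
move=> uL; have L1 : L2_01 (fun=> 1 : R) by apply: L2_continuous => x; exact: cvg_cst.
by apply: itg_eq (L2_itgM uL L1) => x _; rewrite mulr1.
Qed.

Lemma L2B u v : L2_01 u -> L2_01 v -> L2_01 (fun x => u x - v x).
Proof.
move=> uL vL; have [mu_ iu] := (L2_01P u).1 uL; have [mv iv] := (L2_01P v).1 vL.
apply/L2_01P; split; first exact: measurable_funB.
have := itgD (itgD iu iv) (itgZ (- 2) (L2_itgM uL vL)).
by apply: itg_eq => x _; ring.
Qed.

Lemma normL2_ae u v : mfunT u ->
  mfunT v -> ae_eq01 u v -> normL2 u = normL2 v.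
Proof.
move=> mu_ mv uv; have m2 (h : R -> R) : mfunT h ->
   mfunT (fun x => (h x ^+ 2)%:E).
  by move=> mh; apply/measurable_EFinP; exact: measurable_funX.
rewrite !normL2_poweR// -!integral_mu01; [|exact: m2|exact: m2].
have -> // : (\int[mu01]_x (u x ^+ 2)%:E = \int[mu01]_x (v x ^+ 2)%:E)%E.
apply: ae_eq_integral => //; [exact: m2|exact: m2|].
move: uv; apply: filterS; first exact: (ae_filter_ringOfSetsType mu01).
by move=> x /= ->.
Qed.

(** The variance of f on [0, 1] is nonnegative. *)
Lemma intab_sqr_le f : itg 0 1 f -> itg 0 1 (fun x => f x ^+ 2) ->
  intab 0 1 f ^+ 2 <= intab 0 1 (fun x => f x ^+ 2).
Proof.
move=> jf if2; set m := intab 0 1 f.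
have ic (c : R) : itg 0 1 (fun=> c) by apply: itg_continuous => x; exact: cvg_cst.
have : 0 <= intab 0 1 (fun x => (f x - m) ^+ 2) by apply: intab_ge0 => x _; exact: sqr_ge0.
rewrite (@eq_intab _ 0 1 _ (fun x => f x ^+ 2 + (m ^+ 2 - (2 * m) * f x))); last by move=> x _; ring.
rewrite intabD//; last by apply: itgB => //; exact: itgZ.
rewrite intabB//; last exact: itgZ.
rewrite intabZ// intab_cst ?ler01// -/m; lra.
Qed.

Lemma norm_intab_le_normL2 f : L2_01 f -> (`|intab 0 1 f|%:E <= normL2 f)%E.
Proof.
move=> fL; rewrite normL2E// lee_fin -sqrtr_sqr ler_wsqrtr// intab_sqr_le//.
  exact: L2_itg.
exact: L2_itg2.
Qed.

Lemma normL2_le f g : L2_01 f -> L2_01 g -> (forall x, 0 <= x <= 1 -> `|f x| <= `|g x|) ->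
  (normL2 f <= normL2 g)%E.
Proof.
move=> fL gL fg; rewrite !normL2E// lee_fin ler_wsqrtr// le_intab//; try exact: L2_itg2.
move=> x x01; rewrite -(real_normK (num_real (f x))) -(real_normK (num_real (g x))).
by rewrite lerXn2r ?nnegrE// fg.
Qed.

End lebesgue01.

(** * Weak derivatives and classical representatives *)

Section weak_derivatives.
Context {R : realType}.
Local Notation mu := (@lebesgue_measure R).
Local Notation mu01 := (@mu01 R).
Local Notation mfun_itv a b := (measurable_fun (`[a, b] : set (measurableTypeR R))).
Local Notation mfunT := (measurable_fun (setT : set (measurableTypeR R))).
Implicit Types (f g u v w phi psi : R -> R) (a b x y : R).

Lemma continuous_mfun f : continuous f -> mfunT f.
Proof. exact: continuous_measurable_fun. Qed.

Lemma test_mfun phi : test_function phi -> mfunT phi.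
Proof. by move=> /test_smooth/smooth_continuous/continuous_mfun. Qed.

Lemma test_within phi a b : test_function phi -> {within `[a, b], continuous phi}.
Proof. by move=> /test_smooth/smooth_continuous/continuous_subspaceT; exact. Qed.

Lemma itg_test f phi : itg 0 1 f -> test_function phi -> itg 0 1 (fun x => f x * phi x).
Proof. by move=> jf tp; apply: itgMc => //; exact: test_within. Qed.

Lemma eq_ae_intab a b f g : mfun_itv a b f ->
  mfun_itv a b g ->
  {ae mu, forall x, a < x < b -> f x = g x} -> intab a b f = intab a b g.
Proof.
move=> mf mg fg; have sub : (`]a, b[ : set (measurableTypeR R)) `<=` `[a, b] by exact: subset_itv_oo_cc.
have mo (h : R -> R) : mfun_itv a b h ->
    measurable_fun (`]a, b[ : set (measurableTypeR R)) (EFin \o h).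
  by move=> mh; apply/measurable_EFinP; apply: measurable_funS mh.
congr fine; rewrite (@integral_itv_bndoo _ _ _ _ true false (mo _ mf)).
rewrite (@integral_itv_bndoo _ _ _ _ true false (mo _ mg)).
apply: ae_eq_integral => //; [exact: mo|exact: mo|].
move: fg; apply: filterS; first exact: (ae_filter_ringOfSetsType mu).
by move=> x /= h; rewrite in_itv => /= xab; rewrite h.
Qed.

(** By Lebesgue differentiation f is almost everywhere the derivative of its
    primitive, which is locally constant. *)
Lemma ae0_of_intab f : itg 0 1 f ->
  (forall a b, 0 < a -> a < b -> b < 1 -> intab a b f = 0) ->
  {ae mu, forall x, 0 < x < 1 -> f x = 0}.
Proof.
move=> jf f0; pose g := f \_ `[0, 1].
have ig : mu.-integrable setT (EFin \o g).
  by rewrite -restrict_EFin; apply/(integrable_mkcond _ _).1.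
have locg : locally_integrable setT g by apply: integrable_locally.
have igy (y : R) : mu.-integrable `[0, y] (EFin \o g) by apply: integrableS ig.
have := @FTC1 R g (BLeft 0) igy locg.
apply: filterS; first exact: (ae_filter_ringOfSetsType mu).
move=> x /= h /andP[x0 x1]; have ax : (0%:E < x%:E)%E by rewrite lte_fin.
have [_ ] := h ax.
have -> : g x = f x by rewrite /g patchE mem_setE in_itv/= (ltW x0) (ltW x1).
have e : \forall y \near x, cst (intab 0 x g) y = intab 0 y g.
  near=> y; have : y \in `]0, 1[ by near: y; apply: near_in_itvoo; rewrite in_itv/= x0.
  rewrite in_itv/= => /andP[y0 y1] /=.
  have eqg a b : 0 < a -> b < 1 -> intab a b g = intab a b f.
    move=> a0 b1; apply: eq_intab => z /andP[az zb].
    by rewrite /g patchE mem_setE in_itv/= (le_trans (ltW a0))// (le_trans zb (ltW b1)).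
  have [xy|yx|->//] := ltgtP x y.
    rewrite [RHS](@intab_split _ _ _ x)//; [|exact: igy|exact: ltW|exact: ltW].
    by rewrite (eqg x y)// f0// addr0.
  rewrite (@intab_split _ _ _ y)//; [|exact: igy|exact: ltW|exact: ltW].
  by rewrite (eqg y x)// f0// addr0.
have [_] := near_eq_is_derive e (is_derive_cst (intab 0 x g) x 1).
by rewrite -derive1E => E1 E2; rewrite -E2 -[RHS]E1.
Unshelve. all: by end_near. Qed.

(** Pointwise convergence in the open interval is enough, the end points being
    negligible. *)
Lemma intab_dct a b (F : nat -> R -> R) f (G : R -> R) :
  (forall n, mfun_itv a b (F n)) ->
  mfun_itv a b f -> itg a b G ->
  (forall n x, a <= x <= b -> `|F n x| <= G x) ->
  (forall x, a < x < b -> F n x @[n --> \oo] --> f x) ->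
  intab a b (F n) @[n --> \oo] --> intab a b f.
Proof.
move=> mF mf iG dom cv.
have sub : (`]a, b[ : set (measurableTypeR R)) `<=` `[a, b] by exact: subset_itv_oo_cc.
have mFo n : measurable_fun (`]a, b[ : set (measurableTypeR R)) (EFin \o F n).
  by apply/measurable_EFinP; apply: measurable_funS (mF n).
have mfo : measurable_fun (`]a, b[ : set (measurableTypeR R)) (EFin \o f).
  by apply/measurable_EFinP; apply: measurable_funS mf.
have E (h : R -> R) : measurable_fun (`]a, b[ : set (measurableTypeR R)) (EFin \o h) ->
    (\int[mu]_(x in `[a, b]) (h x)%:E = \int[mu]_(x in `]a, b[) (EFin \o h) x)%E.
  by move=> mh; rewrite (@integral_itv_bndoo _ _ _ _ true false mh).
have iGo : mu.-integrable (`]a, b[ : set (measurableTypeR R)) (EFin \o G).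
  exact: integrableS iG.
have cv' : {ae mu, forall x, `]a, b[%classic x -> (EFin \o F n) x @[n --> \oo] --> (EFin \o f) x}.
  apply: aeW => x; rewrite /= in_itv/= => xab; apply: cvg_EFin; first by near=> n.
  exact: cv.
have dom' : {ae mu, forall x, forall n, `]a, b[%classic x -> (`|(EFin \o F n) x| <= (EFin \o G) x)%E}.
  by apply: aeW => x n; rewrite /= in_itv/= => /andP[ax xb]; rewrite lee_fin dom// !ltW.
have [jf _ C] := @dominated_convergence _ _ R mu _ (measurable_itv `]a, b[) _ _ _ mFo mfo cv' iGo dom'.
rewrite /intab /Rintegral (E f mfo); under eq_fun do rewrite (E _ (mFo _)).
apply: fine_cvg; rewrite fineK//; exact: integrable_fin_num.
Unshelve. all: by end_near. Qed.

(** The fundamental lemma of the calculus of variations; the bumps alone suffice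
    because they converge to the indicators of intervals. *)
Lemma ae0_of_bumps f : itg 0 1 f ->
  (forall a b n, 0 < a -> a < b -> b < 1 -> intab 0 1 (fun x => f x * itv_bump a b n x) = 0) ->
  {ae mu, forall x, 0 < x < 1 -> f x = 0}.
Proof.
move=> jf H; apply: ae0_of_intab => // a b a0 ab b1.
have jab : itg a b f by apply: itg_sub jf; exact: ltW.
have tb n : test_function (itv_bump a b n) by apply: itv_bump_test => //; exact: ltW.
pose F n x := f x * itv_bump a b n x.
have mf : mfun_itv a b f := itg_mfun jab.
have mF n : mfun_itv a b (F n).
  by apply: measurable_funM => //; apply: measurable_funTS; exact: test_mfun.
have Z n : intab a b (F n) = 0.
  rewrite -(H a b n a0 ab b1) (@intab_split _ 0 1 a); [|exact: itg_test|exact: ltW|by apply/ltW/(lt_trans ab)].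
  rewrite (@intab_split _ a 1 b); [|by apply: itg_sub (itg_test jf (tb n)) => //; exact: ltW|exact: ltW|exact: ltW].
  have Z0 c d : (forall x, c <= x <= d -> ~ (a < x < b)) -> intab c d (fun x => f x * itv_bump a b n x) = 0.
    move=> out; rewrite (@eq_intab _ c d _ (fun=> 0 * 0)).
      by rewrite intabZ ?mul0r//; apply: itg_continuous => x; exact: cvg_cst.
    by move=> x /out nx; rewrite itv_bump_out ?mulr0// ltW.
  rewrite (Z0 0 a); last by move=> x /andP[_ xa] /andP[]; rewrite ltNge xa.
  rewrite (Z0 b 1) ?addr0 ?add0r//; by move=> x /andP[bx _] /andP[_]; rewrite ltNge bx.
have C : intab a b (F n) @[n --> \oo] --> intab a b f.
  apply: (@intab_dct a b F f (fun x => `|f x|)) => //; first exact: itg_norm.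
    move=> n x _; rewrite /F normrM ler_piMr// ger0_norm ?bump_ge0//.
    exact: bump_le1.
  move=> x xab; rewrite -[X in _ --> X]mulr1; apply: cvgM; first exact: cvg_cst.
  exact: itv_bump_cvg.
have E0 : (fun n => intab a b (F n)) = fun=> 0 by apply/funext.
by rewrite E0 in C; apply: (cvg_unique (@Rhausdorff R) C); exact: cvg_cst.
Qed.

(** The antiderivative that vanishes on the left of the support of psi also vanishes
    on its right, since psi has zero mean. *)
Lemma test_primitive a b psi : 0 < a -> a < b -> b < 1 -> smooth psi ->
  (forall x, ~ (a < x < b) -> psi x = 0) -> intab 0 1 psi = 0 ->
  exists2 phi, test_function phi & forall x, is_derive x 1 phi (psi x).
Proof.
move=> a0 ab b1 sp out Z.
have cp := smooth_continuous sp.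
have b0 := lt_trans a0 ab; have a1 := lt_trans ab b1.
have restr (D : set R) : (forall x, a < x < b -> D x) -> psi \_ D = psi.
  move=> sD; apply/funext => x; rewrite patchE; case: ifPn => // nD.
  rewrite out// => /sD Dx; move: nD; rewrite notin_setE; exact.
have ip : mu.-integrable setT (EFin \o psi).
  rewrite -(restr `[0, 1]%classic).
    by rewrite -restrict_EFin; apply/(integrable_mkcond _ _).1 => //; exact: itg_continuous.
  move=> x /andP[ax xb]; rewrite /= in_itv/=.
  by rewrite (ltW (lt_trans a0 ax)) (ltW (lt_trans xb b1)).
pose phi x := \int[mu]_(t in `]-oo, x]) psi t.
have dphi x : is_derive x 1 phi (psi x).
  have ipx : mu.-integrable `]-oo, x + 1] (EFin \o psi) by apply: integrableS ip.
  have [d1 d2] := @continuous_FTC1 R psi -oo%O x (x + 1) ltac:(by rewrite ltrDl) ipx (ltNyr x) (cp x).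
  by apply: DeriveDef; [exact: d1|rewrite -derive1E; exact: d2].
exists phi; last exact: dphi.
apply: (smooth_test a0 b1).
  exact: smooth_antiderivative dphi sp.
move=> x nx; have [xa|ax] := leP x a.
  rewrite /phi Rintegral_mkcond (_ : psi \_ _ = cst 0).
    by rewrite /Rintegral integral0.
  apply/funext => y; rewrite patchE; case: ifPn => // ; rewrite inE /= in_itv/= => yx.
  by rewrite out// => /andP[]; rewrite ltNge (le_trans yx xa).
have bx : b <= x by rewrite leNgt; apply/negP => xb; apply: nx; rewrite ax.
rewrite /phi Rintegral_mkcond restr; last first.
  by move=> y /andP[_ yb]; rewrite /= in_itv/= (le_trans (ltW yb)).
rewrite -Z /intab [RHS]Rintegral_mkcond restr// => y /andP[ay yb].
by rewrite /= in_itv/= (ltW (lt_trans a0 ay)) (ltW (lt_trans yb b1)).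
Qed.

(** Subtracting a multiple of a fixed bump psi0 from a bump gives it zero mean, hence
    makes it the derivative of a test function.  The constant is the mean of f
    weighted by psi0. *)
Lemma du_bois_reymond f : itg 0 1 f ->
  (forall phi, test_function phi -> intab 0 1 (fun x => f x * phi^`()%classic x) = 0) ->
  exists c : R, {ae mu, forall x, 0 < x < 1 -> f x = c}.
Proof.
move=> jf H; pose a0 : R := 1 / 4; pose b0 : R := 3 / 4.
pose psi0 := itv_bump a0 b0 0.
have ta : test_function psi0 by apply: itv_bump_test; rewrite /a0 /b0; lra.
have out0 x : ~ (a0 < x < b0) -> psi0 x = 0.
  by move=> nx; apply: itv_bump_out => //; rewrite /a0 /b0; lra.
have ic psi : test_function psi -> itg 0 1 psi.
  by move=> tp; apply: itg_within; exact: test_within.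
pose m := intab 0 1 psi0.
have m0 : m != 0.
  apply/eqP => mz; have c01 : 0 < (1 / 2 : R) < 1 by apply/andP; split; lra.
  have := @intab_eq0 R 0 1 psi0 ler01 (@test_within _ _ _ ta) (fun x _ => bump_ge0 _) mz (1 / 2) c01.
  have := @itv_bump_pos R a0 b0 0; rewrite (_ : (a0 + b0) / 2 = 1 / 2); last by rewrite /a0 /b0; lra.
  by move=> /(_ ltac:(rewrite /a0 /b0; lra)) h1 h2; move: h1; rewrite -/psi0 h2 ltxx.
pose c := intab 0 1 (fun x => f x * psi0 x) / m.
exists c; have cc : itg 0 1 (fun=> c) by apply: itg_continuous => x; exact: cvg_cst.
suff : {ae mu, forall x, 0 < x < 1 -> f x - c = 0}.
  apply: filterS; first exact: (ae_filter_ringOfSetsType mu).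
  by move=> x /= h /h /eqP; rewrite subr_eq0 => /eqP.
apply: ae0_of_bumps => [|a b n A0 AB B1]; first exact: itgB.
set psi := itv_bump a b n.
have tp : test_function psi by apply: itv_bump_test => //; exact: ltW.
pose d := intab 0 1 psi.
pose chi x := psi x + (- (d / m)) * psi0 x.
have schi : smooth chi.
  apply: smoothD; first exact: test_smooth.
  by apply: smoothM; [exact: smooth_cst|exact: test_smooth].
have Zchi : intab 0 1 chi = 0.
  rewrite /chi intabD; [|exact: ic|by apply: itgZ; exact: ic].
  rewrite intabZ; last exact: ic.
  by rewrite -/d -/m mulNr divfK// subrr.
have [phi tphi dphi] := @test_primitive (Num.min a a0) (Num.max b b0) chi
  ltac:(by rewrite lt_min A0 /a0; lra) ltac:(by rewrite gt_min !lt_max AB)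
  ltac:(by rewrite gt_max B1 /b0; lra) schi
  ltac:(move=> x nx; rewrite /chi /psi itv_bump_out ?(ltW AB) ?out0 ?mulr0 ?addr0//;
     move=> /andP[h1 h2]; apply: nx; rewrite gt_min lt_max h1 h2 ?orbT//) Zchi.
have := H _ tphi; have -> : phi^`()%classic = chi.
  by apply/funext => x; rewrite derive1E; have [_ ->] := dphi x.
have ifp : itg 0 1 (fun x => f x * psi x) by exact: itg_test.
have ifp0 : itg 0 1 (fun x => f x * psi0 x) by exact: itg_test.
rewrite (@eq_intab _ 0 1 _ (fun x => f x * psi x + (- (d / m)) * (f x * psi0 x))); last first.
  by move=> x _; rewrite /chi; ring.
rewrite intabD//; last exact: itgZ.
rewrite intabZ// => E.
rewrite (@eq_intab _ 0 1 _ (fun x => f x * psi x - c * psi x)); last by move=> x _; ring.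
rewrite intabB//; last by apply: itgZ; exact: ic.
rewrite intabZ; last exact: ic.
have fin (X Y e l : R) : Y + - (e / l) * X = 0 -> Y - X / l * e = 0 by move=> <-; ring.
exact: fin E.
Qed.

Lemma weak_derivativeP k u v : L2_01 u -> is_weak_derivative k u v ->
  forall phi, test_function phi ->
  intab 0 1 (fun x => u x * phi^`(k)%classic x) = (-1) ^+ k * intab 0 1 (fun x => v x * phi x).
Proof.
move=> uL [vL H] phi tp; rewrite -!Rint_mu01; first exact: H.
  by apply: measurable_funM; [exact: L2_mfun|exact: test_mfun].
apply: measurable_funM; first exact: L2_mfun.
apply: continuous_mfun; apply: smooth_continuous => j x.
have := test_smooth tp => sp; have := sp (j + k)%N x.
by rewrite /derive1n iterD.
Qed.

Lemma sobolev_weak k m u : sobolevH m u -> (k <= m)%N ->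
  is_weak_derivative k u (weak_derivative k u).
Proof.
move=> [_ H] /H[v Hv]; rewrite /weak_derivative; case: xgetP => [y _ //|].
by move=> /(_ v) /(_ Hv).
Qed.

Lemma prim_test_ibp P w phi : prim 0 1 P w -> test_function phi ->
  intab 0 1 (fun x => P x * phi^`()%classic x) = - intab 0 1 (fun x => w x * phi x).
Proof.
move=> Pw tp; have sp := test_smooth tp.
rewrite (prim_ibp ler01 Pw (fun x => smooth_is_derive x sp)); last first.
  exact: smooth_continuous (smooth_derive sp).
rewrite (test_eq0 tp (x := 1)) ?(test_eq0 tp (x := 0)) ?ltxx ?andbF//; ring.
Qed.

(** The difference between u and a primitive of v has zero weak derivative. *)
Lemma weak_primitive u v : itg 0 1 u -> itg 0 1 v ->
  (forall phi, test_function phi ->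
    intab 0 1 (fun x => u x * phi^`()%classic x) = - intab 0 1 (fun x => v x * phi x)) ->
  exists2 P, prim 0 1 P v & {ae mu, forall x, 0 < x < 1 -> u x = P x}.
Proof.
move=> iu iv H; pose V x := intab 0 x v.
have pV : prim 0 1 V v by split=> // x _; rewrite /V intab_xx add0r.
have iV : itg 0 1 V by apply: itg_within; exact: prim_within pV.
have [||c Hc] := @du_bois_reymond (fun x => u x - V x).
- exact: itgB.
- move=> phi tp; have tp' := test_derive tp.
  rewrite (@eq_intab _ 0 1 _ (fun x => u x * phi^`()%classic x - V x * phi^`()%classic x)).
    rewrite intabB; [|exact: itg_test|exact: itg_test].
    by rewrite H// (prim_test_ibp pV tp) subrr.
  by move=> x _; ring.
exists (fun x => c + V x).
  by split=> // x _; rewrite /V intab_xx addr0.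
apply: filterS Hc; first exact: (ae_filter_ringOfSetsType mu).
by move=> x /= h /h /eqP; rewrite subr_eq => /eqP.
Qed.

End weak_derivatives.

Section representation.
Context {R : realType}.
Local Notation mu := (@lebesgue_measure R).
Implicit Types (u v w U p phi : R -> R).

(** Both integrals vanish for test functions and are continuous for the H^1 norm.
    For a classical representative U they are U(1) - U(0) and U(1). *)
Lemma H10_boundary u : sobolevH10 u -> let v := weak_derivative 1 u in
  intab 0 1 v = 0 /\ intab 0 1 (fun x => u x + x * v x) = 0.
Proof.
move=> [sH dens] v; have [vL _] := sobolev_weak sH (leqnn 1).
have uL : L2_01 u by case: sH.
have Lid : L2_01 (fun x : R => x) by apply: L2_continuous => x; exact: cvg_id.
have small (r : R) : (forall e : R, 0 < e -> `|r| <= e) -> r = 0.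
  move=> h; apply/eqP; rewrite -normr_le0; apply/ler_addgt0Pl => e e0.
  by rewrite addr0; exact: h.
have key (e : R) : 0 < e -> `|intab 0 1 v| <= e /\ `|intab 0 1 (fun x => u x + x * v x)| <= e.
  move=> e0; have [phi tp] := dens _ e0.
  have sp := test_smooth tp; have cp := smooth_continuous sp.
  have cp' := smooth_continuous (smooth_derive sp).
  have pL : L2_01 phi by exact: L2_continuous.
  have pL' : L2_01 phi^`()%classic by exact: L2_continuous.
  have uB := L2B uL pL; have vB := L2B vL pL'.
  have p01 : phi 0 = 0 /\ phi 1 = 0 by split; apply: (test_eq0 tp); rewrite ?ltxx ?andbF.
  have I1 : intab 0 1 phi^`()%classic = 0.
    by rewrite (intab_FTC ler01 (fun x => smooth_is_derive x sp) cp') p01.1 p01.2 subrr.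
  have I2 : intab 0 1 (fun x => phi x + x * phi^`()%classic x) = 0.
    have d (x : R) : is_derive x 1 (fun x => x * phi x) (phi x + x * phi^`()%classic x).
      have dp := smooth_is_derive x sp.
      by apply: is_derive_eq; rewrite /GRing.scale /=; ring.
    rewrite (intab_FTC ler01 d) ?p01.1 ?p01.2 ?mulr0 ?subrr//.
    by move=> x; apply: cvgD; [exact: cp|apply: cvgM; [exact: cvg_id|exact: cp']].
  move=> small_e.
  have n1 := norm_intab_le_normL2 uB; have n2 := norm_intab_le_normL2 vB.
  have xvB : L2_01 (fun x => x * (v x - phi^`()%classic x)).
    apply/L2_01P; split; first by apply: measurable_funM; [exact: L2_mfun|exact: L2_mfun].
    have cxx : continuous (fun x : R => x * x) by move=> x; apply: cvgM; exact: cvg_id.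
    have := itgMc (L2_itg2 vB) (continuous_subspaceT cxx).
    by apply: itg_eq => x _; rewrite exprMn expr2; ring.
  have n3 : (`|intab 0 1 (fun x => x * (v x - phi^`()%classic x))|%:E <= normL2 (fun x => v x - phi^`()%classic x)%R)%E.
    apply: le_trans (norm_intab_le_normL2 xvB) _; apply: normL2_le => // x /andP[x0 x1].
    by rewrite normrM ler_piMl// ger0_norm.
  have E1 : intab 0 1 v = intab 0 1 (fun x => v x - phi^`()%classic x).
    by rewrite intabB ?I1 ?subr0//; exact: L2_itg.
  have E2 : intab 0 1 (fun x => u x + x * v x) = intab 0 1 (fun x => u x - phi x)
      + intab 0 1 (fun x => x * (v x - phi^`()%classic x)).
    rewrite -intabD; [|exact: L2_itg|exact: L2_itg].
    have iA : itg 0 1 (fun x => u x + x * v x) by apply: itgD; [exact: L2_itg|exact: L2_itgM].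
    have iB : itg 0 1 (fun x => phi x + x * phi^`()%classic x).
      by apply: itgD; [exact: L2_itg|exact: L2_itgM].
    have := intabB iA iB; rewrite I2 subr0 => <-.
    by apply: eq_intab => x _; ring.
  move: small_e n1 n2 n3; rewrite /= !normL2E// -EFinD !lte_fin !lee_fin.
  rewrite E1 E2 => s n1 n2 n3; split.
    by apply: (le_trans n2); apply: le_trans (ltW s); rewrite lerDr sqrtr_ge0.
  by apply: le_trans (ler_normD _ _) _; apply: le_trans (ltW s); exact: lerD.
by split; apply: small => e e0; have [] := key e e0.
Qed.

(** Two applications of weak_primitive give U and its derivative p; the boundary
    values come from H10_boundary. *)
Lemma H2_H10_rep u : H2_H10 u ->
  exists U p, H2rep U p (weak_derivative 2 u) /\ ae_eq01 u U.
Proof.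
move=> [sH2 sH10]; have [sH1 _] := sH10; have uL : L2_01 u by case: sH2.
have W1 := sobolev_weak sH1 (leqnn 1); have W2 := sobolev_weak sH2 (leqnn 2).
set v := weak_derivative 1 u in W1; set w := weak_derivative 2 u in W2 *.
have [vL _] := W1; have [wL _] := W2.
have P1 := weak_derivativeP uL W1; have P2 := weak_derivativeP uL W2.
have [||phi tp|p pp vp] := @weak_primitive R v w; [exact: L2_itg|exact: L2_itg| |].
  have := P1 _ (test_derive tp); have := P2 _ tp; rewrite derive1n1 expr1 => E1 E2.
  have : - 1 * intab 0 1 (fun x => v x * phi^`()%classic x) = (-1) ^+ 2 * intab 0 1 (fun x => w x * phi x).
    by rewrite -E1 -E2.
  by rewrite mulN1r sqrrN expr1n mul1r => /eqP; rewrite eqr_oppLR => /eqP.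
have ip : itg 0 1 p by apply: itg_within; exact: prim_within pp.
have mv := L2_mfun vL; have mu_ := L2_mfun uL; have mw := L2_mfun wL.
have [||phi tp|U pU uU] := @weak_primitive R u v; [exact: L2_itg|exact: L2_itg| |].
  by have := P1 _ tp; rewrite derive1n1 expr1 mulN1r.
have [B1 B2] := H10_boundary sH10; rewrite -/v in B1 B2.
have sub01 x : x <= 1 -> {ae mu, forall y, 0 < y < x -> v y = p y}.
  move=> x1; apply: filterS vp; first exact: (ae_filter_ringOfSetsType mu).
  by move=> y /= h /andP[y0 yx]; apply: h; rewrite y0 (lt_le_trans yx).
have mp x : x <= 1 -> measurable_fun (`[0, x] : set (measurableTypeR R)) p.
  by move=> x1; apply: itg_mfun; apply: itg_sub ip.
have Up : prim 0 1 U p.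
  split=> // x /andP[x0 x1]; have [_ /(_ x)] := pU; rewrite x0 x1 => /(_ isT) ->.
  congr (_ + _); apply: eq_ae_intab; [by apply: measurable_funTS|exact: mp|exact: sub01].
have iU : itg 0 1 U by apply: itg_within; exact: prim_within Up.
have U10 : U 1 = U 0.
  have [_ /(_ 1)] := pU; rewrite lexx ler01 => /(_ isT) ->.
  by rewrite B1 addr0.
have ixp : itg 0 1 (fun x => p x * x) by apply: itgMc => //; apply: continuous_subspaceT => x; exact: cvg_id.
have U1 : U 1 = 0.
  have c1 : continuous (fun _ : R => 1 : R) by move=> x; exact: cvg_cst.
  have := prim_ibp ler01 Up (fun x => is_derive_id x 1) c1.
  rewrite mulr1 mulr0 subr0 => E; rewrite -[RHS]B2.
  have -> : intab 0 1 (fun x => u x + x * v x) = intab 0 1 (fun x => U x * 1 + p x * x).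
    apply: eq_ae_intab.
    - apply: measurable_funTS; apply: measurable_funD => //; apply: measurable_funM => //.
    - apply: itg_mfun; apply: itgD => //; apply: itg_eq iU => x _; by rewrite mulr1.
    - apply: filterS2 uU vp; first exact: (ae_filter_ringOfSetsType mu).
      by move=> y /= h1 h2 h3; rewrite h1// h2//; ring.
  rewrite intabD//; last by apply: itg_eq iU => x _; rewrite mulr1.
  by rewrite E; ring.
exists U, p; split; last exact/ae_mu01P.
split=> //; [exact: L2_itg2|by rewrite -U10].
Qed.

End representation.

(** * Partial sums of the series of coth at pi / 2 *)

Section coth_series.
Context {R : realType}.
Implicit Types (n : nat) (x : R).

(** Integrals in the style of Wallis, which will evaluate the partial sums of the
    partial fraction series of coth at pi / 2. *)
Definition wallisC n : R := intab 0 (pi / 2) (fun x => cosh x * cos x ^+ n.*2).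
Definition wallisD n : R := intab 0 (pi / 2) (fun x => x * sinh x * cos x ^+ n.*2).

Lemma pihalf_ge0 : 0 <= pi / 2 :> R.
Proof. by rewrite divr_ge0// pi_ge0. Qed.

Lemma continuous_pow (f : R -> R) n : continuous f -> continuous (fun x => f x ^+ n).
Proof.
move=> cf; elim: n => [|n IH] x.
  by under eq_fun do rewrite expr0; exact: cvg_cst.
by under eq_fun do rewrite exprS; apply: cvgM; [exact: cf|exact: IH].
Qed.

Lemma continuous_mul (f g : R -> R) : continuous f -> continuous g -> continuous (fun x => f x * g x).
Proof. by move=> cf cg x; apply: cvgM; [exact: cf|exact: cg]. Qed.

Lemma continuous_add (f g : R -> R) : continuous f -> continuous g -> continuous (fun x => f x + g x).
Proof. by move=> cf cg x; apply: cvgD; [exact: cf|exact: cg]. Qed.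

Lemma continuous_scale (c : R) (f : R -> R) : continuous f -> continuous (fun x => c * f x).
Proof. by move=> cf x; apply: cvgM; [exact: cvg_cst|exact: cf]. Qed.

Lemma continuous_wallisC n : continuous (fun x : R => cosh x * cos x ^+ n.*2).
Proof.
by apply: continuous_mul; [exact: continuous_cosh|apply: continuous_pow; exact: continuous_cos].
Qed.

Lemma continuous_wallisD n : continuous (fun x : R => x * sinh x * cos x ^+ n.*2).
Proof.
apply: continuous_mul; last by apply: continuous_pow; exact: continuous_cos.
by apply: continuous_mul; [move=> x; exact: cvg_id|exact: continuous_sinh].
Qed.

Lemma is_derive_expS (f : R -> R) (df x : R) k : is_derive x 1 f df ->
  is_derive x 1 (fun y => f y ^+ k.+1) (k.+1%:R * (f x ^+ k * df)).
Proof.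
move=> d; elim: k => [|k IH].
  under eq_fun do rewrite expr1.
  by apply: (is_derive_eq d); rewrite expr0; ring.
under eq_fun do rewrite exprS.
by apply: is_derive_eq; rewrite /GRing.scale /= -[k.+2%:R]natr1 exprS; ring.
Qed.

Lemma wallis_derive (f g f1 g1 : R -> R) (m x : R) (p q : R -> R) (p1 q1 : R) :
  (forall y : R, is_derive y 1 f (f1 y)) -> (forall y : R, is_derive y 1 g (g1 y)) ->
  is_derive x 1 p p1 -> is_derive x 1 q q1 ->
  is_derive x 1 (fun y => f y * p y + m * (g y * (q y * sin y)))
   (f1 x * p x + f x * p1 + m * (g1 x * (q x * sin x) + g x * (q1 * sin x + q x * cos x))).
Proof.
by move=> df dg dp dq; apply: is_derive_eq; rewrite /GRing.scale /=; ring.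
Qed.

Lemma sinh_ge0 x : 0 <= x -> 0 <= sinh x.
Proof. by rewrite le_eqVlt => /predU1P[<-|/sinh_gt0/ltW//]; rewrite sinh0. Qed.

(** F is an antiderivative of the difference of the two integrands. *)
Lemma wallisC_rec n : (1 + (n.+1.*2)%:R ^+ 2) * wallisC n.+1 =
  (n.+1.*2)%:R * (n.*2.+1)%:R * wallisC n.
Proof.
pose F (x : R) := sinh x * cos x ^+ n.*2.+2 + (n.+1.*2)%:R * (cosh x * (cos x ^+ n.*2.+1 * sin x)).
pose f (x : R) := (1 + (n.+1.*2)%:R ^+ 2) * (cosh x * cos x ^+ n.+1.*2)
   - (n.+1.*2)%:R * (n.*2.+1)%:R * (cosh x * cos x ^+ n.*2).
have dF (x : R) : is_derive x 1 F (f x).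
  have dp := is_derive_expS n.*2.+1 (is_derive_cos x).
  have dq := is_derive_expS n.*2 (is_derive_cos x).
  have := wallis_derive (n.+1.*2)%:R (@is_derive_sinh R) (@is_derive_cosh R) dp dq.
  rewrite /F /f doubleS; move/is_derive_eq; apply.
  rewrite -[n.*2.+2%:R]natr1 -[n.*2.+1%:R]natr1.
  move: (n.*2%:R) => k; rewrite !exprS; move: (cos x ^+ n.*2) (cos2Dsin2 x) => q.
  move: (cosh x) (sinh x) (cos x) (sin x) => C S c s E.
  transitivity ((1 + (k + 1 + 1) ^+ 2) * (C * (c * (c * q))) - (k + 1 + 1) * (k + 1) * (C * q)
    + (k + 1 + 1) * (k + 1) * C * q * (1 - (c ^+ 2 + s ^+ 2))); first by ring.
  by rewrite E; ring.
have cf : continuous f.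
  apply: continuous_add; first by apply: continuous_scale; exact: continuous_wallisC.
  by move=> x; apply: cvgN; apply: (continuous_scale (@continuous_wallisC n)).
have := intab_FTC pihalf_ge0 dF cf.
rewrite /F cos_pihalf sinh0 sin0 !expr0n /= !(mul0r, mulr0) !addr0 subr0.
rewrite intabB; [|by apply: itgZ; apply: itg_continuous; exact: continuous_wallisC
  |by apply: itgZ; apply: itg_continuous; exact: continuous_wallisC].
rewrite !intabZ; [|by apply: itg_continuous; exact: continuous_wallisC
  |by apply: itg_continuous; exact: continuous_wallisC].
by move/eqP; rewrite subr_eq0 => /eqP.
Qed.

Lemma wallisD_rec n : 2 * wallisC n.+1 + (1 + (n.+1.*2)%:R ^+ 2) * wallisD n.+1 =
  (n.+1.*2)%:R * (n.*2.+1)%:R * wallisD n.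
Proof.
pose F (x : R) := x * (cosh x * cos x ^+ n.*2.+2 + (n.+1.*2)%:R * (sinh x * (cos x ^+ n.*2.+1 * sin x)))
  + sinh x * cos x ^+ n.*2.+2.
pose f (x : R) := 2 * (cosh x * cos x ^+ n.+1.*2) + (1 + (n.+1.*2)%:R ^+ 2) * (x * sinh x * cos x ^+ n.+1.*2)
   - (n.+1.*2)%:R * (n.*2.+1)%:R * (x * sinh x * cos x ^+ n.*2).
have dF (x : R) : is_derive x 1 F (f x).
  have dp := is_derive_expS n.*2.+1 (is_derive_cos x).
  have dq := is_derive_expS n.*2 (is_derive_cos x).
  have dG := wallis_derive (n.+1.*2)%:R (@is_derive_cosh R) (@is_derive_sinh R) dp dq.
  have dx := is_derive_id x 1.
  rewrite /F /f doubleS; apply: is_derive_eq; rewrite /GRing.scale /=.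
  rewrite -[n.*2.+2%:R]natr1 -[n.*2.+1%:R]natr1.
  move: (n.*2%:R) => k; rewrite !exprS; move: (cos x ^+ n.*2) (cos2Dsin2 x) => q.
  move: (cosh x) (sinh x) (cos x) (sin x) => C S c s E.
  transitivity (2 * (C * (c * (c * q))) + (1 + (k + 1 + 1) ^+ 2) * (x * S * (c * (c * q)))
    - (k + 1 + 1) * (k + 1) * (x * S * q)
    + x * (k + 1 + 1) * (k + 1) * S * q * (1 - (c ^+ 2 + s ^+ 2))); first by ring.
  by rewrite E; ring.
have ic k : itg 0 (pi / 2) (fun x : R => cosh x * cos x ^+ k.*2) by apply: itg_continuous; exact: continuous_wallisC.
have id k : itg 0 (pi / 2) (fun x : R => x * sinh x * cos x ^+ k.*2) by apply: itg_continuous; exact: continuous_wallisD.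
have cf : continuous f.
  apply: continuous_add.
    by apply: continuous_add; apply: continuous_scale; [exact: continuous_wallisC|exact: continuous_wallisD].
  by move=> x; apply: cvgN; apply: (continuous_scale (@continuous_wallisD n)).
have := intab_FTC pihalf_ge0 dF cf.
rewrite /F cos_pihalf sinh0 sin0 !expr0n /= !(mul0r, mulr0) !addr0 !mulr0 subr0.
rewrite intabB; [|by apply: itgD; exact: itgZ|exact: itgZ].
rewrite intabD; [|exact: itgZ|exact: itgZ].
rewrite !intabZ//.
by move/eqP; rewrite subr_eq0 => /eqP.
Qed.

Lemma wallisC0 : wallisC 0 = sinh (pi / 2).
Proof.
rewrite /wallisC (@eq_intab _ _ _ _ cosh); last by move=> x _; rewrite expr0 mulr1.
rewrite (intab_FTC pihalf_ge0 (@is_derive_sinh R)) ?sinh0 ?subr0//.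
exact: continuous_cosh.
Qed.

Lemma wallisD0 : wallisD 0 = pi / 2 * cosh (pi / 2) - sinh (pi / 2).
Proof.
rewrite /wallisD (@eq_intab _ _ _ _ (fun x => x * sinh x)); last by move=> x _; rewrite expr0 mulr1.
have d (x : R) : is_derive x 1 (fun x => x * cosh x - sinh x) (x * sinh x).
  by apply: is_derive_eq; rewrite /GRing.scale /=; ring.
rewrite (intab_FTC pihalf_ge0 d) ?sinh0 ?mul0r ?subr0//.
by apply: continuous_mul; [move=> x; exact: cvg_id|exact: continuous_sinh].
Qed.

Lemma wallisC_gt0 n : 0 < wallisC n.
Proof.
elim: n => [|n IH]; first by rewrite wallisC0 sinh_pihalf_gt0.
have := wallisC_rec n; have : 0 < (n.+1.*2)%:R * (n.*2.+1)%:R * wallisC n.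
  by rewrite !mulr_gt0// ltr0n.
move=> h E; move: h; rewrite -E pmulr_rgt0// ltr_wpDr// sqr_ge0//.
Qed.

Lemma wallisD_ge0 n : 0 <= wallisD n.
Proof.
apply: intab_ge0 => x /andP[x0 xp]; apply: mulr_ge0.
  by apply: mulr_ge0 => //; exact: sinh_ge0.
by rewrite -mul2n exprM exprn_ge0// sqr_ge0.
Qed.

(** It suffices to have x sinh x (cos x)^2 <= (sin x)^2 cosh x, which holds since
    tanh x <= x <= tan x. *)
Lemma wallisD_le n : wallisD n.+1 <= wallisC n - wallisC n.+1.
Proof.
have ic k : itg 0 (pi / 2) (fun x : R => cosh x * cos x ^+ k.*2) by apply: itg_continuous; exact: continuous_wallisC.
have id k : itg 0 (pi / 2) (fun x : R => x * sinh x * cos x ^+ k.*2) by apply: itg_continuous; exact: continuous_wallisD.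
rewrite /wallisC -intabB//; apply: le_intab => //; first exact: itgB.
move=> x /andP[x0 xp].
have -> : cosh x * cos x ^+ n.*2 - cosh x * cos x ^+ n.+1.*2 = cosh x * sin x ^+ 2 * cos x ^+ n.*2.
  by rewrite sin2cos2 doubleS 2!exprS; ring.
rewrite doubleS (_ : cos x ^+ n.*2.+2 = cos x ^+ 2 * cos x ^+ n.*2); last by rewrite !exprS expr0; ring.
rewrite mulrA ler_wpM2r//; first by rewrite -mul2n exprM exprn_ge0// sqr_ge0.
have h1 : sinh x <= x * cosh x.
  suff : 0 <= x * cosh x - sinh x by lra.
  have d (y : R) : is_derive y 1 (fun x => x * cosh x - sinh x) (y * sinh y).
    by apply: is_derive_eq; rewrite /GRing.scale /=; ring.
  apply: (ge0_from_derive d) x0 => [|y y0]; first by rewrite sinh0; lra.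
  by move: y0; rewrite le_eqVlt => /predU1P[<-|y0]; rewrite ?mul0r// mulr_ge0// ltW// sinh_gt0.
have h2 : x * cos x <= sin x.
  suff : 0 <= sin x - x * cos x by lra.
  have [->|xn0] := eqVneq x 0; first by rewrite sin0; lra.
  have d (y : R) : is_derive y 1 (fun x => sin x - x * cos x) (y * sin y).
    by apply: is_derive_eq; rewrite /GRing.scale /=; ring.
  have xgt0 : 0 < x by rewrite lt_neqAle eq_sym xn0.
  have [c /andP[c0 cx]] := MVT_is_derive xgt0 d.
  rewrite sin0 mul0r !subr0 => ->; rewrite mulr_ge0// mulr_ge0 ?(ltW c0)// sin_ge0_pi//.
  by rewrite (ltW c0)/=; have := @pi_gt0 R; lra.
have c0 : 0 <= cos x by apply: cos_ge0_pihalf; rewrite xp andbT; have := @pi_gt0 R; lra.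
have C0 := @cosh_gt0 R x.
have s0 := sinh_ge0 x0.
have h3 : x * sinh x <= x * (x * cosh x) by rewrite ler_wpM2l.
have h4 : x * sinh x * cos x ^+ 2 <= x * (x * cosh x) * cos x ^+ 2 by rewrite ler_wpM2r ?sqr_ge0.
apply: (le_trans h4).
have -> : x * (x * cosh x) * cos x ^+ 2 = cosh x * (x * cos x) ^+ 2 by ring.
by rewrite ler_wpM2l ?(ltW C0)// lerXn2r// ?nnegrE ?mulr_ge0// (le_trans _ h2)// mulr_ge0.
Qed.

(** By the two recurrences, wallisD n / wallisC n decreases by
    2 / (1 + 4 (n + 1)^2) from n to n + 1; its initial value involves
    coth (pi / 2) and its limit is 0. *)
Lemma coth_partial_sum n :
  \sum_(1 <= j < n.+1) 2 / (1 + (j.*2)%:R ^+ 2) = pi / 2 * coth (pi / 2) - 1 - wallisD n / wallisC n :> R.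
Proof.
elim: n => [|n IH].
  rewrite big_geq// wallisD0 wallisC0 cothE; field.
  by rewrite gt_eqF// sinh_pihalf_gt0.
rewrite big_nat_recr//= IH.
have c0 := wallisC_gt0 n; have c1 := wallisC_gt0 n.+1.
have := wallisC_rec n; have := wallisD_rec n.
set q := 1 + _; set k := _ * _%:R => E1 E2.
have q0 : 0 < q by rewrite ltr_wpDr// sqr_ge0.
have k0 : 0 < k by rewrite mulr_gt0// ltr0n.
have -> : wallisD n = (2 * wallisC n.+1 + q * wallisD n.+1) / k.
  by rewrite E1 mulrC mulKf// gt_eqF.
have -> : wallisC n = q * wallisC n.+1 / k by rewrite E2 mulrC mulKf// gt_eqF.
by field; rewrite !gt_eqF.
Qed.

Lemma wallis_ratio_le n : wallisD n.+1 / wallisC n.+1 <= 3 / (n.*2.+1)%:R.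
Proof.
have c0 := wallisC_gt0 n; have c1 := wallisC_gt0 n.+1.
rewrite ler_pdivrMr//; apply: le_trans (wallisD_le n) _.
have := wallisC_rec n; rewrite doubleS; set m : R := n.*2.+1%:R.
have -> : n.*2.+2%:R = m + 1 by rewrite /m natr1.
have m1 : 1 <= m by rewrite ler1n.
move=> E; have -> : wallisC n = (1 + (m + 1) ^+ 2) / ((m + 1) * m) * wallisC n.+1.
  by rewrite mulrAC E mulrC mulKf// gt_eqF// mulr_gt0//; lra.
rewrite -[X in _ - X]mul1r -mulrBl ler_wpM2r ?(ltW c1)//.
have -> : (1 + (m + 1) ^+ 2) / ((m + 1) * m) - 1 = (m + 2) / (m + 1) / m.
  by field; rewrite !gt_eqF//; lra.
rewrite ler_pM2r ?invr_gt0; last by lra.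
by rewrite ler_pdivrMr; lra.
Qed.

End coth_series.

(** * The Green function of the beam equation with pole 1/2 *)

Section gluing.
Context {R : realType}.
Local Notation mu := (@lebesgue_measure R).
Implicit Types (a b c : R) (f P w : R -> R).

Lemma itg_glue a b c f : a <= c -> c <= b -> itg a c f -> itg c b f -> itg a b f.
Proof.
move=> ac cb h1 h2.
have h3 : mu.-integrable `]c, b] (EFin \o f).
  by apply: integrableS h2 => //; apply: subset_itvr; rewrite bnd_simp.
have i1 := (integrable_mkcond _ _).1 h1; have i3 := (integrable_mkcond _ _).1 h3.
apply/integrable_mkcond => //; rewrite restrict_EFin.
have := integrableD _ (i1 _) (i3 _).
move=> /(_ measurableT (measurable_itv _) (measurable_itv _)); apply: eq_integrable => // x _ /=.
rewrite /patch !mem_setE !in_itv /=; have -> : point = 0%E :> \bar R by [].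
have [xc|cx] := leP x c; first by rewrite (le_trans xc cb) !andbT addr0; case: ifP.
by rewrite andbF (le_trans ac (ltW cx)) /= add0r; case: ifP.
Qed.

Lemma prim_glue a b c P w : a <= c -> c <= b -> prim a c P w -> prim c b P w -> prim a b P w.
Proof.
move=> ac cb [i1 h1] [i2 h2]; split; first exact: itg_glue i1 i2.
move=> x /andP[ax xb]; have [xc|cx] := leP x c; first by apply: h1; rewrite ax.
have cx' := ltW cx.
rewrite h2 ?cx'// h1 ?ac ?lexx// (@intab_split _ a x c) ?addrA//.
by apply: itg_sub (itg_glue ac cb i1 i2).
Qed.

Lemma prim_eq a b P w P' w' : (forall x, a <= x <= b -> P x = P' x) ->
  (forall x, a <= x <= b -> w x = w' x) -> prim a b P' w' -> prim a b P w.
Proof.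
move=> eP ew [i h]; split; first by apply: itg_eq i => x /ew.
move=> x xab; have [ax xb] := andP xab.
have ab := le_trans ax xb.
rewrite (eP x xab) (h x xab) (eP a); last by rewrite lexx.
congr (_ + _).
by apply: eq_intab => y /andP[ay yx]; rewrite ew// ay (le_trans yx).
Qed.

End gluing.

Section green_function.
Context {R : realType}.
Implicit Types (x : R) (U p w : R -> R).

(** Reflections across 1 / 2. *)
Definition fold_even (f : R -> R) x : R := if x <= 1 / 2 then f x else f (1 - x).
Definition fold_odd (f : R -> R) x : R := if x <= 1 / 2 then f x else - f (1 - x).

Definition green0 := fold_even (beam0 1 1 pi : R -> R).
Definition green1 := fold_odd (beam1 1 1 pi : R -> R).
Definition green2 := fold_even (beam2 1 1 pi : R -> R).

Lemma fold_evenL f x : x <= 1 / 2 -> fold_even f x = f x.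
Proof. by rewrite /fold_even => ->. Qed.

Lemma fold_evenR f x : 1 / 2 <= x -> fold_even f x = f (1 - x).
Proof.
by rewrite /fold_even => x1; case: leP => // x2; have {1}-> : x = 1 - x by lra.
Qed.

Lemma beam_mid : (beam0 1 1 pi (1 / 2) = cosh (pi / 2) :> R) *
  (beam1 1 1 pi (1 / 2) = 0 :> R) * (beam3 1 1 pi (1 / 2) = - (4 * pi ^+ 3 * sinh (pi / 2)) :> R).
Proof.
rewrite /beam0 /beam1 /beam3 (_ : pi * (1 / 2) = pi / 2); last by lra.
by rewrite cos_pihalf sin_pihalf; split; [split|]; ring.
Qed.

Lemma green1R x : 1 / 2 <= x -> green1 x = - beam1 1 1 pi (1 - x).
Proof.
rewrite /green1 /fold_odd => x1; case: leP => // x2.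
have -> : x = 1 / 2 by lra.
by rewrite (_ : 1 - 1 / 2 = 1 / 2) ?beam_mid ?oppr0//; lra.
Qed.

Let half0 : (0 : R) <= 1 / 2. Proof. lra. Qed.
Let half1 : (1 / 2 : R) <= 1. Proof. lra. Qed.

Lemma green_prim : prim 0 1 green0 green1 /\ prim 0 1 green1 green2.
Proof.
have bg := beamP 1 1 (pi : R); have bg' := beam_refl bg.
have [l1 l2] := beam_prim 0 (1 / 2) bg; have [r1 r2] := beam_prim (1 / 2) 1 bg'.
split; apply: (prim_glue half0 half1).
- by apply: prim_eq l1 => x /andP[_ x2]; rewrite /green0 /green1 /fold_even /fold_odd x2.
- by apply: prim_eq r1 => x /andP[x2 _]; [rewrite /green0 fold_evenR|rewrite green1R].
- by apply: prim_eq l2 => x /andP[_ x2]; rewrite /green2 /green1 /fold_even /fold_odd x2.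
- by apply: prim_eq r2 => x /andP[x2 _]; [rewrite green1R|rewrite /green2 fold_evenR].
Qed.

Lemma green_ends : (green0 0 = 0) * (green0 1 = 0).
Proof.
by rewrite /green0 fold_evenL// fold_evenR// subrr !prof_at0.
Qed.

Lemma green_rep : H2rep green0 green1 green2.
Proof.
have [g1 g2] := green_prim; split=> //; try by rewrite green_ends.
have c2 : continuous (fun x => beam2 1 1 pi x ^+ 2 : R).
  have [_ _ d2 _] := beamP 1 1 (pi : R); have c := derive_continuous d2.
  by move=> x; under eq_fun do rewrite expr2; apply: cvgM; exact: c.
apply: (itg_glue half0 half1).
  by apply: itg_eq (@itg_continuous _ _ _ _ c2) => x /andP[_ x2]; rewrite /green2 fold_evenL.
have c2' : continuous (fun x => beam2 1 1 pi (1 - x) ^+ 2 : R).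
  have [_ _ d2 _] := beam_refl (beamP 1 1 (pi : R)); have c := derive_continuous d2.
  by move=> x; under eq_fun do rewrite expr2; apply: cvgM; exact: c.
by apply: itg_eq (@itg_continuous _ _ _ _ c2') => x /andP[x2 _]; rewrite /green2 fold_evenR.
Qed.

(** The jump at 1 / 2 of the third derivative of green0. *)
Definition green_jump : R := 8 * pi ^+ 3 * sinh (pi / 2).

Lemma itg_prod_prim P w P' w' : prim 0 1 P w -> prim 0 1 P' w' ->
  itg 0 1 (fun x => P x * P' x).
Proof.
move=> h h'; have c := prim_within ler01 h; have c' := prim_within ler01 h'.
by apply: itgMc => //; exact: itg_within.
Qed.

Lemma itg_w_green2 (w : R -> R) : itg 0 1 w -> itg 0 1 (fun x => w x * green2 x).
Proof.
move=> iw; have [_ _ d2 _] := beamP 1 1 (pi : R); have [_ _ d2' _] := beam_refl (beamP 1 1 (pi : R)).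
apply: (itg_glue half0 half1).
  have i1 : itg 0 (1 / 2) w by apply: itg_sub iw.
  apply: itg_eq (itgMc i1 (continuous_subspaceT (derive_continuous d2))) => x /andP[_ x2].
  by rewrite /green2 fold_evenL.
have i1 : itg (1 / 2) 1 w by apply: itg_sub iw.
apply: itg_eq (itgMc i1 (continuous_subspaceT (derive_continuous d2'))) => x /andP[x2 _].
by rewrite /green2 fold_evenR.
Qed.

(** On each half green0 solves the beam equation, so that the identity of Green
    leaves boundary terms only; at 1 / 2 those with U survive because the third
    derivative of green0 jumps there. *)
Lemma green_reproducing U p w : H2rep U p w ->
  intab 0 1 (fun x => w x * green2 x) + 4 * pi ^+ 4 * intab 0 1 (fun x => U x * green0 x)
  = green_jump * U (1 / 2).
Proof.
move=> [Up pw iw2 U0 U1].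
have bg := beamP 1 1 (pi : R); have bg' := beam_refl bg.
have L := green_identity half0 (prim_sub (lexx _) half1 Up) (prim_sub (lexx _) half1 pw) bg.
have Rr := green_identity half1 (prim_sub half0 (lexx _) Up) (prim_sub half0 (lexx _) pw) bg'.
have iU := itg_prod_prim Up green_prim.1.
have iw := itg_w_green2 pw.1.
rewrite (intab_split iw half0 half1) (intab_split iU half0 half1).
rewrite (@eq_intab _ 0 (1 / 2) (fun x => w x * green2 x) (fun x => w x * beam2 1 1 pi x));
  last by move=> x /andP[_ x2]; rewrite /green2 fold_evenL.
rewrite (@eq_intab _ (1 / 2) 1 (fun x => w x * green2 x) (fun x => w x * beam2 1 1 pi (1 - x)));
  last by move=> x /andP[x2 _]; rewrite /green2 fold_evenR.
rewrite (@eq_intab _ 0 (1 / 2) (fun x => U x * green0 x) (fun x => U x * beam0 1 1 pi x));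
  last by move=> x /andP[_ x2]; rewrite /green0 fold_evenL.
rewrite (@eq_intab _ (1 / 2) 1 (fun x => U x * green0 x) (fun x => U x * beam0 1 1 pi (1 - x)));
  last by move=> x /andP[x2 _]; rewrite /green0 fold_evenR.
transitivity ((intab 0 (1 / 2) (fun x => w x * beam2 1 1 pi x) + 4 * pi ^+ 4 * intab 0 (1 / 2) (fun x => U x * beam0 1 1 pi x)) +
  (intab (1 / 2) 1 (fun x => w x * beam2 1 1 pi (1 - x)) + 4 * pi ^+ 4 * intab (1 / 2) 1 (fun x => U x * beam0 1 1 pi (1 - x)))); first by ring.
rewrite L Rr U0 U1 subrr !prof_at0 (_ : 1 - 1 / 2 = 1 / 2 :> R); last by lra.
by rewrite !beam_mid /green_jump; ring.
Qed.

(** d/dy [sinh 2y - sin 2y - (cosh 2y sin 2y - sinh 2y cos 2y)] is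
    2 (3 (sinh y cos y - cosh y sin y)^2 - (sinh y cos y + cosh y sin y)^2)
    and the bracket vanishes at 0 and at pi/2. *)
Lemma green_equipartition :
  3 * intab 0 1 (fun x => green2 x ^+ 2) = 4 * pi ^+ 4 * intab 0 1 (fun x => green0 x ^+ 2).
Proof.
pose F x : R := 2 * pi ^+ 3 * (2 * (sinh (pi * x) * cosh (pi * x)) - 2 * (sin (pi * x) * cos (pi * x))
  - ((cosh (pi * x) * cosh (pi * x) + sinh (pi * x) * sinh (pi * x)) * (2 * (sin (pi * x) * cos (pi * x)))
     - 2 * (sinh (pi * x) * cosh (pi * x)) * (cos (pi * x) * cos (pi * x) - sin (pi * x) * sin (pi * x)))).
pose f x : R := 3 * beam2 1 1 pi x ^+ 2 - 4 * pi ^+ 4 * beam0 1 1 pi x ^+ 2.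
have dF (x : R) : is_derive x 1 F (f x).
  rewrite /F; apply: is_derive_eq; rewrite /GRing.scale /= /f /beam2 /beam0.
  have := cos2Dsin2 (pi * x); have := cosh2sinh2 (pi * x).
  move: (cosh _) (sinh _) (cos _) (sin _) => C S c s E1 E2; move: pi => q.
  transitivity (4 * q ^+ 4 * ((C ^+ 2 + S ^+ 2) * (c ^+ 2 + s ^+ 2)
     - (c ^+ 2 - s ^+ 2) * (C ^+ 2 - S ^+ 2) - 8 * (S * C * s * c))); last by ring.
  by rewrite E1 E2; ring.
have F0 : F 0 = 0 by rewrite /F mulr0 sinh0 sin0; ring.
have F2 : F (1 / 2) = 0.
  by rewrite /F (_ : pi * (1 / 2) = pi / 2); [rewrite cos_pihalf sin_pihalf; ring|lra].
have [d0 _ d2 _] := beamP 1 1 (pi : R); have [e0 _ e2 _] := beam_refl (beamP 1 1 (pi : R)).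
have cf2 (g0 g2 : R -> R) : continuous g0 -> continuous g2 -> continuous (fun x => 3 * g2 x ^+ 2 - 4 * pi ^+ 4 * g0 x ^+ 2).
  move=> c0 c2 x; under eq_fun do rewrite !expr2.
  by apply: cvgB; (apply: cvgM; first exact: cvg_cst); apply: cvgM; solve [exact: c0|exact: c2].
have cf : continuous f by apply: cf2; [exact: derive_continuous d0|exact: derive_continuous d2].
have cfr : continuous (fun x => f (1 - x)).
  by apply: cf2; [exact: derive_continuous e0|exact: derive_continuous e2].
have L := intab_FTC half0 dF cf.
have dFr (x : R) : is_derive x 1 (fun y => - F (1 - y)) (f (1 - x)).
  by have := is_deriveN (is_derive_refl (dF (1 - x))); rewrite opprK.
have Rr := intab_FTC half1 dFr cfr.
have [gp0 gp1] := green_prim; have [_ _ ig2 _ _] := green_rep.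
have ig0 : itg 0 1 (fun x => green0 x ^+ 2).
  by apply: itg_eq (itg_prod_prim gp0 gp0) => x _; rewrite expr2.
apply/eqP; rewrite -subr_eq0 -!intabZ// -intabB; [|exact: itgZ|exact: itgZ].
rewrite (@intab_split _ _ _ (1 / 2))//; last by apply: itgB; exact: itgZ.
rewrite (@eq_intab _ 0 (1 / 2) _ f); last by move=> x /andP[_ x2]; rewrite /green0 /green2 !fold_evenL.
rewrite (@eq_intab _ (1 / 2) 1 _ (fun x => f (1 - x))); last by move=> x /andP[x2 _]; rewrite /green0 /green2 !fold_evenR.
rewrite L Rr subrr (_ : 1 - 1 / 2 = 1 / 2 :> R); last by lra.
by rewrite F0 F2; apply/eqP; ring.
Qed.

Lemma green_energies (A := intab 0 1 (fun x => green2 x ^+ 2)) (B := intab 0 1 (fun x => green0 x ^+ 2)) :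
  A + 4 * pi ^+ 4 * B = green_jump * cosh (pi / 2).
Proof.
have := green_reproducing green_rep; rewrite [in X in _ = X]/green0 fold_evenL// beam_mid => <-.
by rewrite /A /B; congr (_ + _ * _); apply: eq_intab => x _; rewrite expr2.
Qed.

End green_function.

(** * Sine sums *)

Section sine_sums.
Context {R : realType}.
Implicit Types (n m N : nat) (x : R) (f U p w : R -> R).

Lemma sin_npi n : sin (pi * n%:R) = 0 :> R.
Proof.
elim: n => [|n IH]; first by rewrite mulr0 sin0.
by rewrite -natr1 mulrDr mulr1 sinDpi IH oppr0.
Qed.

(** The derivatives of order 0, 1, 2, 3 of sin (pi n x). *)
Definition sine0 n x := sin (pi * n%:R * x).
Definition sine1 n x := pi * n%:R * cos (pi * n%:R * x).
Definition sine2 n x := - (pi * n%:R) ^+ 2 * sin (pi * n%:R * x).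
Definition sine3 n x := - (pi * n%:R) ^+ 3 * cos (pi * n%:R * x).

Lemma sineP n : beam_solution (- (pi * n%:R) ^+ 4) (sine0 n) (sine1 n) (sine2 n) (sine3 n).
Proof.
split=> x; rewrite /sine0 /sine1 /sine2 /sine3; move: (pi * n%:R) => k;
  by apply: is_derive_eq; rewrite /GRing.scale /=; ring.
Qed.

Lemma sine_continuous n : continuous (sine0 n) /\ continuous (sine2 n).
Proof.
by have [d0 _ d2 _] := sineP n; split; [exact: derive_continuous d0|exact: derive_continuous d2].
Qed.

Lemma sine_ends n : (sine0 n 0 = 0) * (sine0 n 1 = 0) * (sine2 n 0 = 0) * (sine2 n 1 = 0).
Proof.
by rewrite /sine0 /sine2 !mulr0 !mulr1 sin_npi sin0 !mulr0.
Qed.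

(** The sine modes satisfy all the boundary conditions, so that Green's identity has
    no boundary terms. *)
Lemma sine_mode_energy n U p w : H2rep U p w ->
  intab 0 1 (fun x => w x * sine2 n x) = (pi * n%:R) ^+ 4 * intab 0 1 (fun x => U x * sine0 n x).
Proof.
move=> [Up pw iw2 U0 U1].
have := green_identity ler01 Up pw (sineP n); rewrite U0 U1 !sine_ends.
by move=> E; apply/eqP; rewrite -subr_eq0 -mulNr E; apply/eqP; ring.
Qed.

Lemma sine_rep n : H2rep (sine0 n) (sine1 n) (sine2 n).
Proof.
have [p0 p1] := beam_prim 0 1 (sineP n); split=> //; try by rewrite sine_ends.
apply: itg_continuous => x; under eq_fun do rewrite expr2.
by have [_ c] := sine_continuous n; apply: cvgM; exact: c.
Qed.

(** Eigenfunctions for the distinct eigenvalues (pi n)^4 and (pi m)^4. *)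
Lemma sine_orthogonal n m : (0 < n)%N -> (0 < m)%N -> n != m ->
  intab 0 1 (fun x => sine0 n x * sine0 m x) = 0.
Proof.
move=> n0 m0 nm; have := sine_mode_energy m (sine_rep n).
set I := intab 0 1 (fun x => sine0 n x * sine0 m x).
rewrite (@eq_intab _ _ _ _ (fun x => (pi * n%:R) ^+ 2 * (pi * m%:R) ^+ 2 * (sine0 n x * sine0 m x))); last first.
  by move=> x _; rewrite /sine2 /sine0; ring.
have [cn _] := sine_continuous n; have [cm _] := sine_continuous m.
rewrite intabZ -/I; last by apply: itg_continuous => x; apply: cvgM; [exact: cn|exact: cm].
move=> E; have : pi ^+ 4 * m%:R ^+ 2 * (n%:R ^+ 2 - m%:R ^+ 2) * I = 0.
  by rewrite -[RHS](subrr ((pi * m%:R) ^+ 4 * I)) -{1}E; ring.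
have nz : pi ^+ 4 * m%:R ^+ 2 * (n%:R ^+ 2 - m%:R ^+ 2) != 0 :> R.
  apply: mulf_neq0; first by apply: mulf_neq0; apply: expf_neq0; rewrite ?pnatr_eq0 -?lt0n// gt_eqF// pi_gt0.
  by rewrite subr_eq0 eqrXn2// eqr_nat.
by move/eqP; rewrite mulf_eq0 (negPf nz) => /eqP.
Qed.

Lemma sine_norm n : (0 < n)%N -> intab 0 1 (fun x => sine0 n x * sine0 n x) = 1 / 2.
Proof.
move=> n0; have k0 : pi * n%:R != 0 :> R by rewrite mulf_neq0// ?pnatr_eq0 -?lt0n// gt_eqF// pi_gt0.
have e1 : sin (pi * n%:R * 1) = 0 :> R by rewrite mulr1 sin_npi.
rewrite /sine0; move: (pi * n%:R) k0 e1 => k k0 e1.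
have d (x : R) : is_derive x 1 (fun x => 1 / 2 * x - (2 * k)^-1 * (sin (k * x) * cos (k * x))) (sin (k * x) * sin (k * x)).
  apply: is_derive_eq; rewrite /GRing.scale /=; have := cos2Dsin2 (k * x).
  move: (cos _) (sin _) => c s E; transitivity (1 / 2 * (1 - (c ^+ 2 + s ^+ 2)) + s * s).
    by field.
  by rewrite E; ring.
rewrite (intab_FTC ler01 d).
  by rewrite e1 (mulr0 k) sin0; ring.
have ds (x : R) : is_derive x 1 (fun x => sin (k * x)) (cos (k * x) * k).
  by apply: is_derive_eq; rewrite /GRing.scale /=; ring.
by move=> x; apply: cvgM; exact: (derive_continuous ds).
Qed.

Lemma intab_sum_mul a b f (r : seq nat) (c : nat -> R) (g : nat -> R -> R) :
  itg a b f -> (forall n, continuous (g n)) ->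
  intab a b (fun x => f x * \sum_(n <- r) c n * g n x) = \sum_(n <- r) c n * intab a b (fun x => f x * g n x).
Proof.
move=> jf cg; have cs (s : seq nat) : continuous (fun x => \sum_(n <- s) c n * g n x).
  elim: s => [|n s IH] x; first by under eq_fun do rewrite big_nil; exact: cvg_cst.
  under eq_fun do rewrite big_cons.
  by apply: cvgD; [apply: cvgM; [exact: cvg_cst|exact: cg]|exact: IH].
have im (h : R -> R) : continuous h -> itg a b (fun x => f x * h x).
  by move=> ch; apply: itgMc => //; exact: continuous_subspaceT.
elim: r => [|n r IH].
  rewrite big_nil -[RHS](mul0r (intab a b f)) -intabZ//; apply: eq_intab => x _.
  by rewrite big_nil mulr0 mul0r.
rewrite big_cons -IH -intabZ; last exact: im.
rewrite -intabD; [|by apply: itgZ; exact: im|exact: im].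
by apply: eq_intab => x _; rewrite big_cons; ring.
Qed.

Lemma is_derive_bigsum (r : seq nat) (c : nat -> R) (g g' : nat -> R -> R) x :
  (forall n, is_derive x 1 (g n) (g' n x)) ->
  is_derive x 1 (fun y => \sum_(n <- r) c n * g n y) (\sum_(n <- r) c n * g' n x).
Proof.
move=> dg; elim: r => [|n r IH].
  by under eq_fun do rewrite big_nil; rewrite big_nil; exact: is_derive_cst.
under eq_fun do rewrite big_cons; rewrite big_cons.
have dn := dg n.
by apply: is_derive_eq; rewrite /GRing.scale /=; ring.
Qed.

(** Fourier coefficients of the solution of u'''' + 4 pi^4 u = delta_(1/2). *)
Definition green_coef n : R := 2 * sin (pi * n%:R * (1 / 2)) / (pi ^+ 4 * n%:R ^+ 4 + 4 * pi ^+ 4).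

Definition sine_sum (e : nat -> R -> R) N x := \sum_(1 <= n < N) green_coef n * e n x.

Lemma sine_sum_derive (e e' : nat -> R -> R) N x : (forall n, is_derive x 1 (e n) (e' n x)) ->
  is_derive x 1 (sine_sum e N) (sine_sum e' N x).
Proof. by move=> d; exact: is_derive_bigsum. Qed.

Lemma sine_sum_rep N : H2rep (sine_sum sine0 N) (sine_sum sine1 N) (sine_sum sine2 N).
Proof.
have d0 (x : R) : is_derive x 1 (sine_sum sine0 N) (sine_sum sine1 N x).
  by apply: sine_sum_derive => n; have [d _ _ _] := sineP n.
have d1 (x : R) : is_derive x 1 (sine_sum sine1 N) (sine_sum sine2 N x).
  by apply: sine_sum_derive => n; have [_ d _ _] := sineP n.
have d2 (x : R) : is_derive x 1 (sine_sum sine2 N) (sine_sum sine3 N x).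
  by apply: sine_sum_derive => n; have [_ _ d _] := sineP n.
have c1 := derive_continuous d1; have c2 := derive_continuous d2.
split; try exact: prim_C1.
- by apply: itg_continuous => x; under eq_fun do rewrite expr2; apply: cvgM; exact: c2.
- by apply: big1 => n _; rewrite sine_ends mulr0.
- by apply: big1 => n _; rewrite sine_ends mulr0.
Qed.

Lemma green_coef_den n : 0 < pi ^+ 4 * n%:R ^+ 4 + 4 * pi ^+ 4 :> R.
Proof.
have q0 : 0 < pi ^+ 4 :> R by rewrite exprn_gt0// pi_gt0.
apply: ltr_wpDl; last by rewrite mulr_gt0.
by apply: mulr_ge0; [exact: ltW|exact: exprn_ge0].
Qed.

(** The denominator of a Fourier coefficient is exactly the energy of its mode, so
    that only the value of the mode at 1 / 2 is left. *)
Lemma sine_sum_energy N U p w : H2rep U p w ->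
  intab 0 1 (fun x => w x * sine_sum sine2 N x) + 4 * pi ^+ 4 * intab 0 1 (fun x => U x * sine_sum sine0 N x) =
  2 * \sum_(1 <= n < N) sin (pi * n%:R * (1 / 2)) * intab 0 1 (fun x => U x * sine0 n x).
Proof.
move=> rep; have [Up pw _ _ _] := rep.
have iU : itg 0 1 U by apply: itg_within; exact: prim_within Up.
rewrite !intab_sum_mul//; try by move=> n; have [] := sine_continuous n.
  2: by case: pw.
rewrite !mulr_sumr -big_split/=; apply: eq_bigr => n _.
rewrite (sine_mode_energy n rep) /green_coef; have := green_coef_den n.
set D := _ + _ => D0; have -> : (pi * n%:R) ^+ 4 = D - 4 * pi ^+ 4 by rewrite /D; ring.
move: (intab _ _ _) (sin _) (4 * _) => I t q; move: D D0 => D D0; field.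
by rewrite lt0r_neq0.
Qed.

(** By orthogonality the integrals in sine_sum_energy are half the coefficients of the
    partial sum, so that they add up to its value at 1 / 2. *)
Lemma sine_sum_self_energy N :
  intab 0 1 (fun x => sine_sum sine2 N x * sine_sum sine2 N x) +
    4 * pi ^+ 4 * intab 0 1 (fun x => sine_sum sine0 N x * sine_sum sine0 N x) = sine_sum sine0 N (1 / 2).
Proof.
rewrite (sine_sum_energy N (sine_sum_rep N)) mulr_sumr /sine_sum.
rewrite !big_nat; apply: eq_bigr => n /andP[n0 nN].
have [cn _] := sine_continuous n.
rewrite (@eq_intab _ _ _ _ (fun x => sine0 n x * sine_sum sine0 N x)); last by move=> x _; rewrite mulrC.
rewrite intab_sum_mul; [|exact: itg_continuous|by move=> k; have [] := sine_continuous k].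
rewrite (bigD1_seq n) ?mem_index_iota ?n0 ?iota_uniq//=.
rewrite sine_norm// big_seq_cond big1 ?addr0 => [|k].
  by rewrite /sine0; field.
rewrite mem_index_iota => /andP[/andP[k0 _] kn].
by rewrite sine_orthogonal ?mulr0// eq_sym.
Qed.

Lemma sine_sum_green_energy N :
  intab 0 1 (fun x => sine_sum sine2 N x * green2 x) +
    4 * pi ^+ 4 * intab 0 1 (fun x => sine_sum sine0 N x * green0 x) = green_jump * sine_sum sine0 N (1 / 2).
Proof. exact: green_reproducing (sine_sum_rep N). Qed.

End sine_sums.

(** * Convergence of the sine series *)

Section green_series_limit.
Context {R : realType}.
Implicit Types (n m N : nat) (x z : R) (f P U p w : R -> R).
Local Notation s := (coth (pi / 2) : R).

Lemma sin_half_even n : sin (pi * n.*2%:R * (1 / 2)) = 0 :> R.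
Proof.
by rewrite -muln2 natrM (_ : pi * (n%:R * 2%:R) * (1 / 2) = pi * n%:R) ?sin_npi//; field.
Qed.

Lemma sin_half_odd n : sin (pi * n.*2.+1%:R * (1 / 2)) ^+ 2 = 1 :> R.
Proof.
rewrite -natr1 -muln2 natrM (_ : pi * (n%:R * 2%:R + 1) * (1 / 2) = pi * n%:R + pi / 2); last by field.
by rewrite sinDpihalf; have := cos2Dsin2 (pi * n%:R : R); rewrite sin_npi expr0n /= addr0.
Qed.

Lemma sin_half_sqr n : sin (pi * n%:R * (1 / 2)) ^+ 2 = `|sin (pi * n%:R * (1 / 2))| :> R.
Proof.
rewrite -(odd_double_half n); case: (odd n); last by rewrite add0n sin_half_even normr0 expr0n.
rewrite add1n; have h := sin_half_odd n./2; rewrite h.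
have : `|sin (pi * n./2.*2.+1%:R * (1 / 2))| ^+ 2 = 1 :> R by rewrite real_normK ?num_real.
by move/eqP; rewrite sqrp_eq1// => /eqP.
Qed.

Lemma sine_mid n : green_coef n * sine0 n (1 / 2) = 2 * `|sin (pi * n%:R * (1 / 2))| / (pi ^+ 4 * n%:R ^+ 4 + 4 * pi ^+ 4) :> R.
Proof. by rewrite -sin_half_sqr /green_coef /sine0; move: (_^-1) => d; ring. Qed.

Lemma sine_mid_ge0 n : 0 <= green_coef n * sine0 n (1 / 2) :> R.
Proof. by rewrite sine_mid divr_ge0 ?mulr_ge0// ltW// green_coef_den. Qed.

Lemma sine_sum_mid_mono N N' : (N <= N')%N ->
  sine_sum sine0 N (1 / 2) <= sine_sum sine0 N' (1 / 2) :> R.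
Proof.
elim: N' => [|N' IH]; first by rewrite leqn0 => /eqP ->.
rewrite leq_eqVlt => /predU1P[->//|]; rewrite ltnS => /IH h; apply: (le_trans h).
case: N' {IH h} => [|N']; first by rewrite /sine_sum !big_geq.
by rewrite {2}/sine_sum big_nat_recr//= lerDl sine_mid_ge0.
Qed.

(** n^4 + 4 = ((n + 1)^2 + 1) ((n - 1)^2 + 1), so the sum over odd n telescopes
    up to a sum of 1 / (4 j^2 + 1). *)
Lemma sine_sum_mid m : sine_sum sine0 m.+1.*2 (1 / 2) =
  (4 * pi ^+ 4)^-1 * ((m.+1.*2%:R + 1) / (m.+1.*2%:R ^+ 2 + 1) + 1 +
    \sum_(1 <= j < m.+1) 2 / (1 + (j.*2)%:R ^+ 2)) :> R.
Proof.
have pi4 : pi ^+ 4 != 0 :> R by rewrite expf_neq0// gt_eqF// pi_gt0.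
elim: m => [|m IH].
  rewrite /sine_sum big_nat1 [in RHS]big_geq// sine_mid -sin_half_sqr (sin_half_odd 0).
  have -> : 1.*2%:R = 2 :> R by [].
  rewrite expr1n; move: (pi ^+ 4) pi4 => q q0.
  by field; rewrite q0 /= mulr_natl -mulrS mulrn_eq0 q0.
rewrite [in RHS]big_nat_recr//= /sine_sum [m.+2.*2]doubleS 2?big_nat_recr//= -/(sine_sum _ _ _) IH.
rewrite !sine_mid -!sin_half_sqr sin_half_even sin_half_odd.
have -> : m.+1.*2.+2%:R = m.+1.*2%:R + 2 :> R by rewrite -!natr1; ring.
rewrite -[m.+1.*2.+1%:R]natr1; move: (m.+1.*2%:R) (ler0n R m.+1.*2) => t t0.
set S := \sum_(_ <= _ < _) _.
have -> : pi ^+ 4 * (t + 1) ^+ 4 + 4 * pi ^+ 4 = pi ^+ 4 * (((t + 2) ^+ 2 + 1) * (t ^+ 2 + 1)) by ring.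
have h1 : (t + 2) ^+ 2 + 1 != 0 by apply: lt0r_neq0; nra.
have h2 : t ^+ 2 + 1 != 0 by apply: lt0r_neq0; nra.
have h3 : 1 + t ^+ 2 != 0 by apply: lt0r_neq0; nra.
rewrite expr0n /= mulr0 mul0r addr0; move: (pi ^+ 4) pi4 => q q0.
rewrite (addrC 1 (t ^+ 2)); field; move: h1 h2; rewrite q0 ?mulr1 => -> ->.
by [].
Qed.

(** The value at 1 / 2 of the remainder of the series, computed with its expected
    sum. *)
Definition green_gap N : R := cosh (pi / 2) / green_jump - sine_sum sine0 N (1 / 2).

Lemma green_jump_gt0 : 0 < green_jump :> R.
Proof.
rewrite /green_jump; apply: mulr_gt0; first by rewrite mulr_gt0// exprn_gt0// pi_gt0.
exact: sinh_pihalf_gt0.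
Qed.

Lemma green_mid : cosh (pi / 2) / green_jump = s / (8 * pi ^+ 3) :> R.
Proof.
rewrite cothE /green_jump invfM; move: (cosh _) (sinh _)^-1 (_ * _)^-1 => a b c; ring.
Qed.

(** By the explicit partial sums the gap is at most wallisD (n + 1) / wallisC (n + 1). *)
Lemma green_gap_le n N : (n.+2.*2 <= N)%N -> green_gap N <= 3 / (n.*2.+1)%:R.
Proof.
move=> nN; have h := sine_sum_mid_mono nN.
apply: (@le_trans _ _ (green_gap n.+2.*2)); first by rewrite /green_gap; lra.
apply: le_trans (wallis_ratio_le n).
rewrite /green_gap green_mid sine_sum_mid coth_partial_sum.
have q0 := @wallisC_gt0 R n.+1; have r0 : 0 <= wallisD n.+1 / wallisC n.+1 :> R.
  by apply: divr_ge0; [exact: wallisD_ge0|exact: ltW].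
set r := wallisD _ / _ in r0 *.
set A := (_ + 1) / _; have A0 : 0 <= A.
  by rewrite /A divr_ge0// addr_ge0// sqr_ge0.
have p0 := @pi_gt0 R; have p2 := @pi_ge2 R.
have -> : s / (8 * pi ^+ 3) - (4 * pi ^+ 4)^-1 * (A + 1 + (pi / 2 * s - 1 - r)) = (r - A) / (4 * pi ^+ 4).
  move: (pi : R) p0 A r s {h q0 r0 A0 p2} => q q0 A r t; field.
  exact: lt0r_neq0.
have d1 : 1 <= 4 * pi ^+ 4 :> R.
  have : 1 <= pi ^+ 4 :> R by apply: exprn_ege1; lra.
  lra.
rewrite ler_pdivrMr; last by lra.
by nra.
Qed.

Lemma primZB P w P' w' (k : R) : prim 0 1 P w -> prim 0 1 P' w' ->
  prim 0 1 (fun x => P x - k * P' x) (fun x => w x - k * w' x).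
Proof.
move=> [i h] [i' h']; split; first by apply: itgB => //; exact: itgZ.
move=> x x01; have [x0 x1] := andP x01; have j := itg_sub (lexx 0) x1 i; have j' := itg_sub (lexx 0) x1 i'.
by rewrite h// h'// intabB// ?intabZ//; [ring|exact: itgZ].
Qed.

(** Expanding the square, the three energies are sine_sum_self_energy,
    sine_sum_green_energy and green_energies. *)
Lemma sine_residual N (k := green_jump^-1 : R) :
  intab 0 1 (fun x => (sine_sum sine2 N x - k * green2 x) ^+ 2) +
  4 * pi ^+ 4 * intab 0 1 (fun x => (sine_sum sine0 N x - k * green0 x) ^+ 2) = green_gap N.
Proof.
have [Sp Sq iS2 _ _] := sine_sum_rep (R := R) N; have [Gp Gq iG2 _ _] := @green_rep R.
have e1 := sine_sum_self_energy (R := R) N; have e2 := sine_sum_green_energy (R := R) N.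
have e3 := @green_energies R.
have J0 := green_jump_gt0.
have expand (f g : R -> R) : itg 0 1 (fun x => f x * f x) -> itg 0 1 (fun x => f x * g x) ->
    itg 0 1 (fun x => g x ^+ 2) ->
    intab 0 1 (fun x => (f x - k * g x) ^+ 2) = intab 0 1 (fun x => f x * f x)
    - 2 * k * intab 0 1 (fun x => f x * g x) + k ^+ 2 * intab 0 1 (fun x => g x ^+ 2).
  move=> iff ifg igg.
  rewrite -!intabZ// -intabB//; last exact: itgZ.
  rewrite -intabD//; [|by apply: itgB => //; exact: itgZ|exact: itgZ].
  by apply: eq_intab => x _; ring.
rewrite !expand.
- rewrite /green_gap; move: e1 e2 e3 => /=.
  set a := intab 0 1 (fun x => sine_sum sine2 N x * _); set b := intab 0 1 (fun x => sine_sum sine0 N x * sine_sum _ _ _).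
  set c := intab _ _ _; set d := intab _ _ _; set e := intab _ _ _; set f := intab _ _ _.
  move=> e1 e2 e3.
  transitivity ((a + 4 * pi ^+ 4 * b) - 2 * k * (c + 4 * pi ^+ 4 * d) + k ^+ 2 * (e + 4 * pi ^+ 4 * f)); first by ring.
  rewrite e1 e2 e3 /k; move: (sine_sum _ _ _) (cosh _) green_jump J0 => X Y Z Z0.
  by field; rewrite gt_eqF.
- exact: (itg_prod_prim Sp Sp).
- exact: itg_prod_prim Sp Gp.
- by apply: itg_eq (itg_prod_prim Gp Gp) => x _; rewrite expr2.
- by apply: itg_eq iS2 => x _; rewrite expr2.
- by apply: itg_w_green2; case: Sq.
- exact: iG2.
Qed.

Lemma green_gap_ge0 N : 0 <= green_gap N.
Proof.
rewrite -sine_residual; apply: addr_ge0; [|apply: mulr_ge0; first by rewrite mulr_ge0// exprn_ge0// pi_ge0];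
  by apply: intab_ge0 => x _; exact: sqr_ge0.
Qed.

Lemma green_gap_cvg : green_gap @ \oo --> (0 : R).
Proof.
apply/cvgrPdist_lt => e e0; near=> N.
rewrite sub0r normrN ger0_norm ?green_gap_ge0//.
have b0 : 0 <= 3 / e by rewrite divr_ge0// ltW.
have := Num.Theory.archi_boundP b0; set n := Num.bound _ => hn.
apply: (@le_lt_trans _ _ (3 / (n.*2.+1)%:R)).
  by apply: green_gap_le; near: N; exact: nbhs_infty_ge.
rewrite ltr_pdivrMr ?ltr0n// mulrC -ltr_pdivrMr//; apply: (lt_le_trans hn).
by rewrite ler_nat -addnn; apply: leq_trans (leqnSn _); exact: leq_addr.
Unshelve. all: by end_near. Qed.

Lemma prim_osc P w z x : prim 0 1 P w -> 0 <= z <= 1 -> 0 <= x <= 1 ->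
  `|P x - P z| <= intab 0 1 (fun y => `|w y|).
Proof.
move=> Pw; wlog zx : x z / z <= x.
  move=> H hz hx; have [zx|/ltW xz] := leP z x; first exact: H.
  by rewrite distrC; exact: H.
move=> /andP[z0 z1] /andP[x0 x1].
have [i h] := prim_sub z0 (lexx _) Pw; have iw := Pw.1.
have inw := itg_norm iw.
rewrite h ?zx// addrAC subrr add0r; apply: (le_trans (le_norm_intab (itg_sub z0 x1 iw))).
rewrite (intab_split inw z0 z1) (intab_split (itg_sub z0 (lexx _) inw) zx x1).
have a1 : 0 <= intab 0 z (fun y => `|w y|) by apply: intab_ge0.
have a2 : 0 <= intab x 1 (fun y => `|w y|) by apply: intab_ge0.
by lra.
Qed.

Lemma intab_norm_le w : itg 0 1 w -> itg 0 1 (fun y => w y ^+ 2) ->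
  intab 0 1 (fun y => `|w y|) <= Num.sqrt (intab 0 1 (fun y => w y ^+ 2)).
Proof.
move=> iw iw2; have e : (fun y => w y ^+ 2) = fun y => `|w y| ^+ 2.
  by apply/funext => y; rewrite real_normK ?num_real.
rewrite -[leLHS]ger0_norm; last by apply: intab_ge0.
rewrite -sqrtr_sqr ler_wsqrtr// e; apply: intab_sqr_le; first exact: itg_norm.
by rewrite -e.
Qed.

Lemma sine1_mid N : sine_sum sine1 N (1 / 2) = 0 :> R.
Proof.
apply: big1 => n _; rewrite /sine1 /green_coef.
have : sin (pi * n%:R * (1 / 2)) * cos (pi * n%:R * (1 / 2)) = 0 :> R.
  have : sin (pi * n%:R * (1 / 2) + pi * n%:R * (1 / 2)) = 0 :> R.
    by rewrite -[RHS](sin_npi n); congr sin; field.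
  by rewrite sinD; lra.
move: (sin (pi * n%:R * (1 / 2))) (cos (pi * n%:R * (1 / 2))) (pi ^+ 4 * _ + _) => a b c E.
by transitivity (2 * (a * b) * c^-1 * (pi * n%:R)); [ring|rewrite E; ring].
Qed.

Lemma residual_rep N (k := green_jump^-1 : R) :
  prim 0 1 (fun x => sine_sum sine0 N x - k * green0 x) (fun x => sine_sum sine1 N x - k * green1 x) /\
  prim 0 1 (fun x => sine_sum sine1 N x - k * green1 x) (fun x => sine_sum sine2 N x - k * green2 x).
Proof.
have [Sp Sq _ _ _] := sine_sum_rep (R := R) N; have [Gp Gq _ _ _] := @green_rep R.
by split; exact: primZB.
Qed.

(** The derivative of the remainder vanishes at 1 / 2, and its second derivative is
    small in L_2. *)
Lemma residual_sup1 N x : 0 <= x <= 1 ->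
  `|sine_sum sine1 N x - green_jump^-1 * green1 x| <= Num.sqrt (green_gap N).
Proof.
move=> x01; have [_ p1] := residual_rep N.
have h : 0 <= (1 / 2 : R) <= 1 by lra.
have := prim_osc p1 h x01; rewrite sine1_mid {2}/green1 /fold_odd lexx beam_mid mulr0 !subr0.
move=> /le_trans; apply.
have [Sp Sq iS2 _ _] := sine_sum_rep (R := R) N; have [Gp Gq iG2 _ _] := @green_rep R.
have sq : itg 0 1 (fun y : R => (sine_sum sine2 N y - green_jump^-1 * green2 y) ^+ 2).
  have i1 := itg_w_green2 Sq.1.
  apply: itg_eq (itgD (itgD iS2 (itgZ (- 2 * green_jump^-1) i1)) (itgZ (green_jump^-1 ^+ 2) iG2)) => y _.
  by ring.
apply: (le_trans (intab_norm_le p1.1 sq)); rewrite ler_wsqrtr// -sine_residual lerDl.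
apply: mulr_ge0; first by rewrite mulr_ge0// exprn_ge0// pi_ge0.
by apply: intab_ge0 => y _; exact: sqr_ge0.
Qed.

Lemma residual_sup0 N x : 0 <= x <= 1 ->
  `|sine_sum sine0 N x - green_jump^-1 * green0 x| <= Num.sqrt (green_gap N).
Proof.
move=> x01; have [p0 p1] := residual_rep N.
have h : 0 <= (0 : R) <= 1 by rewrite lexx ler01.
have [_ _ _ S0 _] := sine_sum_rep (R := R) N.
have := prim_osc p0 h x01; rewrite S0 green_ends mulr0 !subr0.
move=> /le_trans; apply.
rewrite -[leRHS]mulr1 -{2}(subr0 1) -intab_cst//; apply: le_intab.
- exact: itg_norm p0.1.
- by apply: itg_continuous => y; exact: cvg_cst.
- by move=> y; exact: residual_sup1.
Qed.

Lemma sine_sum_cvg x : 0 <= x <= 1 -> sine_sum sine0 N x @[N --> \oo] --> (green_jump^-1 * green0 x : R).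
Proof.
move=> x01; apply/cvgrPdist_le => e e0.
have cs : Num.sqrt (green_gap N) @[N --> \oo] --> (0 : R).
  by rewrite -[X in _ --> X]sqrtr0; apply: continuous_cvg; [exact: sqrt_continuous|exact: green_gap_cvg].
have /cvgrPdist_le /(_ e e0) := cs; apply: filterS => N.
rewrite sub0r normrN ger0_norm ?sqrtr_ge0// => h; rewrite distrC.
exact: le_trans (residual_sup0 N x01) h.
Qed.

Definition green_lim : R -> R := green_series (4 * pi ^+ 4) (1 / 2).

Definition green_partial N x : R := \sum_(1 <= n < N)
  (sin (pi * n%:R * x) * sin (pi * n%:R * (1 / 2)) / (pi ^+ 4 * n%:R ^+ 4 + 4 * pi ^+ 4)).

Lemma green_partialE N x : 2 * green_partial N x = sine_sum sine0 N x.
Proof.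
rewrite /green_partial /sine_sum mulr_sumr; apply: eq_bigr => n _.
by rewrite /green_coef /sine0; move: (_^-1) => d; ring.
Qed.

(** Since sin (pi n / 2) is 0, 1 or - 1, its absolute value is its square, so that the
    terms at 1 / 2 dominate those at x.  Convergence is needed for every real x, for the
    sum to be a measurable function on the line. *)
Lemma green_partial_cvg x : cvgn (green_partial ^~ x).
Proof.
pose u y n : R := sin (pi * n%:R * y) * sin (pi * n%:R * (1 / 2)) / (pi ^+ 4 * n%:R ^+ 4 + 4 * pi ^+ 4).
have ser y : green_partial ^~ y = series (u y).
  apply/funext => N; rewrite /series /= /green_partial; case: N => [|N]; first by rewrite !big_geq.
  by rewrite [RHS]big_nat_recl//= {1}/u mulr0 mul0r sin0 !mul0r add0r big_add1.
rewrite ser; apply: normed_cvg.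
have mid n : u (1 / 2) n = `|sin (pi * n%:R * (1 / 2))| / (pi ^+ 4 * n%:R ^+ 4 + 4 * pi ^+ 4).
  by rewrite /u -expr2 sin_half_sqr.
apply: (@series_le_cvg _ _ (u (1 / 2))).
- by move=> n; exact: normr_ge0.
- by move=> n; rewrite mid divr_ge0// ltW// green_coef_den.
- move=> n; rewrite mid /u /= normrM normfV (gtr0_norm (green_coef_den n)).
  rewrite ler_pM2r ?invr_gt0 ?green_coef_den// normrM ler_piMl//.
  by rewrite ler_norml sin_geN1 sin_le1.
rewrite -ser; have h : 0 <= (1 / 2 : R) <= 1 by lra.
have -> : green_partial ^~ (1 / 2) = fun N => 2^-1 * sine_sum sine0 N (1 / 2).
  by apply/funext => N; rewrite -green_partialE mulKf.
apply/cvg_ex; eexists; apply: cvgM; first exact: cvg_cst.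
exact: sine_sum_cvg h.
Qed.

Lemma sine_sum_green_lim x : sine_sum sine0 N x @[N --> \oo] --> green_lim x.
Proof.
under eq_fun do rewrite -green_partialE.
by apply: cvgM; [exact: cvg_cst|exact: green_partial_cvg].
Qed.

Lemma green_limE x : 0 <= x <= 1 -> green_lim x = green_jump^-1 * green0 x.
Proof.
move=> x01; exact: (cvg_unique _ (sine_sum_green_lim (x := x)) (sine_sum_cvg x01)).
Qed.

Lemma sine_sum_continuous N : continuous (sine_sum sine0 N : R -> R).
Proof.
apply: (derive_continuous (f := sine_sum sine1 N)) => x.
by apply: sine_sum_derive => n; have [d _ _ _] := sineP (R := R) n.
Qed.

Lemma green_lim_mfun : measurable_fun (setT : set (measurableTypeR R)) green_lim.
Proof.
apply: (@measurable_fun_cvg _ _ _ _ (sine_sum sine0)) => [N|x _]; last exact: sine_sum_green_lim.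
exact: continuous_mfun (@sine_sum_continuous N).
Qed.

End green_series_limit.

(** * Approximation by test functions, weak derivatives of primitives *)

Section boundary_cutoff.
Context {R : realType}.
Implicit Types (x y z : R) (f g phi : R -> R).

(** The product x (1 - x) plays the role of the distance to the boundary: the cutoff
    vanishes where it is at most 1 / (n + 1). *)
Definition cutoff (n : nat) x : R := bump (n.+1%:R * (x * (1 - x)) - 1).
Definition cutoff' (n : nat) x : R :=
  flat 'X^2 (n.+1%:R * (x * (1 - x)) - 1) * (n.+1%:R * (1 - 2 * x)).

Lemma is_derive_cutoff n x : is_derive x 1 (cutoff n) (cutoff' n x).
Proof.
have dq : is_derive x 1 (fun x : R => n.+1%:R * (x * (1 - x)) - 1) (n.+1%:R * (1 - 2 * x)).
  by apply: is_derive_eq; rewrite /GRing.scale /=; ring.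
have := @is_derive1_comp R bump (fun x : R => n.+1%:R * (x * (1 - x)) - 1) x _ _ (is_derive_bump _) dq.
by [].
Qed.

Lemma smooth_cutoff n : smooth (cutoff n : R -> R).
Proof.
apply: smooth_comp; first exact: smooth_flat.
have := smoothD (@smooth_cst R (-1)) (smoothM (@smooth_cst R n.+1%:R) (smoothM (@smooth_id R) (@smooth_affine R 1 (-1)))).
by congr smooth; apply/funext => x; ring.
Qed.

Lemma cutoff_test n f : smooth f -> test_function (fun x => f x * cutoff n x).
Proof.
move=> sf; have n0 : 0 < n.+1%:R^-1 :> R by rewrite invr_gt0 ltr0n.
apply: (@smooth_test _ n.+1%:R^-1 (1 - n.+1%:R^-1)); first exact: n0.
  by rewrite ltrBlDr ltrDl.
  by apply: (smoothM sf); exact: smooth_cutoff.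
move=> x nx; rewrite /cutoff bumpE ifN ?mulr0// -leNgt subr_le0.
have N0 : 0 < n.+1%:R :> R by rewrite ltr0n.
rewrite -ler_pdivlMl// mulr1; move: (n.+1%:R^-1) n0 nx => e e0 nx {N0}.
have [xe|ex] := leP x e; first by have [x0|x0] := leP x 0; nra.
have [xe'|ex'] := leP (1 - e) x; first by have [x1|x1] := leP 1 x; nra.
by exfalso; apply: nx; rewrite ex ex'.
Qed.

Lemma near_cutoff_pos x : 0 < x < 1 ->
  \forall n \near \oo, 0 < n.+1%:R * (x * (1 - x)) - 1.
Proof.
move=> /andP[x0 x1]; have q0 : 0 < x * (1 - x) by apply: mulr_gt0 => //; lra.
near=> n.
have b0 : 0 <= (x * (1 - x))^-1 by rewrite invr_ge0 ltW.
have := Num.Theory.archi_boundP b0; set m := Num.bound _ => hm.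
rewrite subr_gt0 -ltr_pdivrMr// mul1r; apply: (lt_trans hm); rewrite ltr_nat ltnS.
by near: n; exact: nbhs_infty_ge.
Unshelve. all: by end_near. Qed.

Lemma cutoff_arg_cvg x : 0 < x < 1 ->
  (n.+1%:R * (x * (1 - x)) - 1)^-1 @[n --> \oo] --> (0 : R).
Proof.
move=> x01; have /andP[x0 x1] := x01; have q0 : 0 < x * (1 - x) by apply: mulr_gt0 => //; lra.
apply/cvgrPdist_lt => e e0; near=> n.
have np : 0 < n.+1%:R * (x * (1 - x)) - 1 by near: n; exact: near_cutoff_pos.
rewrite sub0r normrN gtr0_norm ?invr_gt0//.
rewrite invf_plt ?posrE// ltrBrDr -ltr_pdivrMr//.
have b0 : 0 <= (e^-1 + 1) / (x * (1 - x)) by rewrite divr_ge0 ?(ltW q0)// addr_ge0// invr_ge0 ltW.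
have := Num.Theory.archi_boundP b0; set m := Num.bound _ => hm.
apply: (lt_trans hm); rewrite ltr_nat ltnS.
by near: n; exact: nbhs_infty_ge.
Unshelve. all: by end_near. Qed.

(** Of the two mean value estimates from 0 and from 1, use the one for the nearer
    end.  This decay compensates the growth of the derivative of the cutoff. *)
Lemma boundary_linear f f' : (forall x, is_derive x 1 f (f' x)) -> continuous f' ->
  f 0 = 0 -> f 1 = 0 -> exists2 L : R, 0 <= L &
  forall x, 0 <= x <= 1 -> `|f' x| <= L /\ `|f x| <= 2 * L * (x * (1 - x)).
Proof.
move=> df cf f0 f1.
have [L HL] := bounded_within (continuous_subspaceT cf : {within `[0, 1], continuous f'}).
have L0 : 0 <= L by apply: le_trans (HL 0 _) => //; rewrite lexx ler01.
exists L => // x /andP[x0 x1]; split; first by rewrite HL// x0.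
have h0 : `|f x| <= L * x.
  move: x0; rewrite le_eqVlt => /predU1P[<-|x0]; first by rewrite f0 normr0 mulr0.
  have [c /andP[c0 cx]] := MVT_is_derive x0 df; rewrite f0 !subr0 => ->.
  by rewrite normrM (gtr0_norm x0) ler_pM2r// HL// (ltW c0)/= (le_trans (ltW cx)).
have h1 : `|f x| <= L * (1 - x).
  move: x1; rewrite le_eqVlt => /predU1P[->|x1]; first by rewrite f1 normr0 subrr mulr0.
  have [c /andP[cx c1]] := MVT_is_derive x1 df; rewrite f1 sub0r => E.
  have s1 : 0 < 1 - x by lra.
  by rewrite -normrN E normrM (gtr0_norm s1) ler_pM2r// HL// (ltW c1) andbT (le_trans x0 (ltW cx)).
have [x2|x2] := leP x (1 / 2).
  have := mulr_ge0 (mulr_ge0 L0 x0) (_ : 0 <= 1 - 2 * x); rewrite !subr_ge0; lra.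
by have := mulr_ge0 (mulr_ge0 L0 (_ : 0 <= 1 - x)) (_ : 0 <= 2 * x - 1); rewrite !subr_ge0; lra.
Qed.

(** With y = (n + 1) x (1 - x) - 1, the left-hand side is at most
    (1 / y + 1 / y^2) exp (- 1 / y), which is bounded. *)
Lemma cutoff'_bound : exists2 C : R, 0 <= C &
  forall n x, 0 <= x <= 1 -> x * (1 - x) * `|cutoff' n x| <= C.
Proof.
have [C HC] := poly_exp_bounded ('X + 'X^2 : {poly R}).
have C0 : 0 <= C by apply: le_trans (HC 0 (lexx 0)).
exists C => // n x /andP[x0 x1].
have q0 : 0 <= x * (1 - x) by apply: mulr_ge0 => //; lra.
rewrite /cutoff' /flat; case: ifPn => y0; last by rewrite mul0r normr0 mulr0.
have N0 : 0 < n.+1%:R :> R by rewrite ltr0n.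
set y := _ - 1 in y0 *; have yE : n.+1%:R * (x * (1 - x)) = y + 1 by rewrite /y subrK.
have z0 : 0 <= y^-1 by rewrite invr_ge0 ltW.
apply: le_trans (le_trans (ler_norm _) (HC _ z0)).
rewrite hornerD hornerX hornerXn !normrM (ger0_norm (expR_ge0 _)) (gtr0_norm N0).
rewrite (ger0_norm z0).
have t1 : `|1 - 2 * x| <= 1 by rewrite ler_norml; apply/andP; split; lra.
have E0 := expR_ge0 (- y^-1).
have -> : y^-1 + y^-1 ^+ 2 = (n.+1%:R * (x * (1 - x))) * (y^-1 * y^-1).
  by rewrite yE; field; exact: lt0r_neq0.
set e := expR _ in E0 *; set Z := y^-1 * y^-1; have Z0 : 0 <= Z by apply: mulr_ge0.
have -> : x * (1 - x) * (Z * e * (n.+1%:R * `|1 - 2 * x|)) =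
   (n.+1%:R * (x * (1 - x)) * Z * e) * `|1 - 2 * x| by ring.
apply: ler_piMr => //.
by apply: mulr_ge0 => //; apply: mulr_ge0 => //; apply: mulr_ge0 => //; exact: ltW.
Qed.

(** The approximations are f times the cutoffs.  Both integrands are bounded, by the
    two preceding lemmas, and tend to 0 at each point, where they are functions of
    the inverse of the argument of the bump. *)
Lemma boundary_approx f f' (e : R) : smooth f -> (forall x, is_derive x 1 f (f' x)) -> continuous f' ->
  f 0 = 0 -> f 1 = 0 -> 0 < e -> exists2 phi, test_function phi &
  intab 0 1 (fun x => (f x - phi x) ^+ 2) < e /\ intab 0 1 (fun x => (f' x - phi^`()%classic x) ^+ 2) < e.
Proof.
move=> sf df cf' f0 f1 e0.
have [L L0 HL] := boundary_linear df cf' f0 f1; have [C C0 HC] := cutoff'_bound.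
have cf := derive_continuous df.
have cchi n : continuous (cutoff n : R -> R) .
  by apply: smooth_continuous; exact: smooth_cutoff.
have cchi' n : continuous (cutoff' n : R -> R).
  have -> : cutoff' n = (cutoff n)^`()%classic.
    by apply/funext => x; rewrite derive1E; have [_ ->] := is_derive_cutoff n x.
  by apply: smooth_continuous; apply: smooth_derive; exact: smooth_cutoff.
pose phi n x := f x * cutoff n x.
pose phi' n x := f' x * cutoff n x + f x * cutoff' n x.
have dphi n : (phi n)^`()%classic = phi' n.
  apply/funext => x; rewrite derive1E; have d1 := df x; have d2 := is_derive_cutoff n x.
  have [_ ->] : is_derive x 1 (phi n) (phi' n x); last by [].
  by apply: is_derive_eq; rewrite /GRing.scale /= /phi'; ring.
have sqc (g h : R -> R) : continuous g -> continuous h -> continuous (fun x => (g x - h x) ^+ 2).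
  by move=> cg ch x; under eq_fun do rewrite expr2; apply: cvgM; apply: cvgB; solve [exact: cg|exact: ch].
have cphi n : continuous (phi n) by move=> x; apply: cvgM; [exact: cf|exact: cchi].
have cphi' n : continuous (phi' n).
  by move=> x; apply: cvgD; apply: cvgM; solve [exact: cf|exact: cchi|exact: cf'|exact: cchi'].
have chi01 n x : 0 <= cutoff n x <= 1 by rewrite bump_ge0 bump_le1.
have mcf a b (g : R -> R) : continuous g -> measurable_fun (`[a, b] : set (measurableTypeR R)) g.
  by move=> cg; apply: itg_mfun; exact: itg_continuous.
have ev (F : nat -> R -> R) (Psi : R -> R -> R) x : 0 < x < 1 ->
    (forall n, 0 < n.+1%:R * (x * (1 - x)) - 1 -> F n x = Psi x (n.+1%:R * (x * (1 - x)) - 1)^-1) ->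
    continuous (Psi x) -> Psi x 0 = 0 -> F n x @[n --> \oo] --> (0 : R).
  move=> x01 FP cP P0; have h : Psi x (n.+1%:R * (x * (1 - x)) - 1)^-1 @[n --> \oo] --> (0 : R).
    by rewrite -[X in _ --> X]P0; apply: continuous_cvg; [exact: cP|exact: cutoff_arg_cvg].
  apply: cvg_trans h; apply: near_eq_cvg; near=> n; apply/esym; apply: FP.
  by near: n; exact: near_cutoff_pos.
have l1 : intab 0 1 (fun x => (f x - phi n x) ^+ 2) @[n --> \oo] --> (0 : R).
  suff : intab 0 1 (fun x => (f x - phi n x) ^+ 2) @[n --> \oo] --> intab 0 1 (fun=> 0 : R) by rewrite (intab_cst 0 ler01) mul0r.
  apply: (@intab_dct R 0 1 (fun n => (fun x => (f x - phi n x) ^+ 2)) (fun=> 0) (fun=> L ^+ 2)).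
  - by move=> n; apply: mcf; exact: sqc.
  - exact: measurable_cst.
  - by apply: itg_continuous => x; exact: cvg_cst.
  - move=> n x x01; have [_ h] := HL x x01; have /andP[c1 c2] := chi01 n x; have /andP[x0 x1] := x01.
    rewrite normrX lerXn2r ?nnegrE//.
    have -> : f x - phi n x = f x * (1 - cutoff n x) by rewrite /phi; ring.
    rewrite normrM; apply: (@le_trans _ _ (`|f x| * 1)).
      by apply: ler_wpM2l => //; rewrite ler_norml; apply/andP; split; lra.
    have t : 0 <= 1 - 2 * (x * (1 - x)).
      have -> : 1 - 2 * (x * (1 - x)) = x ^+ 2 + (1 - x) ^+ 2 by ring.
      by rewrite addr_ge0// sqr_ge0.
    by rewrite mulr1; apply: (le_trans h); have := mulr_ge0 L0 t; lra.
  - move=> x x01; apply: (ev (fun n x => (f x - phi n x) ^+ 2) (fun x z => (f x - f x * expR (- z)) ^+ 2)) => //.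
    + by move=> n y0; rewrite /phi /cutoff bumpE y0.
    + have d (z : R) : is_derive z 1 (fun z => (f x - f x * expR (- z)) ^+ 2) (2 * (f x - f x * expR (- z)) * (f x * expR (- z))).
        by apply: is_derive_eq; rewrite /GRing.scale /=; ring.
      exact: derive_continuous d.
    + by rewrite oppr0 expR0 mulr1 subrr expr0n.
have l2 : intab 0 1 (fun x => (f' x - phi' n x) ^+ 2) @[n --> \oo] --> (0 : R).
  suff : intab 0 1 (fun x => (f' x - phi' n x) ^+ 2) @[n --> \oo] --> intab 0 1 (fun=> 0 : R) by rewrite (intab_cst 0 ler01) mul0r.
  apply: (@intab_dct R 0 1 (fun n => (fun x => (f' x - phi' n x) ^+ 2)) (fun=> 0) (fun=> (L + 2 * L * C) ^+ 2)).
  - by move=> n; apply: mcf; exact: sqc.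
  - exact: measurable_cst.
  - by apply: itg_continuous => x; exact: cvg_cst.
  - move=> n x x01; have [h' h] := HL x x01; have /andP[c1 c2] := chi01 n x; have /andP[x0 x1] := x01.
    rewrite normrX lerXn2r ?nnegrE//; first by rewrite addr_ge0// !mulr_ge0.
    have -> : f' x - phi' n x = f' x * (1 - cutoff n x) - f x * cutoff' n x by rewrite /phi'; ring.
    apply: (le_trans (ler_normB _ _)); rewrite (normrM (f' x)) (normrM (f x)); apply: lerD.
      apply: (@le_trans _ _ (`|f' x| * 1)); last by rewrite mulr1.
      by apply: ler_wpM2l => //; rewrite ler_norml; apply/andP; split; lra.
    apply: (@le_trans _ _ (2 * L * (x * (1 - x)) * `|cutoff' n x|)); first by apply: ler_wpM2r.
    by rewrite -mulrA; apply: ler_wpM2l; [apply: mulr_ge0|exact: HC].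
  - move=> x x01; have /andP[x0 x1] := x01.
    apply: (ev (fun n x => (f' x - phi' n x) ^+ 2) (fun x z => (f' x - (f' x * expR (- z) +
       f x * (1 - 2 * x) / (x * (1 - x)) * ((z + z ^+ 2) * expR (- z)))) ^+ 2)) => //.
    + move=> n y0; rewrite /phi' /cutoff /cutoff' bumpE /flat y0 hornerXn; congr ((_ - (_ + _)) ^+ 2).
      set y := _ - 1 in y0 *; have -> : n.+1%:R = (y + 1) / (x * (1 - x)).
        by rewrite /y subrK mulfK// gt_eqF// mulr_gt0//; lra.
      move: (expR _) => E; field; rewrite !gt_eqF//; lra.
    + move: (f x * _ / _) (f' x) => K a.
      have d (z : R) : is_derive z 1 (fun z => (a - (a * expR (- z) + K * ((z + z ^+ 2) * expR (- z)))) ^+ 2)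
          (2 * (a - (a * expR (- z) + K * ((z + z ^+ 2) * expR (- z)))) *
            (a * expR (- z) - K * ((1 + 2 * z) * expR (- z) - (z + z ^+ 2) * expR (- z)))).
        by apply: is_derive_eq; rewrite /GRing.scale /=; ring.
      exact: derive_continuous d.
    + by rewrite oppr0 expR0 mulr1 expr0n addr0 mul0r mulr0 addr0 subrr expr0n.
have [n [h1 h2]] : exists n, intab 0 1 (fun x => (f x - phi n x) ^+ 2) < e /\
    intab 0 1 (fun x => (f' x - phi' n x) ^+ 2) < e.
  have := l1 => /cvgrPdist_lt /(_ e e0) a1; have := l2 => /cvgrPdist_lt /(_ e e0) a2.
  have [N _ /(_ N (leqnn N)) []] := filterI a1 a2.
  rewrite !sub0r !normrN => b1 b2; exists N.
  by split; [exact: le_lt_trans (ler_norm _) b1|exact: le_lt_trans (ler_norm _) b2].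
exists (phi n); first exact: cutoff_test.
by rewrite dphi.
Unshelve. all: by end_near. Qed.

End boundary_cutoff.

Section weak_derivatives_of_primitives.
Context {R : realType}.
Local Notation mu := (@lebesgue_measure R).
Implicit Types (f u v w p U : R -> R).

(** Elements of L_2 are asked to be measurable on the whole line. *)
Definition zero_out f : R -> R := f \_ `[0, 1].

Lemma zero_outE f x : 0 <= x <= 1 -> zero_out f x = f x.
Proof. by move=> x01; rewrite /zero_out patchE mem_setE in_itv/= x01. Qed.

Lemma zero_out_L2 f : itg 0 1 f -> itg 0 1 (fun x => f x ^+ 2) -> L2_01 (zero_out f).
Proof.
move=> jf jf2; apply/L2_01P; split.
  have : mu.-integrable setT (EFin \o zero_out f).
    by rewrite -restrict_EFin; apply/(integrable_mkcond _ _).1.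
  by case/integrableP => /measurable_EFinP.
by apply: itg_eq jf2 => x x01; rewrite zero_outE.
Qed.

Lemma weak_derivative_intro k u v : L2_01 u -> L2_01 v ->
  (forall phi, test_function phi ->
   intab 0 1 (fun x => u x * phi^`(k)%classic x) = (-1) ^+ k * intab 0 1 (fun x => v x * phi x)) ->
  is_weak_derivative k u v.
Proof.
move=> uL vL H; split=> // phi tp; rewrite !Rint_mu01; first exact: H.
  by apply: measurable_funM; [exact: L2_mfun|exact: test_mfun].
apply: measurable_funM; first exact: L2_mfun.
apply: continuous_mfun; apply: smooth_continuous => j x.
have := test_smooth tp => sp; have := sp (j + k)%N x.
by rewrite /derive1n iterD.
Qed.

(** The fundamental lemma applied to the difference. *)
Lemma weak_derivative_unique k u v v' : L2_01 u -> is_weak_derivative k u v ->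
  is_weak_derivative k u v' -> ae_eq01 v v'.
Proof.
move=> uL Hv Hv'; have [vL _] := Hv; have [vL' _] := Hv'.
have d := L2B vL vL'.
apply/ae_mu01P; have := @ae0_of_bumps _ _ (L2_itg d) _.
move=> H; have {}H : {ae mu, forall x, 0 < x < 1 -> v x - v' x = 0}.
  apply: H => a b n a0 ab b1; have tb := itv_bump_test n a0 (ltW ab) b1.
  rewrite (@eq_intab _ _ _ _ (fun x => v x * itv_bump a b n x - v' x * itv_bump a b n x)); last by move=> x _; ring.
  rewrite intabB; [|by apply: itg_test => //; exact: L2_itg|by apply: itg_test => //; exact: L2_itg].
  apply/eqP; rewrite subr_eq0; apply/eqP.
  apply: (@mulfI _ ((-1) ^+ k)); first by rewrite signr_eq0.
  by rewrite -(weak_derivativeP uL Hv tb) -(weak_derivativeP uL Hv' tb).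
apply: filterS H; first exact: (ae_filter_ringOfSetsType mu).
by move=> x h /h /eqP; rewrite subr_eq0 => /eqP.
Qed.

Lemma itg_prim_sqr P w : prim 0 1 P w -> itg 0 1 P /\ itg 0 1 (fun x => P x ^+ 2).
Proof.
move=> h; split; first by apply: itg_within; exact: prim_within h.
by apply: itg_eq (itg_prod_prim h h) => x _; rewrite expr2.
Qed.

Lemma prim_weak_derivatives u U p w : L2_01 u -> (forall x, 0 <= x <= 1 -> u x = U x) ->
  prim 0 1 U p -> prim 0 1 p w -> itg 0 1 (fun x => w x ^+ 2) ->
  [/\ is_weak_derivative 0 u u, is_weak_derivative 1 u (zero_out p) &
      is_weak_derivative 2 u (zero_out w)].
Proof.
move=> uL uU Up pw iw2; have [ip ip2] := itg_prim_sqr pw; have [iw _] := pw.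
split; apply: weak_derivative_intro => //; try exact: zero_out_L2.
- by move=> phi tp; rewrite expr0 mul1r.
- move=> phi tp; rewrite expr1 mulN1r.
  rewrite (@eq_intab _ _ _ _ (fun x => U x * phi^`()%classic x)); last by move=> x /uU ->.
  by rewrite (prim_test_ibp Up tp); congr (- _); apply: eq_intab => x x01; rewrite zero_outE.
- move=> phi tp; rewrite sqrrN expr1n mul1r; have tp' := test_derive tp.
  rewrite (@eq_intab _ _ _ _ (fun x => U x * (phi^`()^`())%classic x)); last by move=> x /uU ->.
  rewrite (prim_test_ibp Up tp') (prim_test_ibp pw tp) opprK.
  by apply: eq_intab => x x01; rewrite zero_outE.
Qed.

End weak_derivatives_of_primitives.

(** * The extremal function as an element of the space, sup norms *)

Section green_membership.
Context {R : realType}.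
Local Notation mu := (@lebesgue_measure R).
Local Notation green := (@green_lim R).
Local Notation k := ((@green_jump R)^-1).
Implicit Types (x : R) (u : R -> R).

Lemma primZ P w (c : R) : prim 0 1 P w -> prim 0 1 (fun x => c * P x) (fun x => c * w x).
Proof.
move=> [i h]; split; first exact: itgZ.
by move=> x x01; have [x0 x1] := andP x01; rewrite h// mulrDr intabZ//; exact: itg_sub i.
Qed.

Lemma H2repZ U p w (c : R) : H2rep U p w ->
  H2rep (fun x => c * U x) (fun x => c * p x) (fun x => c * w x).
Proof.
move=> [Up pw iw2 U0 U1]; split; try exact: primZ; try by rewrite ?U0 ?U1 mulr0.
by apply: itg_eq (itgZ (c ^+ 2) iw2) => x _; rewrite exprMn.
Qed.

Lemma green_lim_rep : H2rep (fun x => k * green0 x) (fun x => k * green1 x) (fun x => k * green2 x).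
Proof. exact: H2repZ green_rep. Qed.

Lemma green_lim_L2 : L2_01 green.
Proof.
apply/L2_01P; split; first exact: green_lim_mfun.
have [Up _ _ _ _] := green_lim_rep; have [_ i] := itg_prim_sqr Up.
by apply: itg_eq i => x x01; rewrite green_limE.
Qed.

Lemma green_lim_weak : [/\ is_weak_derivative 0 green green,
  is_weak_derivative 1 green (zero_out (fun x => k * green1 x)) &
  is_weak_derivative 2 green (zero_out (fun x => k * green2 x))].
Proof.
have [Up pw iw2 _ _] := green_lim_rep.
by apply: (prim_weak_derivatives green_lim_L2 _ Up pw iw2) => x; exact: green_limE.
Qed.

Lemma green_lim_sobolev m : (m <= 2)%N -> sobolevH m green.
Proof.
move=> m2; split; first exact: green_lim_L2.
have [w0 w1 w2] := green_lim_weak.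
by case=> [|[|[|j]]] jm; [eexists; exact: w0|eexists; exact: w1|eexists; exact: w2|
  have := leq_trans jm m2].
Qed.

Lemma normL2_weak_derivative j u v : sobolevH j u -> is_weak_derivative j u v ->
  forall g, L2_01 g ->
  normL2 (weak_derivative j u \- g) = (Num.sqrt (intab 0 1 (fun x => (v x - g x) ^+ 2)))%:E.
Proof.
move=> su uv g gL; have uL : L2_01 u by case: su.
have W := sobolev_weak su (leqnn j); have [WL _] := W; have [vL _] := uv.
have vg := L2B vL gL; rewrite -(normL2E vg).
apply: normL2_ae; [exact: L2_mfun (L2B WL gL)|exact: L2_mfun vg|].
have := weak_derivative_unique uL W uv.
apply: filterS; first exact: (ae_filter_ringOfSetsType (@mu01 R)).
by move=> x /= ->.
Qed.

(** A partial sum close to the limit in C^1 vanishes at 0 and 1, hence is itself close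
    in H^1 to a test function. *)
Lemma green_lim_H10 : sobolevH10 green.
Proof.
split=> [|e e0]; first exact: green_lim_sobolev.
pose d := e ^+ 2 / 32; have d0 : 0 < d by rewrite /d divr_gt0// exprn_gt0.
have [N _ /(_ N (leqnn N))] := (cvgrPdist_lt _ _).1 green_gap_cvg d d0.
rewrite sub0r normrN ger0_norm ?green_gap_ge0// => gN.
have [Sp Sq _ S0 S1] := sine_sum_rep (R := R) N.
have dS0 (x : R) : is_derive x 1 (sine_sum sine0 N) (sine_sum sine1 N x).
  by apply: sine_sum_derive => n; have [dd _ _ _] := sineP (R := R) n.
have dS1 (x : R) : is_derive x 1 (sine_sum sine1 N) (sine_sum sine2 N x).
  by apply: sine_sum_derive => n; have [_ dd _ _] := sineP (R := R) n.
have sS : smooth (sine_sum sine0 N : R -> R).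
  apply: smooth_sum => n; apply: smoothM; first exact: smooth_cst.
  apply: smooth_comp; first exact: smooth_sin.
  have := @smooth_affine R 0 (pi * n%:R); congr smooth; apply/funext => x; ring.
have [phi tphi [h0 h1]] := boundary_approx sS dS0 (derive_continuous dS1) S0 S1 d0.
have sphi := test_smooth tphi.
have cphi := smooth_continuous sphi; have cphi' := smooth_continuous (smooth_derive sphi).
exists phi => //.
have [_ w1 _] := green_lim_weak.
have pL := L2_continuous cphi; have pL' := L2_continuous cphi'.
rewrite (normL2_weak_derivative (green_lim_sobolev (isT : (1 <= 2)%N)) w1 pL').
rewrite (normL2E (L2B green_lim_L2 pL)) -EFinD lte_fin.
have approx (g S psi : R -> R) : (forall x, 0 <= x <= 1 -> `|S x - g x| <= Num.sqrt (green_gap N)) ->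
    itg 0 1 (fun x => (g x - psi x) ^+ 2) -> itg 0 1 (fun x => (S x - psi x) ^+ 2) ->
    intab 0 1 (fun x => (S x - psi x) ^+ 2) < d ->
    Num.sqrt (intab 0 1 (fun x => (g x - psi x) ^+ 2)) < e / 2.
  move=> gS i1 i2 hd.
  rewrite -[ltRHS]ger0_norm; last by rewrite divr_ge0// ltW.
  rewrite -sqrtr_sqr ltr_sqrt; last by rewrite exprn_gt0// divr_gt0.
  have ic : itg 0 1 (fun _ : R => 2 * green_gap N) by apply: itg_continuous => x; exact: cvg_cst.
  have : intab 0 1 (fun x => (g x - psi x) ^+ 2) <= intab 0 1 (fun x => 2 * green_gap N + 2 * (S x - psi x) ^+ 2).
    apply: le_intab => //; first by apply: itgD => //; exact: itgZ.
    move=> x x01; have h : (S x - g x) ^+ 2 <= green_gap N.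
      rewrite -[leRHS]sqr_sqrtr ?green_gap_ge0// -real_normK ?num_real//.
      by rewrite lerXn2r ?nnegrE ?sqrtr_ge0// gS.
    have := sqr_ge0 (S x - g x + (S x - psi x)); nra.
  rewrite intabD//; last exact: itgZ.
  rewrite (intab_cst _ ler01) intabZ// subr0 mulr1 => /le_lt_trans; apply.
  have -> : (e / 2) ^+ 2 = 8 * d by rewrite /d; field.
  lra.
have l0 := approx green (sine_sum sine0 N) phi.
have l1 := approx (zero_out (fun x => k * green1 x)) (sine_sum sine1 N) phi^`()%classic.
suff : Num.sqrt (intab 0 1 (fun x => (green x - phi x) ^+ 2)) < e / 2 /\
   Num.sqrt (intab 0 1 (fun x => (zero_out (fun x => k * green1 x) x - phi^`()%classic x) ^+ 2)) < e / 2.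
  by move=> [a1 a2]; lra.
split; [apply: l0 => //|apply: l1 => //].
- by move=> x x01; rewrite green_limE//; exact: residual_sup0.
- exact: L2_itg2 (L2B green_lim_L2 pL).
- by have [i _] := itg_prim_sqr Sp; apply: L2_itg2; apply: L2B => //; apply: L2_continuous; exact: derive_continuous dS0.
- by move=> x x01; rewrite zero_outE//; exact: residual_sup1.
- by case: w1 => wL _; exact: L2_itg2 (L2B wL pL').
- by apply: L2_itg2; apply: L2B => //; apply: L2_continuous; exact: derive_continuous dS1.
Qed.

Lemma green_lim_H2_H10 : H2_H10 green.
Proof. by split; [exact: green_lim_sobolev|exact: green_lim_H10]. Qed.

End green_membership.

Section sup_norm.
Context {R : realType}.
Local Notation mu := (@lebesgue_measure R).
Implicit Types (x xi M : R) (u U p w : R -> R).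

Lemma normLoo_le u U M : ae_eq01 u U -> (forall x, 0 <= x <= 1 -> `|U x| <= M) ->
  (normLoo u <= M%:E)%E.
Proof.
move=> uU UM; rewrite /normLoo unlock /Lnorm mu01T lte_fin ltr01.
apply/ess_supP; apply/ae_mu01P.
have := (ae_mu01P _).1 uU; apply: filterS; first exact: (ae_filter_ringOfSetsType mu).
by move=> x /= h /[dup] /h -> /andP[x0 x1]; rewrite lee_fin UM// !ltW.
Qed.

(** If |U| were almost everywhere at most some c < |U xi|, the positive part of
    |U| - c would have zero integral, hence vanish at xi. *)
Lemma normLoo_ge u U xi : ae_eq01 u U -> {within `[0, 1], continuous U} -> 0 < xi < 1 ->
  (`|U xi|%:E <= normLoo u)%E.
Proof.
move=> uU cU xi01; rewrite leNgt; apply/negP => lt.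
have n0 : (0 <= normLoo u)%E by exact: Lnorm_ge0.
move: lt; rewrite /normLoo unlock /Lnorm mu01T lte_fin ltr01 => lt.
have ae := @ess_sup_ge _ _ _ (@mu01 R) (abse \o (EFin \o u)).
move: n0; rewrite /normLoo unlock /Lnorm mu01T lte_fin ltr01; move: lt ae.
case: (ess_sup _ _) => [c| |]//; rewrite lte_fin lee_fin => lt ae c0.
pose f x := Num.max (`|U x| - c) 0.
have cf : {within `[0, 1], continuous f}.
  apply: (@within_continuous_comp _ _ _ _ U (fun y => Num.max (`|y| - c) 0)) => // y _.
  apply: (@continuous_max _ _ (fun y => `|y| - c) (fun=> 0)); last exact: cvg_cst.
  by apply: cvgB; [exact: norm_continuous|exact: cvg_cst].
have f0 : intab 0 1 f = 0.
  suff -> : intab 0 1 f = intab 0 1 (fun=> 0 : R) by rewrite (intab_cst 0 ler01) mul0r.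
  apply: eq_ae_intab; [exact: itg_mfun (itg_within cf)|exact: measurable_cst|].
  have h1 := (ae_mu01P _).1 uU; have h2 := (ae_mu01P _).1 ae.
  apply: filterS2 h1 h2; first exact: (ae_filter_ringOfSetsType mu).
  move=> x /= h1 h2 x01; have := h2 x01; rewrite h1// lee_fin => h.
  by apply/max_idPr; rewrite subr_le0.
have fge0 x : 0 <= x <= 1 -> 0 <= f x by rewrite /f le_max lexx orbT.
have h := intab_eq0 ler01 cf fge0 f0 xi01.
have : `|U xi| - c <= f xi by rewrite /f le_max lexx.
by rewrite h subr_le0 leNgt lt.
Qed.

Lemma sup_point U p w : H2rep U p w -> exists xi, [/\ 0 <= xi <= 1,
  forall x, 0 <= x <= 1 -> `|U x| <= `|U xi| & U xi != 0 -> 0 < xi < 1 /\ p xi = 0].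
Proof.
move=> [Up pw _ U0 U1]; have cU := prim_within ler01 Up; have cp := prim_within ler01 pw.
have cn : {within `[0, 1], continuous (fun x => `|U x|)}.
  by apply: (@within_continuous_comp _ _ _ _ U (fun y => `|y|)) => // y _; exact: norm_continuous.
have [xi xi01 mx] := EVT_max ler01 cn.
have {}mx x : 0 <= x <= 1 -> `|U x| <= `|U xi| by move=> x01; apply: mx; rewrite in_itv.
move: xi01; rewrite in_itv/= => xi01; exists xi; split=> // Uxi.
have xi_in : 0 < xi < 1.
  have /andP[x0 x1] := xi01.
  have n0 : xi != 0 by apply: contraNneq Uxi => ->; rewrite U0.
  have n1 : xi != 1 by apply: contraNneq Uxi => ->; rewrite U1.
  by rewrite !lt_neqAle eq_sym n0 n1 x0 x1.
split=> //.
have der x : x \in `]0, 1[ -> is_derive x 1 U (p x).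
  by rewrite in_itv => /= x01; exact: prim_derivable Up cp x01.
have dU x : x \in `]0, 1[ -> derivable U x 1 by move=> /der[].
have xi_in' : xi \in `]0, 1[ by rewrite in_itv.
have bnd x : x \in `]0, 1[ -> `|U x| <= `|U xi|.
  by rewrite in_itv /= => /andP[x0 x1]; apply: mx; rewrite !ltW.
have [_ <-] := der _ xi_in'.
suff [_ ->] : is_derive xi 1 U 0 by [].
have [pos|neg] := leP 0 (U xi).
  apply: (derive1_at_max ler01 dU xi_in') => t /bnd; rewrite (ger0_norm pos).
  exact: le_trans (ler_norm _).
apply: (derive1_at_min ler01 dU xi_in') => t /bnd; rewrite (ltr0_norm neg) => h.
by have := ler_norm (- U t); rewrite normrN; lra.
Qed.

End sup_norm.

(** * The sharp inequality and its extremal functions *)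

Section optimisation.
Context {R : realType}.
Local Notation s := (coth (pi / 2) : R).
Implicit Types (a b c x A B M : R).

Definition sharp_constant : R := Num.sqrt 2 / (27 `^ (1 / 4)) * s.

Lemma sharp_constant_parts : exists q r : R,
  [/\ 0 < q, 0 < r, q ^+ 2 = 2, r ^+ 4 = 27 & sharp_constant = q / r * s].
Proof.
exists (Num.sqrt 2), (27 `^ (1 / 4)); split.
- by rewrite sqrtr_gt0.
- by rewrite powR_gt0.
- by rewrite sqr_sqrtr.
- rewrite -powR_mulrn ?powR_ge0// -powRrM (_ : 1 / 4 * 4%:R = 1); last by field.
  by rewrite powRr1.
- by [].
Qed.

Lemma coth_gt0 : 0 < s. Proof. by have := @coth_pihalf_gt1 R; lra. Qed.

Lemma sharp_constant_gt0 : 0 < sharp_constant.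
Proof.
have [q [r [q0 r0 _ _ ->]]] := sharp_constant_parts.
by apply: mulr_gt0; [exact: divr_gt0|exact: coth_gt0].
Qed.

(** Here a^2 and c^2 stand for the norms of u'' and u.  The condition on b is the
    stationarity of s (a^4 + 4 b^4 c^4) / (8 b^3); it amounts to
    b c r q = 3 a with r^4 = 27 and q^2 = 2. *)
Lemma balanced_bound a b c : 0 < b -> 0 <= a -> 0 <= c ->
  4 * b ^+ 4 * c ^+ 4 = 3 * a ^+ 4 ->
  8 * b ^+ 3 * (sharp_constant * c ^+ 3 * a) = s * (a ^+ 4 + 4 * b ^+ 4 * c ^+ 4).
Proof.
move=> b0 a0 c0 E; have [q [r [q0 r0 q2 r4 ->]]] := sharp_constant_parts.
have t : b * c * (r * q) = 3 * a.
  apply/eqP; rewrite -(@eqrXn2 _ 4)//; [|by rewrite !mulr_ge0// ltW|by rewrite mulr_ge0].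
  have -> : (b * c * (r * q)) ^+ 4 = 4 * b ^+ 4 * c ^+ 4 * r ^+ 4 * (q ^+ 2) ^+ 2 / 4 by field.
  by rewrite E r4 q2; apply/eqP; field.
have -> : 8 * b ^+ 3 * (q / r * s * c ^+ 3 * a) = 8 * (b * c * (r * q)) ^+ 3 * a * s / (r ^+ 4 * q ^+ 2).
  by field; rewrite !lt0r_neq0.
by rewrite t r4 q2 E; field.
Qed.

Lemma balance_exists a c : 0 < a -> 0 < c ->
  exists2 b : R, 0 < b & 4 * b ^+ 4 * c ^+ 4 = 3 * a ^+ 4.
Proof.
move=> a0 c0; have [q [r [q0 r0 q2 r4 _]]] := sharp_constant_parts.
exists (3 * a / (r * q * c)).
  by apply: divr_gt0; [exact: mulr_gt0|apply: mulr_gt0 => //; exact: mulr_gt0].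
have -> : 4 * (3 * a / (r * q * c)) ^+ 4 * c ^+ 4 = 324 * a ^+ 4 / (r ^+ 4 * (q ^+ 2) ^+ 2).
  by field; rewrite !lt0r_neq0.
by rewrite r4 q2; field.
Qed.

(** When one of the norms vanishes no b is balanced; letting b tend to 0 or to
    infinity shows that the maximum vanishes too. *)
Lemma degenerate_bound M a c : 0 <= a -> 0 <= c -> a = 0 \/ c = 0 ->
  (forall b, 0 < b -> 8 * b ^+ 3 * M ^+ 2 <= s * (a ^+ 4 + 4 * b ^+ 4 * c ^+ 4)) -> M = 0.
Proof.
move=> a0 c0 ac H; apply/eqP; apply: contraT => Mn0.
have M2 : 0 < M ^+ 2 by rewrite exprn_even_gt0.
have s0 := coth_gt0.
case: ac => e; rewrite e in H.
  have B0 : 0 <= c ^+ 4 by exact: exprn_ge0.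
  have sB : 0 < s * (c ^+ 4 + 1) by apply: mulr_gt0 => //; lra.
  pose b := M ^+ 2 / (s * (c ^+ 4 + 1)).
  have b0 : 0 < b by exact: divr_gt0.
  have := H b b0; have bE : b * (s * (c ^+ 4 + 1)) = M ^+ 2 by rewrite /b divfK// gt_eqF.
  rewrite -bE.
  have -> : s * (0 ^+ 4 + 4 * b ^+ 4 * c ^+ 4) = 4 * b ^+ 4 * s * c ^+ 4 by ring.
  have -> : 8 * b ^+ 3 * (b * (s * (c ^+ 4 + 1))) = 8 * b ^+ 4 * s * c ^+ 4 + 8 * b ^+ 4 * s by ring.
  have t : 0 < b ^+ 4 * s by apply: mulr_gt0 => //; exact: exprn_gt0.
  have t' : 0 <= b ^+ 4 * s * c ^+ 4 by apply: mulr_ge0 => //; exact: ltW.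
  lra.
have A0 : 0 <= s * a ^+ 4 by apply: mulr_ge0; [exact: ltW|exact: exprn_ge0].
pose b := 1 + s * a ^+ 4 / M ^+ 2.
have b1 : 1 <= b by rewrite lerDl divr_ge0// ltW.
have := H b ltac:(lra).
have -> : s * (a ^+ 4 + 4 * b ^+ 4 * 0 ^+ 4) = s * a ^+ 4 by ring.
have b3 : b <= b ^+ 3 by have := exprn_ege1 2 b1; rewrite [b ^+ 3]exprS => h; rewrite ler_peMr//; lra.
have h1 : b * M ^+ 2 <= b ^+ 3 * M ^+ 2 by rewrite ler_wpM2r// ltW.
have h2 : b * M ^+ 2 = M ^+ 2 + s * a ^+ 4 by rewrite /b; field.
lra.
Qed.

Lemma sqrt_powR A : 0 <= A -> let a := Num.sqrt A `^ (1 / 2) in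
  [/\ 0 <= a, a ^+ 4 = A & Num.sqrt A `^ (3 / 2) = a ^+ 3].
Proof.
move=> A0 a; have a0 : 0 <= a by exact: powR_ge0.
have aE (n : nat) : a ^+ n = Num.sqrt A `^ (1 / 2 * n%:R) by rewrite powRrM powR_mulrn.
split=> //; last by rewrite aE; congr (_ `^ _); field.
rewrite (exprM a 2 2) aE (_ : 1 / 2 * 2%:R = 1); last by field.
by rewrite powRr1 ?sqrtr_ge0// sqr_sqrtr.
Qed.

End optimisation.

Section sharp_inequality.
Context {R : realType}.
Local Notation mu := (@lebesgue_measure R).
Local Notation K := (@sharp_constant R).
Local Notation s := (coth (pi / 2) : R).
Implicit Types (x xi C : R) (u U p w : R -> R).

(** This is split_estimate for the balanced b; in the case of equality that b is pi,
    and the profile found there is the sum of the sine series. *)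
Lemma sharp_point_estimate U p w xi (A := intab 0 1 (fun x => w x ^+ 2)) (B := intab 0 1 (fun x => U x ^+ 2)) :
  H2rep U p w -> (U xi != 0 -> 0 < xi < 1 /\ p xi = 0) ->
  let S := Num.sqrt B `^ (3 / 2) * Num.sqrt A `^ (1 / 2) in
  U xi ^+ 2 <= K * S /\
  (U xi ^+ 2 = K * S -> U xi != 0 ->
   exists2 c : R, c != 0 & forall x, 0 < x < 1 -> x != 1 / 2 -> U x = c * green_lim x).
Proof.
move=> rep Hxi S.
have A0 : 0 <= A by apply: intab_ge0 => x _; exact: sqr_ge0.
have B0 : 0 <= B by apply: intab_ge0 => x _; exact: sqr_ge0.
have [a0 aA _] := sqrt_powR A0; have [c0 cB cE] := sqrt_powR B0.
have SE : K * S = K * (Num.sqrt B `^ (1 / 2)) ^+ 3 * Num.sqrt A `^ (1 / 2) by rewrite /S cE mulrA.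
rewrite SE {SE cE S}; move: a0 aA c0 cB.
move: (Num.sqrt A `^ (1 / 2)) (Num.sqrt B `^ (1 / 2)) => a c a0 aA c0 cB.
have K0 := @sharp_constant_gt0 R.
have [U0|Uxi] := eqVneq (U xi) 0.
  have KS0 : 0 <= K * c ^+ 3 * a.
    by apply: mulr_ge0 a0; apply: mulr_ge0; [exact: ltW|exact: exprn_ge0].
  by split; [rewrite U0 expr0n; exact: KS0|move=> _ []].
have [xi01 pxi] := Hxi Uxi.
have est (b : R) := @split_estimate R U p w xi b rep xi01 pxi.
rewrite /= -/A -/B in est; move: A B est aA cB {A0 B0} => A B est aA cB.
have [ac|] := pselect (a = 0 \/ c = 0).
  exfalso; move/eqP: Uxi; apply; apply: (degenerate_bound a0 c0 ac) => b b0.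
  by have [h _] := est b b0; rewrite aA -mulrA cB mulrA.
move=> /not_orP[/eqP an0 /eqP cn0].
have ap : 0 < a by rewrite lt_neqAle eq_sym an0.
have cp : 0 < c by rewrite lt_neqAle eq_sym cn0.
have [b b0 Eb] := balance_exists ap cp.
have bal := balanced_bound b0 a0 c0 Eb; rewrite aA cB in bal.
have [h1 h2] := est b b0; rewrite -bal in h1 h2.
have b3 : 0 < 8 * b ^+ 3 by apply: mulr_gt0 => //; exact: exprn_gt0.
split; first by rewrite -(ler_pM2l b3).
move=> E _; have E' : 8 * b ^+ 3 * U xi ^+ 2 = 8 * b ^+ 3 * (K * c ^+ 3 * a) by rewrite E.
have [_ [k k0 Hk]] := h2 E' Uxi.
have J0 := @green_jump_gt0 R.
exists (k * green_jump); first by rewrite mulf_neq0// gt_eqF.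
move=> x x01 x2; rewrite (Hk x x01 x2); have /andP[x0 x1] := x01.
rewrite green_limE; last by rewrite !ltW.
have prof (y : R) : extremal_profile y = beam0 1 1 pi y by rewrite /extremal_profile /beam0 !mul1r.
rewrite -mulrA mulVKf; last by rewrite gt_eqF.
congr (_ * _).
by rewrite /green0 /fold_even; case: (ltgtP x (1 / 2)) x2 => [| |->]; rewrite ?prof ?eqxx.
Qed.

Lemma rhs_rep C u U p : H2_H10 u -> H2rep U p (weak_derivative 2 u) -> ae_eq01 u U ->
  inequality_rhs C u = (C * (Num.sqrt (intab 0 1 (fun x => U x ^+ 2)) `^ (3 / 2)
    * Num.sqrt (intab 0 1 (fun x => weak_derivative 2 u x ^+ 2)) `^ (1 / 2)))%:E.
Proof.
move=> [su _] [Up pw iw2 _ _] uU; have uL : L2_01 u by case: su.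
have [wL _] := sobolev_weak su (leqnn 2).
rewrite /inequality_rhs !normL2E// !poweR_EFin -!EFinM mulrA.
suff -> : intab 0 1 (fun x => u x ^+ 2) = intab 0 1 (fun x => U x ^+ 2) by [].
have [_ iU2] := itg_prim_sqr Up.
apply: eq_ae_intab; [exact: itg_mfun (L2_itg2 uL)|exact: itg_mfun iU2|].
have := (ae_mu01P _).1 uU; apply: filterS; first exact: (ae_filter_ringOfSetsType mu).
by move=> x /= h /h ->.
Qed.

Lemma lee_sqr (x y : \bar R) : (0 <= x -> x <= y -> x ^+ 2 <= y ^+ 2)%E.
Proof. by move=> x0 xy; rewrite !expe2 lee_pmul. Qed.

Lemma sharp_inequality u : H2_H10 u -> (inequality_lhs u <= inequality_rhs K u)%E.
Proof.
move=> hu; have [U [p [rep uU]]] := H2_H10_rep hu.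
have [xi [xi01 mx Hxi]] := sup_point rep.
have [est _] := sharp_point_estimate rep Hxi.
rewrite (rhs_rep _ hu rep uU); apply: (@le_trans _ _ ((`|U xi| ^+ 2)%:E)).
  rewrite /inequality_lhs EFin_expe; apply: lee_sqr; [exact: Lnorm_ge0|exact: (normLoo_le uU mx)].
by rewrite lee_fin real_normK ?num_real.
Qed.

Lemma ae_neq (c : R) : {ae mu, forall x, x <> c}.
Proof.
exists [set c]; split => //; first exact: lebesgue_measure_set1.
by move=> x /= nx; apply: contrapT => xc; apply: nx.
Qed.

(** The sup norm of u is at most |U xi|, and sharp_point_estimate bounds |U xi| by the
    right-hand side, so equality for u is equality in sharp_point_estimate. *)
Lemma extremal_unique u : is_extremal K u -> exists2 c : R, c != 0 & ae_eq01 u (fun x => c * green_lim x).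
Proof.
move=> [hu un0 eq]; have [U [p [rep uU]]] := H2_H10_rep hu.
have [xi [xi01 mx Hxi]] := sup_point rep.
have [est eqc] := sharp_point_estimate rep Hxi.
have Uxi : U xi != 0.
  apply/negP => /eqP U0; apply: un0; apply/ae_mu01P.
  have := (ae_mu01P _).1 uU; apply: filterS; first exact: (ae_filter_ringOfSetsType mu).
  move=> x /= h /[dup] /h -> /andP[x0 x1].
  by have := mx x; rewrite U0 normr0 normr_le0 => /(_ _)/eqP ->//; rewrite !ltW.
have eqU : U xi ^+ 2 = K * (Num.sqrt (intab 0 1 (fun x => U x ^+ 2)) `^ (3 / 2)
    * Num.sqrt (intab 0 1 (fun x => weak_derivative 2 u x ^+ 2)) `^ (1 / 2)).
  apply/le_anti; rewrite est /=.
  rewrite -lee_fin -(rhs_rep _ hu rep uU) -eq -real_normK ?num_real// EFin_expe.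
  by apply: lee_sqr; [exact: Lnorm_ge0|exact: (normLoo_le uU mx)].
have [c c0 Hc] := eqc eqU Uxi.
exists c => //; apply/ae_mu01P.
have h1 := (ae_mu01P _).1 uU; have h2 := @ae_neq (1 / 2).
apply: filterS2 h1 h2; first exact: (ae_filter_ringOfSetsType mu).
by move=> x /= h1 h2 x01; rewrite h1// Hc//; apply/eqP.
Qed.

(** By equipartition the balanced b for the extremal function is pi. *)
Lemma green_lim_rhs : exists S : R, [/\ 0 < S,
  forall C, inequality_rhs C green_lim = (C * S)%:E & K * S = (cosh (pi / 2) / green_jump) ^+ 2].
Proof.
have J0 := @green_jump_gt0 R; set k := green_jump^-1.
have [Up pw iw2 _ _] := @green_lim_rep R.
have [_ _ w2] := @green_lim_weak R; have [w2L _] := w2.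
have su := @green_lim_sobolev R 2 (leqnn 2).
pose A := intab 0 1 (fun x => (k * green2 x) ^+ 2); pose B := intab 0 1 (fun x => (k * green0 x) ^+ 2).
have A0 : 0 <= A by apply: intab_ge0 => x _; exact: sqr_ge0.
have B0 : 0 <= B by apply: intab_ge0 => x _; exact: sqr_ge0.
have [a0 aA _] := sqrt_powR A0; have [c0 cB cE] := sqrt_powR B0.
have nA : normL2 (weak_derivative 2 green_lim) = (Num.sqrt A)%:E.
  have [WL _] := sobolev_weak su (leqnn 2).
  rewrite (normL2_ae (L2_mfun WL) (L2_mfun w2L)).
    by rewrite normL2E//; congr ((Num.sqrt _)%:E); apply: eq_intab => x x01; rewrite zero_outE.
  exact: weak_derivative_unique (@green_lim_L2 R) (sobolev_weak su (leqnn 2)) w2.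
have nB : normL2 green_lim = (Num.sqrt B)%:E.
  rewrite (normL2E (@green_lim_L2 R)).
  suff -> : intab 0 1 (fun x => green_lim x ^+ 2) = B by [].
  by apply: eq_intab => x x01; rewrite green_limE.
have [g0 g1] := @green_prim R; have [_ _ ig2 _ _] := @green_rep R; have [_ ig0] := itg_prim_sqr g0.
have AE : A = k ^+ 2 * intab 0 1 (fun x => green2 x ^+ 2).
  by rewrite -intabZ//; apply: eq_intab => x _; rewrite exprMn.
have BE : B = k ^+ 2 * intab 0 1 (fun x => green0 x ^+ 2).
  by rewrite -intabZ//; apply: eq_intab => x _; rewrite exprMn.
have p0 := @pi_gt0 R.
have eqp : 4 * pi ^+ 4 * B = 3 * A.
  by rewrite AE BE mulrCA -green_equipartition; ring.
have en : A + 4 * pi ^+ 4 * B = k * cosh (pi / 2).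
  have := @green_energies R => /= e.
  transitivity (k ^+ 2 * (green_jump * cosh (pi / 2))); first by rewrite -e AE BE; ring.
  by rewrite /k; field; exact: lt0r_neq0.
have C0 := @cosh_gt0 R (pi / 2).
have k0 : 0 < k by rewrite invr_gt0.
move: A B A0 B0 a0 aA c0 cB cE nA nB eqp en {AE BE} => A B A0 B0 a0 aA c0 cB cE nA nB eqp en.
pose S := Num.sqrt B `^ (3 / 2) * Num.sqrt A `^ (1 / 2).
have KS : K * S = (cosh (pi / 2) / green_jump) ^+ 2.
  have := @balanced_bound R _ pi _ p0 a0 c0; rewrite aA cB => /(_ eqp) E.
  rewrite en -cE in E.
  have b3 : 8 * pi ^+ 3 != 0 :> R by rewrite mulf_neq0// expf_neq0// gt_eqF.
  apply: (mulfI b3); rewrite /S [K * _]mulrA E.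
  have tq : 8 * pi ^+ 3 * (cosh (pi / 2) / green_jump) = s.
    by rewrite green_mid mulrC divfK.
  by rewrite expr2 [RHS]mulrA tq [k * _]mulrC.
exists S; split; last exact: KS; last first.
  by move=> C; rewrite /inequality_rhs nA nB !poweR_EFin -!EFinM /S mulrA.
by rewrite -(pmulr_rgt0 _ (@sharp_constant_gt0 R)) KS exprn_gt0// divr_gt0.
Qed.

Lemma green_lim_mid : green_lim (1 / 2) = cosh (pi / 2) / green_jump :> R.
Proof.
rewrite green_limE; last by lra.
by rewrite /green0 fold_evenL// beam_mid mulrC.
Qed.

Lemma green_lim_extremal : is_extremal K green_lim.
Proof.
have hg := @green_lim_H2_H10 R; have [S [S0 rE KS]] := green_lim_rhs.
have J0 := @green_jump_gt0 R; have C0 := @cosh_gt0 R (pi / 2).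
have h12 : 0 < (1 / 2 : R) < 1 by lra.
have cg : {within `[0, 1], continuous (fun x => green_jump^-1 * green0 x : R)}.
  by have [Up _ _ _ _] := @green_lim_rep R; exact: prim_within ler01 Up.
have aeg : ae_eq01 green_lim (fun x => green_jump^-1 * green0 x : R).
  apply/ae_mu01P; apply: aeW => x /= /andP[x0 x1]; apply: green_limE; by rewrite !ltW.
have lhsE : (inequality_lhs (@green_lim R) = ((cosh (pi / 2) / green_jump : R) ^+ 2)%:E)%E.
  have up := sharp_inequality hg; rewrite rE KS in up.
  apply/le_anti; rewrite up /= /inequality_lhs EFin_expe; apply: lee_sqr.
    by rewrite lee_fin divr_ge0// ltW.
  have := normLoo_ge aeg cg h12; rewrite -green_limE ?green_lim_mid; last by rewrite !ltW; lra.
  by rewrite ger0_norm// divr_ge0// ltW.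
split=> //; last by rewrite lhsE rE KS.
move=> g0; have : (normLoo (@green_lim R) <= 0%:E)%E.
  by apply: (normLoo_le g0) => x _; rewrite normr0.
have := normLoo_ge aeg cg h12; rewrite -green_limE ?green_lim_mid; last by lra.
move=> h1 h2; have := le_trans h1 h2; rewrite lee_fin normr_le0.
by rewrite gt_eqF// divr_gt0.
Qed.

(** A smaller constant would fail for the extremal function. *)
Lemma sharp_constant_sharp : is_sharp_constant K.
Proof.
split; first exact: sharp_inequality.
move=> C HC; have [hg _ eq] := green_lim_extremal.
have := HC _ hg; rewrite eq.
have [S [S0 rE _]] := green_lim_rhs; rewrite !rE lee_fin.
by rewrite ler_pM2r.
Qed.

End sharp_inequality.

Theorem theorem3p21 (R : realType) :
  let K : R := Num.sqrt 2 / (27 `^ (1 / 4)) * coth (pi / 2) in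
  let U : R -> R := green_series (4 * pi ^+ 4) (1 / 2) in
  [/\ is_sharp_constant K,
      1 + 9 / 10 ^+ 2 + 3 / 10 ^+ 4 + 3 / 10 ^+ 5 <= coth (pi / 2 : R)
        < 1 + 9 / 10 ^+ 2 + 3 / 10 ^+ 4 + 4 / 10 ^+ 5,
      is_extremal K U &
      forall u : R -> R, is_extremal K u ->
        exists2 c : R, c != 0 & ae_eq01 u (fun x => c * U x)].
Proof.
split.
- exact: sharp_constant_sharp.
- exact: coth_pihalf_bounds.
- exact: green_lim_extremal.
- exact: extremal_unique.
Qed.
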